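(* Let $d\ge2$, $a\in(1-\frac d2,\frac12)$ and $(w(r),\psi(r),\phi(r))=(r^{-2(1-a)},r^a,r^2)$. Let $T_{\mathbb{S}}$ be the operator $$T_{\mathbb{S}}f(\omega)=\frac12\int_{\mathbb{S}^{d-1}}\frac{1}{|\theta-\omega|^{d+2a-2}}\,f(\theta)\,\mathrm{d}\sigma(\theta),\qquad f\in L^2(\mathbb{S}^{d-1}).$$ Then $T_{\mathbb{S}}:L^2(\mathbb{S}^{d-1})\to L^2(\mathbb{S}^{d-1})$ is compact. In fact, if $k\in\mathbb{N}_0$ and $P$ is a solid spherical harmonic of degree $k$ (restricted to $\mathbb{S}^{d-1}$), then $T_{\mathbb{S}}P=\lambda_kP$, where $$\lambda_k=\frac{\pi^{\frac{d-1}{2}}}{2^{2a}}\,\frac{(-1)^k\,\Gamma(\frac12-a)\,\Gamma(2-a-\frac d2)}{\Gamma(2-a-\frac d2-k)\,\Gamma(-a+\frac d2+k)}.$$ The sequence of eigenvalues $(\lambda_k)_{k\ge0}$ is a decreasing sequence converging to zero, and hence the operator norm of $T_{\mathbb{S}}$ is equal to $$\frac{\pi^{\frac{d-1}{2}}}{2^{2a}}\,\frac{\Gamma(\frac12-a)}{\Gamma(-a+\frac d2)}.$$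
   Context: $\mathrm{d}\sigma$ is the induced Lebesgue (surface) measure on the unit sphere $\mathbb{S}^{d-1}\subset\mathbb{R}^d$. A solid spherical harmonic of degree $k$ is a polynomial on $\mathbb{R}^d$ with complex coefficients that is homogeneous of degree $k$ and harmonic. When $2-a-\frac d2$ is a non-positive integer, the quotient $\Gamma(2-a-\frac d2)/\Gamma(2-a-\frac d2-k)$ is understood by continuity, i.e. as the product $\prod_{j=1}^{k}(2-a-\frac d2-j)$ (which equals the quotient in all other cases; empty product $=1$). The operator depends on $(w,\psi,\phi)$ only through $a$ and $d$; it is the spherical analogue of $S^*S$ up to a constant, where $S$ is the oscillatory integral operator associated with $(w,\psi,\phi)$. *)

(* Defs.v *)
From HB Require Import structures.
From mathcomp Require Import all_boot all_order all_algebra.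
From mathcomp Require Import -(notations) mpoly.
From mathcomp Require Import all_classical all_reals all_analysis measurable_realfun.
From mathcomp Require Import complex.

Set Implicit Arguments.
Unset Strict Implicit.
Unset Printing Implicit Defensive.

Import Order.TTheory GRing.Theory Num.Theory.
Import numFieldNormedType.Exports.

Local Open Scope classical_set_scope.
Local Open Scope ring_scope.
Local Open Scope complex_scope.

Section euclidean.
Context (R : realType) (n : nat).
Implicit Types x y : n.-tuple R.

Definition enorm x : R := Num.sqrt (\sum_(i < n) tnth x i ^+ 2).

Definition edist x y : R := enorm [tuple tnth x i - tnth y i | i < n].

Lemma measurable_enorm : measurable_fun setT enorm.
Proof.
apply: (@measurableT_comp _ _ _ _ _ _ (@Num.sqrt R)).
  by apply: continuous_measurable_fun; exact: sqrt_continuous.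
apply: measurable_sum => i; apply: measurable_funX; exact: measurable_tnth.
Qed.

End euclidean.

Section lebesgue_step.
Context (R : realType) (n : nat).
Variable m : {sigma_finite_measure set (n.-tuple R) -> \bar R}.

Definition tcons (p : measurableTypeR R * n.-tuple R) : n.+1.-tuple R := [tuple of p.1 :: p.2].

Lemma measurable_tcons : measurable_fun setT tcons.
Proof. exact: measurable_cons. Qed.

HB.instance Definition _ := isMeasurableFun.Build _ _ _ _ tcons measurable_tcons.

Definition lebesgue_step : set (n.+1.-tuple R) -> \bar R :=
  pushforward (lebesgue_measure \x m)%E tcons.

Let lebesgue_step0 : lebesgue_step set0 = 0%E.
Proof. exact: measure0. Qed.

Let lebesgue_step_ge0 A : (0 <= lebesgue_step A)%E.
Proof. exact: measure_ge0. Qed.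

Let lebesgue_step_sigma_additive : semi_sigma_additive lebesgue_step.
Proof. exact: measure_semi_sigma_additive. Qed.

HB.instance Definition _ := isMeasure.Build _ _ _ lebesgue_step
  lebesgue_step0 lebesgue_step_ge0 lebesgue_step_sigma_additive.

Let lebesgue_step_sigma_finite : sigma_finite setT lebesgue_step.
Proof.
have /sigma_finiteP[F [FT Fnd Foo]] := sigma_finiteT (@lebesgue_measure R).
have /sigma_finiteP[G [GT Gnd Goo]] := sigma_finiteT m.
exists (fun i => [set t | F i (thead t) /\ G i [tuple of behead t]]).
  apply/esym; rewrite -subTset => t _.
  have [i _ Fi] : (\bigcup_i F i) (thead t) by rewrite -FT.
  have [j _ Gj] : (\bigcup_i G i) [tuple of behead t] by rewrite -GT.
  exists (maxn i j) => //; split.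
  - by have /subsetPset := Fnd _ _ (leq_maxl i j); exact.
  - by have /subsetPset := Gnd _ _ (leq_maxr i j); exact.
move=> i; have [mF Fio] := Foo i; have [mG Gio] := Goo i; split.
  rewrite [X in measurable X](_ : _ =
    (fun t : n.+1.-tuple R => tnth t ord0) @^-1` F i `&`
    (fun t : n.+1.-tuple R => [tuple of behead t]) @^-1` G i)//.
  apply: measurableI.
  - by rewrite -[X in measurable X]setTI; exact: measurable_tnth.
  - by rewrite -[X in measurable X]setTI; exact: measurable_behead.
rewrite /lebesgue_step /pushforward.
rewrite [X in (lebesgue_measure \x m)%E X](_ : _ = F i `*` G i).
  by rewrite product_measure1E// lte_mul_pinfty// ge0_fin_numE.
apply/seteqP; split => -[x t] /=; rewrite theadE => -[Fx].
- by move=> Gt; split => //=; congr (G i _): Gt; exact/val_inj.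
- by move=> Gt; split => //=; congr (G i _): Gt; exact/val_inj.
Qed.

HB.instance Definition _ := @Measure_isSigmaFinite.Build _ _ _ lebesgue_step
  lebesgue_step_sigma_finite.

End lebesgue_step.

(** Lebesgue measure on R^n, as an iterated product of one-dimensional ones. *)
Fixpoint lebesgueRn (R : realType) (n : nat) :
    {sigma_finite_measure set (n.-tuple R) -> \bar R} :=
  match n with
  | 0 => \d_([tuple] : 0.-tuple R)
  | n'.+1 => lebesgue_step (lebesgueRn R n')
  end.

(** [sphere R n] is the unit sphere of R^(n.+1), i.e. the n-dimensional one. *)
Record sphere (R : realType) (n : nat) := Sphere {
  sphere_val :> n.+1.-tuple R;
  sphere_valP : enorm sphere_val == 1 }.

HB.instance Definition _ R n := [isSub for @sphere_val R n].
HB.instance Definition _ R n := [Choice of sphere R n by <:].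

Section sphere_measurable.
Context (R : realType) (n : nat).

Definition pole_tuple : n.+1.-tuple R := [tuple (i == ord0)%:R | i < n.+1].

Lemma enorm_pole : enorm pole_tuple == 1.
Proof.
rewrite /enorm (bigD1 ord0)//= big1 ?addr0 => [|i i0].
  by rewrite tnth_mktuple eqxx expr1n sqrtr1.
by rewrite tnth_mktuple (negbTE i0) expr0n.
Qed.

Definition pole : sphere R n := Sphere enorm_pole.

HB.instance Definition _ := isPointed.Build (sphere R n) pole.

HB.instance Definition _ := Measurable.copy (sphere R n)
  (g_sigma_algebra_preimageType (@sphere_val R n)).

(** x / |x|, with a junk value at the origin *)
Definition direction (x : n.+1.-tuple R) : sphere R n :=
  insubd pole [tuple tnth x i / enorm x | i < n.+1].

Lemma measurable_direction : measurable_fun setT direction.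
Proof.
move=> _ _ [B mB <-]; rewrite !setTI.
pose f (x : n.+1.-tuple R) := if enorm x == 0 then pole_tuple else
  [tuple tnth x i / enorm x | i < n.+1].
have -> : direction @^-1` (@sphere_val R n @^-1` B) = f @^-1` B.
  have fE x : sphere_val (direction x) = f x.
    rewrite /direction -[LHS]/(val _) val_insubd /f.
    have -> : enorm [tuple tnth x i / enorm x | i < n.+1] = (enorm x != 0)%:R.
      rewrite /enorm; under eq_bigr do rewrite tnth_mktuple exprMn.
      rewrite -mulr_suml sqrtrM ?sumr_ge0// => [|i _]; last exact: sqr_ge0.
      rewrite -/(enorm x) sqrtr_sqr ger0_norm ?invr_ge0 ?sqrtr_ge0//.
      by have [->|x0] := eqVneq (enorm x) 0; [rewrite mul0r|rewrite divff].
    by case: (eqVneq (enorm x)) => _ /=; rewrite ?eqxx // eq_sym oner_eq0.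
  by apply/seteqP; split => x /=; rewrite fE.
rewrite -[X in measurable X]setTI.
suff : measurable_fun setT f by exact.
apply: measurable_fun_ifT => //=.
  by apply: measurable_fun_eqr => //; exact: measurable_enorm.
apply/measurable_fun_tnthP => i.
rewrite [X in measurable_fun _ X](_ : _ = fun x : n.+1.-tuple R => tnth x i * enorm x `^ (- 1)).
  apply: measurable_funM; first exact: measurable_tnth.
  exact: measurableT_comp (measurable_powR (- 1)) (@measurable_enorm R n.+1).
by apply/funext => x; rewrite /= tnth_mktuple powR_inv1 ?sqrtr_ge0.
Qed.

End sphere_measurable.

Section surface_measure.
Context (R : realType) (n : nat).

(** Polar coordinates: sigma(A) = d |{x : 0 < |x| <= 1, x/|x| in A}|, d = n.+1. *)
Definition surface_measure (A : set (sphere R n)) : \bar R :=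
  (n.+1%:R%:E * lebesgueRn R n.+1
     [set x | (0 < enorm x <= 1)%R /\ A (direction x)])%E.

Let ball : set (n.+1.-tuple R) := [set x | 0 < enorm x <= 1].

Let mball : measurable ball.
Proof.
rewrite (_ : ball = @enorm R n.+1 @^-1` `]0, 1]%classic); last first.
  by apply/seteqP; split => x; rewrite /= in_itv.
by rewrite -[X in measurable X]setTI; exact: measurable_enorm.
Qed.

HB.instance Definition _ := isMeasurableFun.Build _ _ _ _
  (@direction R n) (@measurable_direction R n).

Let cone : set (sphere R n) -> \bar R :=
  pushforward (mrestr (lebesgueRn R n.+1) mball) (@direction R n).

Let cone0 : cone set0 = 0%E.
Proof. exact: measure0. Qed.

Let cone_ge0 A : (0 <= cone A)%E.
Proof. exact: measure_ge0. Qed.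

Let cone_sigma_additive : semi_sigma_additive cone.
Proof. exact: measure_semi_sigma_additive. Qed.

HB.instance Definition _ := isMeasure.Build _ _ _ cone
  cone0 cone_ge0 cone_sigma_additive.

Let surfaceE : surface_measure = mscale n.+1%:R%:nng cone.
Proof.
apply/funext => A; rewrite /surface_measure /mscale /cone /pushforward /mrestr /=.
by congr (_ * lebesgue_step _ _)%E; apply/seteqP; split => x [].
Qed.

Let surface0 : surface_measure set0 = 0%E.
Proof. by rewrite surfaceE measure0. Qed.

Let surface_ge0 A : (0 <= surface_measure A)%E.
Proof. by rewrite surfaceE. Qed.

Let surface_sigma_additive : semi_sigma_additive surface_measure.
Proof. by rewrite surfaceE; exact: measure_semi_sigma_additive. Qed.

HB.instance Definition _ := isMeasure.Build _ _ _ surface_measure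
  surface0 surface_ge0 surface_sigma_additive.

End surface_measure.

(** Complex-valued functions. Elements of L^2 are represented by functions;
    identification up to null sets is explicit in what follows. *)
Section complex_L2.
Context d (T : measurableType d) (R : realType).
Variable mu : {measure set T -> \bar R}.
Implicit Types f g : T -> R[i].

Definition cmeasurable f : Prop :=
  measurable_fun setT (fun x => complex.Re (f x)) /\
  measurable_fun setT (fun x => complex.Im (f x)).

Definition cintegrable f : Prop :=
  mu.-integrable setT (fun x => (complex.Re (f x))%:E) /\
  mu.-integrable setT (fun x => (complex.Im (f x))%:E).

Definition cintegral f : R[i] :=
  (\int[mu]_x complex.Re (f x)) +i* (\int[mu]_x complex.Im (f x)).

Definition L2norm f : \bar R := ('N[mu]_2%:E [EFin \o (fun x => ComplexField.Normc.normc (f x))])%E.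

Definition L2 : set (T -> R[i]) :=
  [set f | cmeasurable f /\ (L2norm f < +oo)%E].

Definition L2_linear (S : (T -> R[i]) -> T -> R[i]) : Prop :=
  [/\ forall f, L2 f -> L2 (S f),
      forall f g, L2 f -> L2 g ->
        (f = g %[ae mu]) -> (S f = S g %[ae mu]) &
      forall (c : R[i]) f g, L2 f -> L2 g ->
        S (fun x => c * f x + g x) = (fun x => c * S f x + S g x) %[ae mu]].

Definition L2_compact (S : (T -> R[i]) -> T -> R[i]) : Prop :=
  L2_linear S /\
  forall f_ : nat -> T -> R[i], (forall j, L2 (f_ j)) ->
    (exists M : R, forall j, (L2norm (f_ j) <= M%:E)%E) ->
  exists (u : nat -> nat) (g : T -> R[i]),
    [/\ {homo u : i j / (i < j)%N},
        L2 g &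
        L2norm (fun x => S (f_ (u j)) x - g x) @[j --> \oo] --> 0%E].

Definition L2_opnorm (S : (T -> R[i]) -> T -> R[i]) : \bar R :=
  ereal_sup [set L2norm (S f) | f in [set f | L2 f /\ (L2norm f <= 1)%E]].

Definition L2_eigenvalue (S : (T -> R[i]) -> T -> R[i]) (c : R[i]) : Prop :=
  exists f, [/\ L2 f, ~ (f = cst 0 %[ae mu]) &
    S f = (fun x => c * f x) %[ae mu]].

End complex_L2.

(** Euler's integral for 0 < x, extended to the x <= 0 that are not poles by
    Gamma(x) = Gamma(x + m) / (x (x+1) ... (x+m-1)) with m least such that
    0 < x + m. *)
Section gamma.
Context (R : realType).
Implicit Types x s : R.

Definition Gamma_pos x : R :=
  \int[lebesgue_measure]_(t in `]0, +oo[) (t `^ (x - 1) * expR (- t)).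

Definition Gamma x : R :=
  if 0 < x then Gamma_pos x else
  let m := (Num.truncn (- x)).+1 in
  Gamma_pos (x + m%:R) / \prod_(0 <= i < m) (x + i%:R).

(** Gamma(s) / Gamma(s - k), by continuity at the poles of Gamma. *)
Definition Gamma_quot s (k : nat) : R :=
  if (s \is a Num.int) && (s <= 0) then \prod_(1 <= j < k.+1) (s - j%:R)
  else Gamma s / Gamma (s - k%:R).

End gamma.

(** [P] has k-homogeneous monomials only (so that 0 is allowed for every k) and
    zero Laplacian. *)
Definition solid_harmonic (R : realType) (d k : nat) (P : mpoly d R[i]) : Prop :=
  P \is ishomog1 k mdeg /\ \sum_(i < d) mderiv i (mderiv i P) = 0.

Definition sphere_restr (R : realType) (n : nat) (P : mpoly n.+1 R[i])
    (theta : sphere R n) : R[i] :=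
  meval (fun i => (tnth theta i)%:C) P.

Section operator.
Context (R : realType) (n : nat).
Variable a : R.
Let d : R := n.+1%:R.

(** On the diagonal, a null set, the value is 0 since 1 / 0 = 0. *)
Definition TS_kernel (omega theta : sphere R n) : R :=
  1 / edist theta omega `^ (d + 2 * a - 2).

Definition TS (f : sphere R n -> R[i]) (omega : sphere R n) : R[i] :=
  (1 / 2)%:C *
  cintegral (@surface_measure R n) (fun theta => (TS_kernel omega theta)%:C * f theta).

Definition TS_lambda (k : nat) : R :=
  pi `^ ((d - 1) / 2) / 2 `^ (2 * a) *
  ((-1) ^+ k * Gamma (1 / 2 - a) * Gamma_quot (2 - a - d / 2) k
   / Gamma (- a + d / 2 + k%:R)).

End operator.

(* Main.v *)
(** With b = d/2 + a - 1 > 0 the kernel is 2^-b (1 - x.y)^-b, and its binomial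
    expansion in powers of x.y has positive coefficients (b)_j / j!.  The
    integral of (x.y)^j P(y) over the sphere, P a solid harmonic of degree k, is
    a constant times P(x): up to the radial factor it is a Gaussian moment, and
    Gaussian integration by parts lowers j, at the cost of differentiating P
    along x.  Summing over j, the eigenvalue becomes a hypergeometric sum at 1,
    which Gauss's theorem evaluates in closed form.

    All terms being nonnegative, the tail of the expansion has integral tending
    to 0 uniformly in x, so by Schur's test T is a limit in operator norm of
    operators with kernel a polynomial in x.y, hence of finite rank, and T is
    compact.  Schur's test for the kernel itself, whose integral is 2 lambda_0,
    bounds the norm by lambda_0, which constants attain. *)

Require Import Defs.
From HB Require Import structures.
From mathcomp Require Import all_boot all_order all_algebra.
From mathcomp Require Import -(notations) mpoly.
From mathcomp Require Import all_classical all_reals all_analysis measurable_realfun.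
From mathcomp Require Import complex ring lra.

Set Implicit Arguments.
Unset Strict Implicit.
Unset Printing Implicit Defensive.

Import Order.TTheory GRing.Theory Num.Theory.
Import numFieldNormedType.Exports.

Local Open Scope classical_set_scope.
Local Open Scope ring_scope.
Local Open Scope complex_scope.

(** The surface measure is defined by volumes of cones, so everything radial rests on one identity:
    integrating [exp(- rho)] against a measure is integrating [exp(- u)] times the mass of the
    sublevel set [rho <= u]. With the scaling of Lebesgue measure it gives the functional equation
    of Gamma, the Gaussian moments and the passage from the sphere to R^n; integration by parts
    becomes an algebraic identity on monomials. The two bounds on [a] enter separately. The lower
    one is [b > 0], positivity of the coefficients. The upper one is [b + 1/2 < d/2], convergence of
    the hypergeometric sum at 1, and equally [b < d/2 - a], which makes the eigenvalues decrease to
    0. The tail is uniform in [x] because the moments of x.y do not depend on [x], which is the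
    degree 0 case of the formula for harmonics; odd powers of |x.y|, not being polynomial, are
    bounded by the even power below. In the proof of compactness an ultrafilter replaces weak
    compactness: one choice makes all the finitely many integrals of every finite-rank approximation
    Cauchy. *)

Section layer_cake.
Context {R : realType}.
Local Notation mu := (@lebesgue_measure R).
Local Open Scope ereal_scope.

Let mexp : measurable_fun setT (fun u : R => (expR (- u))%:E).
Proof. by apply/measurable_EFinP/measurableT_comp => //; exact: measurableT_comp. Qed.

Lemma integral_expRN (r : R) :
  \int[mu]_(u in `]r, +oo[) (expR (- u))%:E = (expR (- r))%:E.
Proof.
have cexp : continuous (fun u : R => expR (- u)).
  move=> x; apply: continuous_comp; last exact: continuous_expR.
  exact: opp_continuous.
rewrite integral_itv_obnd_cbnd; last first.
  exact: measurable_funTS mexp.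
rewrite (@ge0_continuous_FTC2y _ _ (fun u => - expR (- u))%R _ 0%R).
- by rewrite EFinN oppeK add0e.
- by move=> x _; exact: expR_ge0.
- exact: continuous_subspaceT.
- by rewrite -oppr0; apply: cvgN; exact: cvgr_expR.
- by move=> x _; exact: ex_derive.
- by apply: cvgN; apply: cvg_at_right_filter; exact: cexp.
- move=> x _; rewrite derive1E derive_val.
  by rewrite mulrN1 opprK.
Qed.

(** Tonelli for [h x * exp(- u)] on the region [rho x <= u]: integrating in [u] first gives
    [exp(- rho x)]. The gain is in the other order, since the sublevel sets of a homogeneous [rho]
    are dilates of one another. *)
Lemma layer_cake_expRN d (T : measurableType d)
    (m : {sigma_finite_measure set T -> \bar R}) (rho : T -> R) (h : T -> \bar R) :
  measurable_fun setT rho -> (forall x, 0 <= rho x)%R ->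
  measurable_fun setT h -> (forall x, 0 <= h x) ->
  \int[m]_x (h x * (expR (- rho x))%:E) =
  \int[mu]_(u in `]0%R, +oo[)
    ((expR (- u))%:E * \int[m]_(x in [set x | (rho x <= u)%R]) h x).
Proof.
move=> mrho rho0 mh h0.
(* The conjunct [0 < z.2] removes only the null set [u = 0], met when [rho x = 0], and confines the
   outer integral to the open half-line. *)
pose F (z : T * R) :=
  if (rho z.1 <= z.2)%R && (0 < z.2)%R then h z.1 * (expR (- z.2))%:E else 0.
have F0 z : 0 <= F z by rewrite /F; case: ifPn => // _; rewrite mule_ge0 ?lee_fin ?expR_ge0.
have mF : measurable_fun setT F.
  apply: measurable_fun_ifT => //.
    apply: measurable_and; last by apply: measurable_fun_ltr.
    by apply: measurable_fun_ler => //; exact: measurableT_comp.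
  apply: emeasurable_funM; first exact: measurableT_comp.
  exact: measurableT_comp mexp measurable_snd.
have := @fubini_tonelli _ _ _ _ _ m mu F mF F0.
under eq_integral.
  move=> x _.
  have -> : \int[mu]_y F (x, y) = h x * (expR (- rho x))%:E.
    have [r0|r0] := ltP 0%R (rho x).
      rewrite -integral_expRN integral_itv_obnd_cbnd; last exact: measurable_funTS mexp.
      rewrite -ge0_integralZl//.
      - rewrite integral_mkcond; apply: eq_integral => u _.
        rewrite patchE mem_setE in_itv/= andbT /F/=.
        by have [ru|ru] := leP (rho x) u; rewrite //= (lt_le_trans r0 ru).
      - exact: measurable_funTS.
    have r1 : rho x = 0%R by apply/eqP; rewrite eq_le r0 rho0.
    rewrite r1 -integral_expRN -ge0_integralZl//.
    - rewrite integral_mkcond; apply: eq_integral => u _.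
      by rewrite patchE mem_setE in_itv/= andbT /F/= r1; case: ltP => [/ltW ->|]; rewrite ?andbF.
    - exact: measurable_funTS.
    over.
move=> ->; rewrite [RHS]integral_mkcond; apply: eq_integral => u _.
have mrhou : measurable [set x | (rho x <= u)%R].
  rewrite [X in measurable X](_ : _ = rho @^-1` `]-oo, u]%classic).
    by rewrite -[X in measurable X]setTI; exact: mrho.
  by apply/seteqP; split => x; rewrite /= in_itv.
rewrite patchE mem_setE in_itv/= andbT; case: ifPn => u0; last first.
  by apply: integral0_eq => x _; rewrite /F/= (negbTE u0) andbF.
rewrite -ge0_integralZl//; last exact: measurable_funTS.
rewrite [RHS]integral_mkcond; apply: eq_integral => x _.
by rewrite patchE mem_setE /F/= u0 andbT muleC.
Qed.

(** For [x < 1] the integrand is unbounded at 0, so the fundamental theorem is applied on the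
    intervals from [u / (n + 2)] to [u], and monotone convergence gives the limit. *)
Lemma integral_powR (x u : R) : (0 < x)%R -> (0 < u)%R ->
  \int[mu]_(t in `]0%R, u]) (t `^ (x - 1))%:E = (u `^ x / x)%:E.
Proof.
move=> x0 u0.
have mp : measurable_fun setT (fun t : R => (t `^ (x - 1))%:E).
  by apply/measurable_EFinP; exact: measurable_powR.
have dp y (t : R) : (0 < t)%R -> derivable (fun t : R => t `^ y)%R t 1.
  by move=> t0; apply: derivable_powR; rewrite in_itv/= t0.
have cvp1 y (t : R) : (0 < t)%R -> {for t, continuous (fun t : R => t `^ y)%R}.
  by move=> t0; apply: differentiable_continuous; apply/derivable1_diffP; exact: dp.
have cvp (t : R) : (0 < t)%R -> {for t, continuous (fun t : R => t `^ x / x)%R}.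
  by move=> t0; apply: cvgMr_tmp; exact: cvp1.
have H (e : R) : (0 < e)%R -> (e < u)%R ->
    \int[mu]_(t in `[e, u]) (t `^ (x - 1))%:E = ((u `^ x / x) - (e `^ x / x))%:E.
  move=> e0 eu.
  rewrite (@continuous_FTC2 _ _ (fun t : R => t `^ x / x)%R)//.
  - apply: continuous_in_subspaceT => t; rewrite inE/= in_itv/= => /andP[et _].
    by apply: cvp1; exact: lt_le_trans et.
  - split.
    + move=> t; rewrite in_itv/= => /andP[et _].
      apply: derivableM => //; apply: derivable_powR.
      by rewrite in_itv/= (lt_trans e0).
    + by apply: cvg_at_right_filter; exact: cvp.
    + by apply: cvg_at_left_filter; exact: cvp.
  - move=> t; rewrite in_itv/= => /andP[et _].
    have t0 : (0 < t)%R by exact: lt_trans et.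
    rewrite derive1E deriveMr//; last first.
      by apply: derivable_powR; rewrite in_itv/= t0.
    rewrite (@derive_val _ _ _ _ _ _ _ (is_derive1_powR x t0)).
    by rewrite mulrA mulVf ?mul1r// gt_eqF.
pose e n := (u / n.+2%:R)%R.
have e0 n : (0 < e n)%R by rewrite divr_gt0.
have eu n : (e n < u)%R by rewrite ltr_pdivrMr// ltr_pMr// ltr1n.
pose F n : set R := [set` `[e n, u]].
have FE : `]0%R, u]%classic = \bigcup_n F n.
  apply/seteqP; split => t /=.
    rewrite in_itv/= => /andP[t0 tu]; exists (Num.truncn (u / t)) => //.
    rewrite /F/= in_itv/= tu andbT /e ler_pdivrMr// -ler_pdivrMl// mulrC.
    by rewrite (le_trans (ltW (truncnS_gt _)))// ler_nat.
  by move=> [n _]; rewrite /F/= !in_itv/= => /andP[et ->]; rewrite andbT (lt_le_trans (e0 n)).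
have c1 : \int[mu]_(t in F n) (t `^ (x - 1))%:E @[n --> \oo] -->
    \int[mu]_(t in `]0%R, u]) (t `^ (x - 1))%:E.
  rewrite FE; apply: ge0_nondecreasing_set_cvg_integral => //.
  - move=> i j ij; apply/subsetPset => t; rewrite /F/= !in_itv/= => /andP[eit ->].
    by rewrite andbT (le_trans _ eit)// ler_pM2l// lef_pV2 ?posrE// ler_nat.
  - by move=> i; exact: measurable_itv.
  - by move=> i; exact: measurable_funTS mp.
  - by move=> i t _; rewrite lee_fin powR_ge0.
rewrite -(cvg_lim (@ereal_hausdorff R) c1); apply: cvg_lim => //.
under eq_fun do rewrite H//.
apply: cvg_EFin; first by exact: nearW.
rewrite -[in X in _ --> X](subr0 (u `^ x / x)%R) -(mul0r x^-1%R).
apply: cvgB; first exact: cvg_cst.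
apply: cvgMr_tmp.
have /cvg_at_rightP := @powR_cvg0 R x x0; apply; split => //.
rewrite -(mulr0 u); apply: cvgMl_tmp.
by have := @cvg_harmonic R; rewrite -cvg_shiftS.
Qed.

End layer_cake.

(** * Euler's integral: functional equation, finiteness, Wendel's inequalities *)

Section Gamma_pos_theory.
Context {R : realType}.
Local Notation mu := (@lebesgue_measure R).
Implicit Types x : R.

(** Euler's integral with extended real values: the functional equation is available before
    finiteness, which is deduced from it. *)
Let g x : \bar R := (\int[mu]_(t in `]0%R, +oo[) (t `^ (x - 1) * expR (- t))%:E)%E.

Let mexp : measurable_fun setT (fun u : R => expR (- u)).
Proof. by apply/measurableT_comp => //; exact: measurableT_comp. Qed.

Let mg x : measurable_fun setT (fun t : R => (t `^ (x - 1) * expR (- t))%:E).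
Proof.
by apply/measurable_EFinP; apply: measurable_funM => //; exact: measurable_powR.
Qed.

Let gge x t : (0 <= (t `^ (x - 1) * expR (- t))%:E)%E.
Proof. by rewrite lee_fin mulr_ge0 ?powR_ge0 ?expR_ge0. Qed.

Let g0 x : (0 <= g x)%E. Proof. exact: integral_ge0. Qed.

(** Layer cake with [rho t = max(t, 0)] and weight t^(x-1) on the half-line: the inner integral over
    []0, u]] is u^x / x, so Euler's integral at [x] is [1 / x] times the one at [x + 1]. *)
Let gS x : 0 < x -> g (x + 1) = (x%:E * g x)%E.
Proof.
move=> x0.
pose h (t : R) : \bar R := if 0 < t then (t `^ (x - 1))%:E else 0%E.
pose rho (t : R) := Num.max t 0.
have mh : measurable_fun setT h.
  apply: measurable_fun_ifT => //; first exact: measurable_fun_ltr.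
  by apply/measurable_EFinP; exact: measurable_powR.
have h0 t : (0 <= h t)%E by rewrite /h; case: ifPn => // _; rewrite lee_fin powR_ge0.
have mrho : measurable_fun setT rho by exact: measurable_maxr.
have rho0 t : 0 <= rho t by rewrite le_max lexx orbT.
have := layer_cake_expRN mu mrho rho0 mh h0.
rewrite (_ : (\int[_]_x _)%E = g x); last first.
  rewrite /g [RHS]integral_mkcond; apply: eq_integral => t _.
  rewrite patchE mem_setE in_itv/= andbT /h /rho; case: ifPn => t0; last by rewrite mul0e.
  by rewrite max_l ?ltW.
move=> ->; rewrite /g.
have -> : (\int[mu]_(u in `]0%R, +oo[) ((expR (- u))%:E * \int[mu]_(t in [set t | (rho t <= u)%R]) h t))%E
    = (\int[mu]_(u in `]0%R, +oo[) (x^-1%:E * (u `^ (x + 1 - 1) * expR (- u))%:E))%E.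
  apply: eq_integral => u; rewrite inE/= in_itv/= andbT => u0.
  rewrite (_ : (\int[_]_(_ in _) _)%E = (\int[mu]_(t in `]0%R, u]) (t `^ (x - 1))%:E)%E).
    by rewrite integral_powR// -!EFinM addrK; congr EFin; ring.
  rewrite [LHS]integral_mkcond [RHS]integral_mkcond; apply: eq_integral => t _.
  rewrite !patchE.
  have -> : (t \in [set t | (rho t <= u)%R]) = (t <= u).
    by apply/idP/idP; rewrite inE /= /rho ge_max (ltW u0) andbT.
  by rewrite mem_setE in_itv/= /h; case: leP => tu; case: ltP.
rewrite ge0_integralZl_EFin//; last 2 first.
- exact: measurable_funTS (mg _).
- by rewrite invr_ge0 ltW.
by rewrite muleA -EFinM mulfV ?mul1e// gt_eqF.
Qed.

Let g1 : g 1 = 1%E.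
Proof.
rewrite -[RHS](congr1 EFin (expR0 R)) -oppr0 -integral_expRN.
by apply: eq_integral => t _; rewrite subrr powRr0 mul1r.
Qed.

(** Integers are reached by recursion from 1. A real [y >= 1] lies between integers [n] and [n + 1],
    and t^(y-1) is at most t^(n-1) for t <= 1 and at most t^n beyond. Finally [x] is read off from
    [x + 1]. *)
Let g_fin x : 0 < x -> g x \is a fin_num.
Proof.
have gn n : g n.+1%:R \is a fin_num.
  elim: n => [|n IH]; first by rewrite g1.
  by rewrite -natr1 gS// fin_numM.
have H y : 1 <= y -> g y \is a fin_num.
  move=> y1; rewrite ge0_fin_numE//; pose n := Num.truncn y.
  have n0 : (0 < n)%N by rewrite truncn_gt0.
  apply: (@le_lt_trans _ _ (g n%:R + g n.+1%:R)%E); last first.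
    by rewrite lte_add_pinfty// -ge0_fin_numE// -(prednK n0).
  rewrite /g -ge0_integralD//.
  - apply: ge0_le_integral => //.
    + exact: measurable_funTS (mg _).
    + by apply: emeasurable_funD; exact: measurable_funTS (mg _).
    + move=> t; rewrite /= in_itv/= andbT => t0; rewrite -EFinD -mulrDl lee_fin.
      rewrite ler_wpM2r ?expR_ge0//.
      have [t1|t1] := leP t 1.
        rewrite (@le_trans _ _ (t `^ (n%:R - 1)))// ?lerDl ?powR_ge0//.
        apply: ger_powR; first by rewrite t0.
        by rewrite lerD2r truncn_le// (le_trans _ y1).
      rewrite (@le_trans _ _ (t `^ (n.+1%:R - 1)))// ?lerDr ?powR_ge0//.
      by apply: ler_powR; rewrite ?(ltW t1)// lerD2r ltW// truncnS_gt.
  - exact: measurable_funTS (mg _).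
  - exact: measurable_funTS (mg _).
move=> x0; have := H (x + 1); rewrite lerDr ltW// => /(_ isT).
rewrite gS//; case: (g x) (g0 x) => //.
by move=> _; rewrite mulry gtr0_sg// mul1e.
Qed.

Let GE x : 0 < x -> (Gamma_pos x)%:E = g x.
Proof. by move=> x0; rewrite /Gamma_pos /Rintegral fineK// g_fin. Qed.

Lemma Gamma_posS x : 0 < x -> Gamma_pos (x + 1) = x * Gamma_pos x.
Proof.
by move=> x0; apply: EFin_inj; rewrite EFinM !GE ?addr_gt0// gS.
Qed.

Lemma Gamma_pos1 : Gamma_pos 1 = 1 :> R.
Proof. by apply: EFin_inj; rewrite GE// g1. Qed.

Lemma Gamma_pos_gt0 x : 0 < x -> 0 < Gamma_pos x.
Proof.
have H (y : R) : 1 <= y -> 0 < Gamma_pos y.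
  move=> y1; rewrite -lte_fin GE ?(lt_le_trans _ y1)//.
  rewrite (@lt_le_trans _ _ (\int[mu]_(t in `[1%R, 2%R]) (expR (- 2))%:E)%E)//.
    rewrite integral_cst//= lebesgue_measure_itv/= lte_fin ltr1n/= -EFinB.
    by rewrite mule_gt0// ?lte_fin ?expR_gt0// subr_gt0 ltr1n.
  rewrite (@le_trans _ _ (\int[mu]_(t in `[1%R, 2%R]) (t `^ (y - 1) * expR (- t))%:E)%E)//.
    apply: ge0_le_integral => //.
    + exact: measurable_funTS (mg _).
    + move=> t; rewrite /= in_itv/= => /andP[t1 t2]; rewrite lee_fin.
      rewrite (@le_trans _ _ (1 * expR (- t)))// ?mul1r ?ler_expR ?lerN2//.
      rewrite ler_peMl ?expR_ge0// -(powRr0 t); apply: ler_powR => //.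
      by rewrite powRr0 subr_ge0.
  apply: ge0_subset_integral => //.
  + exact: measurable_funTS (mg _).
  + by move=> t; rewrite /= !in_itv/= andbT => /andP[t1 _]; exact: lt_le_trans t1.
move=> x0; have := H (x + 1); rewrite lerDr ltW// => /(_ isT).
by rewrite Gamma_posS// pmulr_rgt0.
Qed.

(** The form in which a layer cake ends when the mass of the sublevel set is homogeneous of degree
    [x] in [u]; the mass [m] at [u = 1] may be infinite. *)
Lemma Gamma_pos_layer_cake (m : \bar R) x : 0 < x -> (0 <= m)%E ->
  (\int[mu]_(u in `]0%R, +oo[) ((expR (- u))%:E * ((u `^ x)%:E * m)))%E
   = ((Gamma_pos (x + 1))%:E * m)%E.
Proof.
move=> x0 m0; rewrite GE ?addr_gt0// /g -ge0_integralZr//.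
- by apply: eq_integral => t _; rewrite addrK muleA -EFinM (mulrC (expR _)).
- exact: measurable_funTS (mg _).
Qed.

(** Concavity of u^s, read off Young's inequality with exponents [1 / s] and [1 / (1 - s)]; the end
    points 0 and 1 are set apart because there an exponent would be infinite. *)
Lemma powR_le_tangent (s u : R) : 0 <= s <= 1 -> 0 < u -> u `^ s <= 1 + s * (u - 1).
Proof.
move=> /andP[s0 s1] u0.
have [->|sN0] := eqVneq s 0; first by rewrite powRr0 mul0r addr0.
have [->|sN1] := eqVneq s 1; first by rewrite powRr1 ?(ltW u0)// mul1r addrC subrK.
have sp : 0 < s by rewrite lt_def sN0.
have sp1 : 0 < 1 - s by rewrite subr_gt0 lt_def eq_sym sN1.
have := @conjugate_powR R (u `^ s) 1 s^-1 (1 - s)^-1 (powR_ge0 _ _) ler01.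
rewrite !invr_gt0 sp sp1 !invrK addrC subrK => /(_ isT isT erefl).
by rewrite mulr1 -powRrM mulfV// powRr1 ?(ltW u0)// powR1 /= mul1r => /le_trans; apply; lra.
Qed.

(** Wendel's upper bound: the tangent inequality at [u = t / x], multiplied by x^s t^(x-1) exp(-t)
    and integrated in [t]. By the functional equation the two terms on the right recombine. *)
Lemma Gamma_pos_le x s : 0 < x -> 0 <= s <= 1 ->
  Gamma_pos (x + s) <= x `^ s * Gamma_pos x.
Proof.
move=> x0 /andP[s0 s1]; have xs0 : 0 < x + s by rewrite ltr_wpDr.
have : (g (x + s) <= (x `^ s * (1 - s))%:E * g x + (x `^ s * s * x^-1)%:E * g (x + 1))%E.
  have c10 : (0 <= (x `^ s * (1 - s))%:E)%E by rewrite lee_fin mulr_ge0 ?powR_ge0 ?subr_ge0.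
  have c20 : (0 <= (x `^ s * s * x^-1)%:E)%E.
    by rewrite lee_fin !mulr_ge0 ?powR_ge0 ?invr_ge0 ?(ltW x0).
  have mgi (y : R) : measurable_fun (`]0%R, +oo[ : set R) (fun t : R => (t `^ (y - 1) * expR (- t))%:E).
    exact: measurable_funTS (mg _).
  have gZ y k : (0 <= k)%E ->
      (k * g y = \int[mu]_(t in `]0%R, +oo[) (k * (t `^ (y - 1) * expR (- t))%:E))%E.
    by move=> k0; rewrite ge0_integralZl//; exact: mgi.
  rewrite !gZ// {1}/g.
  rewrite -ge0_integralD//.
  - apply: ge0_le_integral => //.
    + exact: mgi.
    + by apply: emeasurable_funD; apply: measurable_funeM; exact: mgi.
    + move=> t; rewrite /= in_itv/= andbT => t0.
      rewrite -!EFinM -EFinD lee_fin !mulrA -mulrDl ler_wpM2r ?expR_ge0//.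
      have := @powR_le_tangent s (t / x); rewrite s0 s1 divr_gt0// => /(_ isT isT) H.
      have tE : t `^ (x + s - 1) = (t / x) `^ s * x `^ s * t `^ (x - 1).
        rewrite -powRM ?divr_ge0 ?(ltW x0) ?(ltW t0)// divfK ?lt0r_neq0//.
        by rewrite -powRD ?(gt_eqF t0) ?implybT//; congr (_ `^ _); ring.
      have tx : t `^ x = t * t `^ (x - 1) by rewrite mulr_powRB1// ltW.
      rewrite addrK tE tx.
      apply: le_trans (ler_wpM2r (powR_ge0 _ _) (ler_wpM2r (powR_ge0 _ _) H)) _.
      by rewrite le_eqVlt; apply/orP; left; apply/eqP; have xN0 := lt0r_neq0 x0; field.
  - by move=> t _; rewrite mule_ge0.
  - by apply: measurable_funeM; exact: mgi.
  - by move=> t _; rewrite mule_ge0.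
  - by apply: measurable_funeM; exact: mgi.
rewrite -(GE xs0) -(GE x0) -(GE (addr_gt0 x0 ltr01)) -!EFinM -EFinD lee_fin Gamma_posS// => /le_trans; apply.
rewrite le_eqVlt; apply/orP; left; apply/eqP.
by have xN0 := lt0r_neq0 x0; field.
Qed.

(** Wendel's lower bound is the upper one for the step from [x + s] to [x + 1], with [1 - s] in
    place of [s]. *)
Lemma Gamma_pos_ge x s : 0 < x -> 0 <= s <= 1 ->
  x * (x + s) `^ (s - 1) * Gamma_pos x <= Gamma_pos (x + s).
Proof.
move=> x0 /andP[s0 s1]; have xs0 : 0 < x + s by rewrite ltr_wpDr.
have := @Gamma_pos_le (x + s) (1 - s) xs0; rewrite subr_ge0 s1 lerBlDr lerDl s0 => /(_ isT).
rewrite (_ : x + s + (1 - s) = x + 1); last ring.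
rewrite Gamma_posS// => H.
by rewrite mulrAC -(opprB 1 s) powRN ler_pdivrMr ?powR_gt0// (mulrC (Gamma_pos _)).
Qed.

End Gamma_pos_theory.

(** * Asymptotics of Gamma, Gaussian integrals and duplication *)

Section Gamma_pos_asymptotics.
Context {R : realType}.
Local Notation mu := (@lebesgue_measure R).
Implicit Types x : R.

(** Wendel's bounds squeeze the quotient for exponents in [[0, 1]]. Raising an exponent [s] by 1
    multiplies it by [1 + s / (n + 1)], which tends to 1, and so every [x >= 0] is reached. *)
Lemma cvg_Gamma_pos_ratio x : 0 <= x ->
  Gamma_pos (n.+1%:R + x) / (n.+1%:R `^ x * Gamma_pos n.+1%:R) @[n --> \oo] --> (1 : R).
Proof.
have base s : 0 <= s <= 1 ->
    Gamma_pos (n.+1%:R + s) / (n.+1%:R `^ s * Gamma_pos n.+1%:R) @[n --> \oo] --> (1 : R).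
  move=> s01; have /andP[s0 s1] := s01.
  apply: (@squeeze_cvgr _ _ _ _ (fun n => n.+1%:R / (n.+1%:R + 1)) (fun=> 1)).
  - near=> n; have n0 : 0 < n.+1%:R :> R by [].
    have G0 := Gamma_pos_gt0 n0; have p0 := powR_gt0 s n0.
    rewrite ler_pdivlMr ?mulr_gt0// ler_pdivrMr ?mulr_gt0// mul1r Gamma_pos_le// andbT.
    apply: le_trans (Gamma_pos_ge n0 s01); rewrite mulrA ler_wpM2r ?(ltW G0)//.
    rewrite mulrAC -!mulrA ler_wpM2l ?(ltW n0)// ler_pdivrMr ?addr_gt0//.
    have ns0 : 0 < n.+1%:R + s by rewrite ltr_wpDr.
    rewrite -(opprB 1 s) powRN mulrC ler_pdivlMr ?powR_gt0//.
    rewrite (@le_trans _ _ ((n.+1%:R + s) `^ s * (n.+1%:R + s) `^ (1 - s)))//.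
      by rewrite ler_wpM2r ?powR_ge0// ge0_ler_powR// ?nnegrE ?lerDl// ltW.
    rewrite -powRD; last by rewrite (gt_eqF ns0) implybT.
    by rewrite (addrC s) subrK powRr1 ?(ltW ns0)// lerD2l.
  - rewrite -[X in _ --> X]subr0.
    rewrite (_ : (fun n => _) = (fun n => 1 - n.+2%:R^-1)); last first.
      apply/funext => n; have N0 : n.+1%:R + 1 != 0 :> R by rewrite natr1 pnatr_eq0.
      by rewrite -(natr1 n.+1); field.
    apply: cvgB; first exact: cvg_cst.
    by have := @cvg_harmonic R; rewrite -cvg_shiftS.
  - exact: cvg_cst.
have step s : 0 <= s ->
    Gamma_pos (n.+1%:R + s) / (n.+1%:R `^ s * Gamma_pos n.+1%:R) @[n --> \oo] --> (1 : R) ->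
    Gamma_pos (n.+1%:R + (s + 1)) / (n.+1%:R `^ (s + 1) * Gamma_pos n.+1%:R) @[n --> \oo] --> (1 : R).
  move=> s0 H.
  rewrite (_ : (fun n => _) = (fun n => (1 + s * n.+1%:R^-1) *
     (Gamma_pos (n.+1%:R + s) / (n.+1%:R `^ s * Gamma_pos n.+1%:R)))).
    rewrite -[X in _ --> X](_ : (1 + s * 0) * 1 = 1); last by rewrite mulr0 addr0 mulr1.
    apply: cvgM => //; apply: cvgD; first exact: cvg_cst.
    by apply: cvgMl_tmp; exact: cvg_harmonic.
  apply/funext => n; have n0 : 0 < n.+1%:R :> R by [].
  move: (n.+1%:R : R) n0 => N n0; have N0 := lt0r_neq0 n0.
  have G0 := lt0r_neq0 (Gamma_pos_gt0 n0); have p0 := lt0r_neq0 (powR_gt0 s n0).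
  rewrite addrA Gamma_posS ?ltr_wpDr// powRD ?(gt_eqF n0) ?implybT// powRr1 ?(ltW n0)//.
  by field; rewrite p0 G0.
move=> x0; have [m [s [s01 ->]]] : exists m s, 0 <= s <= 1 /\ x = s + m%:R.
  exists (Num.truncn x), (x - (Num.truncn x)%:R); rewrite subrK; split => //.
  by have := truncn_itv x0; rewrite -natr1; lra.
elim: m => [|m IH]; first by rewrite addr0; exact: base.
by rewrite -natr1 addrA; apply: step => //; case/andP: s01 => s0 _; rewrite addr_ge0.
Unshelve. all: by end_near. Qed.

(** Layer cake with [rho x = x ^+ 2]: the sublevel set is the interval of half-length sqrt u, on
    which x^(2i) integrates to u^(i + 1/2) / (i + 1/2). *)
Lemma integral_even_gauss i :
  (\int[mu]_x (x ^+ i.*2 * expR (- x ^+ 2))%:E = (Gamma_pos (i%:R + 1 / 2))%:E)%E.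
Proof.
pose rho (x : R) := x ^+ 2.
have mrho : measurable_fun setT rho by exact: measurable_funX.
have rho0 x : 0 <= rho x by exact: sqr_ge0.
pose h (x : R) : \bar R := (x ^+ i.*2)%:E.
have mh : measurable_fun setT h by apply/measurable_EFinP; exact: measurable_funX.
have h0 x : (0 <= h x)%E by rewrite lee_fin -muln2 exprM sqr_ge0.
have i0 : 0 < i%:R + 1 / 2 :> R by rewrite ltr_wpDl// divr_gt0.
have := layer_cake_expRN mu mrho rho0 mh h0.
rewrite (_ : (\int[_]_x _)%E = (\int[mu]_x (x ^+ i.*2 * expR (- x ^+ 2))%:E)%E)//.
move=> ->; transitivity (\int[mu]_(u in `]0%R, +oo[)
    ((expR (- u))%:E * ((u `^ (i%:R + 1 / 2))%:E * ((i%:R + 1 / 2)^-1)%:E)))%E.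
  apply: eq_integral => u; rewrite inE/= in_itv/= andbT => u0; congr (_ * _)%E.
  have s0 : 0 < Num.sqrt u by rewrite sqrtr_gt0.
  have -> : [set x | rho x <= u] = `[- Num.sqrt u, Num.sqrt u]%classic.
    apply/seteqP; split => x; rewrite /= in_itv/= /rho -ler_norml.
      by rewrite -sqrtr_sqr ler_sqrt// ltW.
    by move=> H; rewrite -(sqr_sqrtr (ltW u0)) -real_normK ?num_real// ler_pXn2r// nnegrE// ltW.
  rewrite /h.
  have cX n : continuous (fun x : R => x ^+ n) by exact: exprn_continuous.
  rewrite (@continuous_FTC2 _ _ (fun x : R => x ^+ i.*2.+1 / i.*2.+1%:R)).
  - rewrite -EFinB -EFinM; congr EFin.
    rewrite exprNn -signr_odd /= odd_double expr1 powRD ?(gt_eqF u0) ?implybT//.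
    rewrite powR_mulrn ?(ltW u0)// div1r powR12_sqrt ?(ltW u0)// exprS -muln2 mulnC exprM sqr_sqrtr ?(ltW u0)//.
    rewrite -[X in X%:R]addn1 natrD natrM; field.
    by rewrite -natrM natr1 pnatr_eq0.
  - by rewrite gtrN.
  - exact: continuous_subspaceT.
  - split.
    + by move=> x _; apply: derivableM => //; exact: exprn_derivable.
    + by apply: cvg_at_right_filter; apply: cvgMr_tmp; exact: cX.
    + by apply: cvg_at_left_filter; apply: cvgMr_tmp; exact: cX.
  - move=> x _; rewrite derive1E deriveMr; last exact: exprn_derivable.
    by rewrite (etrans (exp_derive _ _ _) (erefl _)) scaler1/= mulrA mulVf ?mul1r// pnatr_eq0.
rewrite Gamma_pos_layer_cake ?lee_fin ?invr_ge0 ?(ltW i0)//.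
by rewrite (Gamma_posS i0) -EFinM mulrAC (mulfV (lt0r_neq0 i0)) (mul1r (Gamma_pos _)).
Qed.

Lemma Gamma_pos_half : Gamma_pos (1 / 2) = Num.sqrt pi :> R.
Proof.
apply: EFin_inj; rewrite -integralT_gauss.
have := integral_even_gauss 0; rewrite add0r => <-.
by apply: eq_integral => x _; rewrite expr0 mul1r.
Qed.

(** Legendre's formula is stated at positive integers, where it follows by induction: it serves to
    compare constants along the integers in [cvg_hval]. *)
Lemma Gamma_pos_duplication_nat n :
  Gamma_pos n.+1%:R * Gamma_pos (n.+1%:R + 1 / 2) * 2 ^+ (n.*2.+1)
  = Num.sqrt pi * Gamma_pos (n.*2.+2)%:R :> R.
Proof.
have N0 m : 0 < m.+1%:R :> R by [].
elim: n => [|n IH].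
  rewrite Gamma_pos1 (addrC 1) Gamma_posS// Gamma_pos_half.
  rewrite -(@natr1 R 1) Gamma_posS// Gamma_pos1; by field.
rewrite doubleS 2!exprS -(natr1 n.+1) -(natr1 n.*2.+3) -(natr1 n.*2.+2).
rewrite (addrAC _ 1) !Gamma_posS ?addr_gt0//.
rewrite [LHS](_ : _ = n.+1%:R * (n.+1%:R + 1 / 2) * 4 *
  (Gamma_pos n.+1%:R * Gamma_pos (n.+1%:R + 1 / 2) * 2 ^+ n.*2.+1)); last by ring.
rewrite IH -!natr1 -muln2 natrM.
by field.
Qed.

End Gamma_pos_asymptotics.

Local Opaque Gamma_pos.

(** * Gauss's summation at 1 for parameters p/2 and (p+1)/2 *)

Section hypergeometric.
Context {R : realType}.
Implicit Types p c : R.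

(* (p)_(2i) = 4^i (p/2)_i ((p+1)/2)_i, so the sum of [hterm p c] is, up to the
   factor 1 / Gamma(c), the value of 2F1(p/2, (p+1)/2; c; .) at 1. *)
Definition hterm p c (i : nat) : R :=
  (\prod_(0 <= j < i.*2) (p + j%:R)) / (4 ^+ i * i`!%:R * Gamma_pos (c + i%:R)).

Lemma hterm_gt0 p c i : 0 < p -> 0 < c -> 0 < hterm p c i.
Proof.
move=> p0 c0; rewrite divr_gt0//.
  by apply: prodr_gt0 => j _; rewrite ltr_wpDr.
by rewrite !mulr_gt0 ?exprn_gt0 ?ltr0n ?fact_gt0// Gamma_pos_gt0// ltr_wpDr.
Qed.

Lemma hterm_shift p c i : 0 < c -> hterm p (c + 1) i * (c + i%:R) = hterm p c i.
Proof.
move=> c0; have ci0 : 0 < c + i%:R by rewrite ltr_wpDr.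
rewrite /hterm addrAC Gamma_posS//.
have G0 := lt0r_neq0 (Gamma_pos_gt0 ci0).
have f0 : i`!%:R != 0 :> R by rewrite pnatr_eq0 -lt0n fact_gt0.
have e0 : 4 ^+ i != 0 :> R by rewrite expf_neq0.
have {}ci0 := lt0r_neq0 ci0; move: (\prod_(_ <= _ < _) _) (Gamma_pos _) G0 => P G G0.
move: (4 ^+ i) (i`!%:R) (c + i%:R) e0 f0 ci0 => E F C e0 f0 ci0.
by field; rewrite e0 f0 ci0 G0.
Qed.

Lemma htermS p c i : 0 < c ->
  hterm p c i.+1 * (i.+1%:R * (c + i%:R)) =
  (p / 2 + i%:R) * ((p + 1) / 2 + i%:R) * hterm p c i.
Proof.
move=> c0; have ci0 : 0 < c + i%:R by rewrite ltr_wpDr.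
rewrite /hterm doubleS !big_nat_recr//= -[in Gamma_pos (c + i.+1%:R)]natr1 addrA Gamma_posS//.
have G0 := lt0r_neq0 (Gamma_pos_gt0 ci0).
have f0 : i`!%:R != 0 :> R by rewrite pnatr_eq0 -lt0n fact_gt0.
have e0 : 4 ^+ i != 0 :> R by rewrite expf_neq0.
have n0 : i.+1%:R != 0 :> R by rewrite pnatr_eq0.
rewrite factS natrM exprS -(natr1 i.*2) -muln2 natrM.
have {}ci0 := lt0r_neq0 ci0; move: (\prod_(_ <= _ < _) _) (Gamma_pos _) G0 => P G G0.
move: (4 ^+ i) (i`!%:R) (i.+1%:R) e0 f0 n0 => E F N e0 f0 n0.
by field; rewrite e0 f0 ci0 G0 n0.
Qed.

(** The contiguity relation in [c] for partial sums. By [hterm_shift] and [htermS] every increment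
    is a rational multiple of a single term, and the relation holds up to the boundary term on the
    right, which has to vanish in the limit. *)
Lemma hterm_telescope p c n : 0 < c ->
  (c - p - 1 / 2) * series (hterm p c) n
  - (c - p / 2) * (c - (p + 1) / 2) * series (hterm p (c + 1)) n
  = - (n%:R * hterm p c n).
Proof.
move=> c0; elim: n => [|n IH].
  by rewrite /series/= !big_geq// !mulr0 subrr mul0r oppr0.
have cn0 : c + n%:R != 0 by rewrite lt0r_neq0// ltr_wpDr.
have Hs := hterm_shift p n c0; have HS := htermS p n c0.
rewrite !seriesSr.
have -> : n.+1%:R * hterm p c n.+1 =
    (p / 2 + n%:R) * ((p + 1) / 2 + n%:R) * hterm p c n / (c + n%:R).
  by rewrite -HS; field.
have -> (x y a b s1 s2 : R) : x * (s1 + a) - y * (s2 + b) = x * s1 - y * s2 + (x * a - y * b) by ring.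
rewrite IH -Hs; move: (hterm p (c + 1) n) n%:R cn0 => h m cn0.
by field.
Qed.

Section convergence.
Variables p c : R.
Hypotheses (p0 : 0 < p) (pc : p + 1 / 2 < c).

Let c0 : 0 < c. Proof. by apply: lt_trans pc; rewrite addr_gt0. Qed.
Let d : R := c - p - 1 / 2.
Let d0 : 0 < d. Proof. by rewrite /d -addrA -opprD subr_gt0. Qed.
Let d20 : 0 < d / 2. Proof. by rewrite divr_gt0. Qed.
Let t := hterm p c.
Let t0 i : 0 < t i. Proof. exact: hterm_gt0. Qed.

(** Raabe's test. The decrement of [i * t i] is exactly [(d * i - p * (p + 1) / 4) / (c + i)] times
    [t i]; this factor tends to [d] and is at least [d / 2] once [i] reaches [K]. *)
Let step : exists i0 : nat, forall i, (i0 <= i)%N ->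
  d / 2 * t i <= i%:R * t i - i.+1%:R * t i.+1.
Proof.
pose K := (p * (p + 1) / 4 + d / 2 * c) / (d / 2).
exists (Num.truncn K).+1 => i iK.
have ci0 : 0 < c + i%:R by rewrite ltr_wpDr.
have iK' : K <= i%:R by rewrite (le_trans (ltW (truncnS_gt K)))// ler_nat.
have -> : i.+1%:R * t i.+1 = (p / 2 + i%:R) * ((p + 1) / 2 + i%:R) * t i / (c + i%:R).
  by rewrite -(htermS p i c0) -/(t _); field; rewrite lt0r_neq0.
rewrite lerBrDr -lerBrDl ler_pdivrMr// -subr_ge0.
rewrite (_ : _ - _ = t i * (d / 2 * i%:R - (p * (p + 1) / 4 + d / 2 * c))).
  by rewrite mulr_ge0 ?(ltW (t0 i))// subr_ge0 (mulrC (d / 2) i%:R) -(ler_pdivrMr _ _ d20).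
by rewrite /d; move: (t i) (i%:R) => a b; field.
Qed.

(** By [step], the partial sum increased by [i * t i / (d / 2)] is nonincreasing from [i0] on, so
    the partial sums are bounded. *)
Lemma is_cvg_hterm : cvgn (series (hterm p c)).
Proof.
have [i0 H] := step.
have B k : series t (k + i0)%N + (k + i0)%:R * t (k + i0)%N / (d / 2)
    <= series t i0 + i0%:R * t i0 / (d / 2).
  elim: k => [|k]; first by rewrite add0n.
  apply: le_trans; rewrite addSn seriesSr.
  have := H (k + i0)%N (leq_addl _ _).
  move: (series t _) (t (k + i0)%N) (t (k + i0).+1) ((k + i0)%:R) ((k + i0).+1%:R) => S a b I J H1.
  move: (d / 2) (I * a) (J * b) (d20) H1 => e u v e0 H1.
  have {}H1 : a <= (u - v) / e by rewrite ler_pdivlMr// mulrC.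
  by rewrite mulrBl in H1; lra.
apply: nondecreasing_is_cvgn.
  by apply/nondecreasing_seqP => n; rewrite seriesSr lerDl ltW// t0.
exists (series t i0 + i0%:R * t i0 / (d / 2)) => _ [n _ <-].
have [ni|/ltnW ni] := leqP n i0.
  apply: (@le_trans _ _ (series t i0)); last first.
    by rewrite lerDl; apply: divr_ge0; [apply: mulr_ge0 => //|]; exact: ltW.
  have /nondecreasing_seqP : forall k, series t k <= series t k.+1.
    by move=> k; rewrite seriesSr lerDl ltW// t0.
  exact.
have := B (n - i0)%N; rewrite subnK//; apply: le_trans.
by rewrite lerDl; apply: divr_ge0; [apply: mulr_ge0 => //|]; exact: ltW.
Qed.
End convergence.

Definition hsum p c : R := limn (series (hterm p c)).

Let cvg_hterm_hsum p c : 0 < p -> p + 1 / 2 < c -> n%:R * hterm p c n @[n --> \oo] -->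
  (c - p / 2) * (c - (p + 1) / 2) * hsum p (c + 1) - (c - p - 1 / 2) * hsum p c.
Proof.
move=> p0 pc; have c0 : 0 < c by apply: lt_trans pc; rewrite addr_gt0.
rewrite (_ : (fun n => _) = fun n => (c - p / 2) * (c - (p + 1) / 2) * series (hterm p (c + 1)) n
    - (c - p - 1 / 2) * series (hterm p c) n); last first.
  by apply/funext => n; rewrite -[LHS]opprK -hterm_telescope// opprB.
apply: cvgB; apply: cvgMl_tmp; last exact: is_cvg_hterm.
by apply: is_cvg_hterm => //; rewrite (lt_trans pc)// ltrDl.
Qed.

(* The limit of n t_n is nonnegative; were it positive, the sums of t over
   [n, 2n[ would stay away from 0, against the convergence of the series. *)
Lemma cvg_hterm_id p c : 0 < p -> p + 1 / 2 < c -> n%:R * hterm p c n @[n --> \oo] --> (0 : R).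
Proof.
move=> p0 pc; have c0 : 0 < c by apply: lt_trans pc; rewrite addr_gt0.
have C1 := is_cvg_hterm p0 pc; have := cvg_hterm_hsum p0 pc.
set L := _ - _ => vL.
have t0 i : 0 < hterm p c i by exact: hterm_gt0.
have L0 : 0 <= L.
  rewrite -(cvg_lim _ vL)//; apply: limr_ge; first by apply/cvg_ex; exists L.
  by apply: nearW => n; rewrite mulr_ge0// ltW.
suff -> : 0 = L by [].
apply/eqP; rewrite eq_le L0/= leNgt; apply/negP => Lp.
have D0 : series (hterm p c) n.*2 - series (hterm p c) n @[n --> \oo] --> (0 : R).
  suff E1 : series (hterm p c) n.*2 @[n --> \oo] --> limn (series (hterm p c)).
    by rewrite -[X in _ --> X](subrr (limn (series (hterm p c)))); exact: cvgB E1 C1.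
  apply: (cvg_comp _ _ _ C1).
  move=> A [N _ HN]; exists N => // n /= Nn; apply: HN => /=.
  by rewrite (leq_trans Nn)// -addnn leq_addr.
have /cvgrPdist_lt/(_ (L / 2)) := vL; rewrite divr_gt0// => /(_ isT)[N1 _ H1].
have /cvgrPdist_lt/(_ (L / 4)) := D0; rewrite divr_gt0// => /(_ isT)[N2 _ H2].
pose N := (maxn N1 N2).+1.
have := H2 N; rewrite /= sub0r normrN => /(_ _)/wrap[].
  by rewrite leqW// leq_maxr.
apply/negP; rewrite -leNgt (le_trans _ (ler_norm _))//.
rewrite -addnn /series/= (big_cat_nat (n := N))//= ?leq_addr// addrAC subrr add0r.
have -> : L / 4 = \sum_(N <= i < N + N) (L / 4 / N%:R).
  by rewrite sumr_const_nat addnK -[RHS]mulr_natr divfK// pnatr_eq0.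
apply: ler_sum_nat => i /andP[Ni iNN].
have := H1 i; rewrite /= => /(_ _)/wrap[].
  by rewrite (leq_trans _ Ni)// leqW// leq_maxl.
rewrite ltr_distlC => /andP[H _].
have i0 : 0 < i%:R :> R by rewrite ltr0n (leq_trans _ Ni).
rewrite ler_pdivrMr//.
have : i%:R * hterm p c i <= (N + N)%:R * hterm p c i.
  by rewrite ler_wpM2r ?(ltW (t0 i))// ler_nat ltnW.
rewrite natrD; move: H L0 i0; move: (hterm p c i) (N%:R) (i%:R) => h n I; nra.
Qed.

Lemma hsum_contiguous p c : 0 < p -> p + 1 / 2 < c ->
  (c - p - 1 / 2) * hsum p c = (c - p / 2) * (c - (p + 1) / 2) * hsum p (c + 1).
Proof.
move=> p0 pc; apply/esym/eqP; rewrite -subr_eq0; apply/eqP.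
exact: cvg_unique (cvg_hterm_hsum p0 pc) (cvg_hterm_id p0 pc).
Qed.

(** Raising [c + n] by 1 multiplies the normalised term by [(c + n) / (c + n + i)], at most
    [(c + n) / (c + n + 1)] for [i > 0], and the product of these bounds telescopes to
    [c / (c + n)]. The term of index 0 stays equal to 1. *)
Lemma hterm_dominated p c n i : 0 < p -> 0 < c ->
  Gamma_pos (c + n%:R) * hterm p (c + n%:R) i <=
  (i == 0)%:R + c / (c + n%:R) * (Gamma_pos c * hterm p c i).
Proof.
move=> p0 c0; have t0 i' : 0 < hterm p c i' by exact: hterm_gt0.
have cn0 m : 0 < c + m%:R by rewrite ltr_wpDr.
case: i => [|i].
  rewrite /hterm !big_geq// !expr0 !mul1r !addr0 !divff ?lt0r_neq0 ?Gamma_pos_gt0//.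
  by rewrite mulr1 lerDl divr_ge0// ltW.
rewrite -[(i.+1 == 0)%:R]/(0 : R) add0r.
elim: n => [|n IH]; first by rewrite addr0 divff ?mul1r// lt0r_neq0.
rewrite -natr1 addrA.
have -> : Gamma_pos (c + n%:R + 1) * hterm p (c + n%:R + 1) i.+1 =
    (c + n%:R) / (c + n%:R + i.+1%:R) * (Gamma_pos (c + n%:R) * hterm p (c + n%:R) i.+1).
  rewrite -(hterm_shift p i.+1 (cn0 n)) Gamma_posS//.
  have : c + n%:R + i.+1%:R != 0 by rewrite lt0r_neq0// ltr_wpDr.
  move: (Gamma_pos (c + n%:R)) (hterm p (c + n%:R + 1) i.+1) => G H.
  move: (c + n%:R) (i.+1%:R) => C I CI.
  by field.
have B : (c + n%:R) / (c + n%:R + i.+1%:R) <= (c + n%:R) / (c + n%:R + 1).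
  by rewrite ler_pM2l// lef_pV2 ?posrE ?ltr_wpDr// lerD2l ler1n.
apply: le_trans (ler_pM _ _ B IH) _.
- by rewrite divr_ge0 ?addr_ge0 ?(ltW c0).
- by rewrite mulr_ge0// ltW// ?Gamma_pos_gt0// hterm_gt0.
rewrite le_eqVlt; apply/orP; left; apply/eqP.
have h1 := lt0r_neq0 (cn0 n); have h2 : c + n%:R + 1 != 0 by rewrite lt0r_neq0// ltr_wpDr// ltW.
move: (c + n%:R) (hterm _ _ _) (Gamma_pos c) h1 h2 => C H G h1 h2.
by field; rewrite h1 h2.
Qed.

(** The limit 1 is the term of index 0; by [hterm_dominated] all the others together are at most
    [K / (n + 1)]. *)
Lemma cvg_hsum p c : 0 < p -> p + 1 / 2 < c ->
  Gamma_pos (c + n.+1%:R) * hsum p (c + n.+1%:R) @[n --> \oo] --> (1 : R).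
Proof.
move=> p0 pc; have c0 : 0 < c by apply: lt_trans pc; rewrite addr_gt0.
have C1 := is_cvg_hterm p0 pc.
pose K := c * (Gamma_pos c * hsum p c).
apply: (@squeeze_cvgr _ _ _ _ (fun=> 1) (fun n => 1 + K * harmonic n)).
- apply: nearW => n; have cn0 : 0 < c + n.+1%:R by rewrite ltr_wpDr.
  have Cn : cvgn (series (hterm p (c + n.+1%:R))) by apply: is_cvg_hterm => //; rewrite ltr_wpDr.
  have G0 := Gamma_pos_gt0 cn0.
  have CG : Gamma_pos (c + n.+1%:R) * series (hterm p (c + n.+1%:R)) m @[m --> \oo]
      --> Gamma_pos (c + n.+1%:R) * hsum p (c + n.+1%:R) by apply: cvgMl_tmp.
  rewrite -(cvg_lim _ CG)//; apply/andP; split.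
    apply: limr_ge; first by apply/cvg_ex; eexists; exact: CG.
    exists 1%N => // m /= m0; rewrite /series/= big_ltn// mulrDr.
    rewrite [X in X + _](_ : _ = 1); last first.
      rewrite /hterm big_geq// expr0 !mul1r addr0 divff// lt0r_neq0//.
    by rewrite lerDl mulr_ge0 ?(ltW G0)// sumr_ge0// => i _; rewrite ltW// hterm_gt0.
  apply: limr_le; first by apply/cvg_ex; eexists; exact: CG.
  apply: nearW => m; rewrite /series/= big_distrr/=.
  apply: (@le_trans _ _ (\sum_(0 <= i < m) ((i == 0)%:R + c / (c + n.+1%:R) * (Gamma_pos c * hterm p c i)))).
    by apply: ler_sum => i _; exact: hterm_dominated.
  rewrite big_split/= lerD//.
    case: m => [|m]; first by rewrite big_geq.
    by rewrite big_ltn// big_nat_cond big1 ?addr0// => i /andP[/andP[i0 _] _]; case: i i0.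
  rewrite -big_distrr -big_distrr/= /K /harmonic.
  have S0 : 0 <= Gamma_pos c * \sum_(0 <= i < m) hterm p c i.
    by rewrite mulr_ge0 ?(ltW (Gamma_pos_gt0 c0))// sumr_ge0// => i _; rewrite ltW// hterm_gt0.
  apply: (@le_trans _ _ (c / n.+1%:R * (Gamma_pos c * \sum_(0 <= i < m) hterm p c i))).
    rewrite ler_wpM2r// ler_pM2l// lef_pV2 ?posrE//.
    by rewrite lerDr ltW.
  rewrite [leLHS]mulrAC ler_wpM2r ?invr_ge0// ler_pM2l// ler_pM2l ?Gamma_pos_gt0//.
  apply: (nondecreasing_cvgn_le _ C1).
  by apply/nondecreasing_seqP => k; rewrite seriesSr lerDl ltW// hterm_gt0.
- exact: cvg_cst.
- rewrite -[X in _ --> X](_ : 1 + K * 0 = 1); last by rewrite mulr0 addr0.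
  by apply: cvgD; [exact: cvg_cst|apply: cvgMl_tmp; exact: cvg_harmonic].
Qed.

Local Opaque hsum hterm.

(* Gauss's value of 2F1 at 1 over Gamma(c), simplified by the duplication formula. *)
Definition hval p c : R :=
  Gamma_pos (c - p - 1 / 2) * 2 `^ (2 * c - p - 2) / (Num.sqrt pi * Gamma_pos (2 * c - p - 1)).

Let sqrtpi : Num.sqrt pi != 0 :> R.
Proof. by rewrite lt0r_neq0// sqrtr_gt0 pi_gt0. Qed.

Let pos1 p c : p + 1 / 2 < c -> 0 < c - p - 1 / 2.
Proof. by rewrite -addrA -opprD subr_gt0. Qed.

Let pos2 p c : 0 < p -> p + 1 / 2 < c -> 0 < 2 * c - p - 1.
Proof. lra. Qed.

Lemma hval_gt0 p c : 0 < p -> p + 1 / 2 < c -> 0 < hval p c.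
Proof.
move=> p0 pc; rewrite divr_gt0// mulr_gt0 ?powR_gt0 ?sqrtr_gt0 ?pi_gt0// Gamma_pos_gt0//.
  exact: pos1.
exact: pos2.
Qed.

(** When [c] grows by 1, the arguments of the two Gamma factors grow by 1 and by 2 and the power of
    2 gains a factor 4, which accounts for [(2 * c - p) * (2 * c - p - 1) = 4 * (c - p / 2) * (c -
    (p + 1) / 2)]. *)
Lemma hval_contiguous p c : 0 < p -> p + 1 / 2 < c ->
  (c - p - 1 / 2) * hval p c = (c - p / 2) * (c - (p + 1) / 2) * hval p (c + 1).
Proof.
move=> p0 pc; have x0 := pos1 pc; have y0 := pos2 p0 pc.
rewrite /hval.
have -> : c + 1 - p - 1 / 2 = c - p - 1 / 2 + 1 by ring.
have -> : 2 * (c + 1) - p - 1 = 2 * c - p - 1 + 1 + 1 by ring.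
have -> : 2 * (c + 1) - p - 2 = 2 * c - p - 2 + 2 by ring.
have y01 : 0 < 2 * c - p - 1 + 1 by rewrite ltr_wpDr.
rewrite (Gamma_posS x0) (Gamma_posS y01) (Gamma_posS y0) (@powRD _ _ (2 * c - p - 2) 2) ?pnatr_eq0 ?implybT// powR_mulrn//.
have G0 := lt0r_neq0 (Gamma_pos_gt0 y0).
have y1 := lt0r_neq0 y01.
have {}y0 := lt0r_neq0 y0; move: (Gamma_pos (c - _ - _)) (Gamma_pos (2 * c - _ - _)) G0 => G H G0.
move: sqrtpi (2 `^ _) => s0 P; field.
by rewrite s0 y1 y0 G0.
Qed.

(** Every Gamma factor is compared, through a ratio [r] tending to 1, with Gamma at [n + 1] or at
    [2 * (n + 1)]; duplication at [n + 1] cancels what remains. As [r] is indexed from 0 but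
    evaluated at [n + 1], the index [n.*2.+1] is the one that stands for [2 * (n + 1)]. *)
Lemma cvg_hval p c : 0 < p -> p + 1 / 2 < c ->
  Gamma_pos (c + n.+1%:R) * hval p (c + n.+1%:R) @[n --> \oo] --> (1 : R).
Proof.
move=> p0 pc; have x0 := pos1 pc; have y0 := pos2 p0 pc.
have c0 : 0 < c by apply: lt_trans pc; rewrite addr_gt0.
pose r (x : R) n := Gamma_pos (n.+1%:R + x) / (n.+1%:R `^ x * Gamma_pos n.+1%:R).
have r1 x : 0 <= x -> r x n @[n --> \oo] --> (1 : R) by exact: cvg_Gamma_pos_ratio.
have rd : r (2 * c - p - 1) n.*2.+1 @[n --> \oo] --> (1 : R).
  apply: (cvg_comp _ _ _ (r1 _ (ltW y0))) => A [N _ HN]; exists N => // n /= Nn.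
  by apply: HN => /=; rewrite (leq_trans Nn)// leqW// -addnn leq_addr.
rewrite (_ : (fun n => _) = fun n => r c n * r (c - p - 1 / 2) n /
   (r (2 * c - p - 1) n.*2.+1 * r (1 / 2) n)).
  rewrite -[X in _ --> X](_ : 1 * 1 / (1 * 1) = 1); last by rewrite mulr1 divr1.
  apply: cvgM; first by apply: cvgM; apply: r1; exact: ltW.
  apply: cvgV; first by rewrite mulr1 oner_eq0.
  have r12 : r (1 / 2) n @[n --> \oo] --> (1 : R) by apply: r1.
  exact: cvgM rd r12.
apply/funext => n; have n0 : 0 < n.+1%:R :> R by [].
have D := @Gamma_pos_duplication_nat R n.
rewrite /r /hval.
have -> : c + n.+1%:R - p - 1 / 2 = n.+1%:R + (c - p - 1 / 2) by ring.
have -> : 2 * (c + n.+1%:R) - p - 1 = n.*2.+2%:R + (2 * c - p - 1).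
  by rewrite -doubleS -muln2 natrM; ring.
have e2 : n.*2.+2%:R = 2 * n.+1%:R :> R by rewrite -doubleS -muln2 natrM mulrC.
have -> : 2 * (c + n.+1%:R) - p - 2 = (2 * c - p - 1) + n.*2.+1%:R.
  by have := e2; rewrite -[in LHS]natr1; lra.
rewrite (addrC c n.+1%:R).
have E : n.*2.+2%:R `^ (2 * c - p - 1) =
    2 `^ (2 * c - p - 1) * (n.+1%:R `^ c * n.+1%:R `^ (c - p - 1 / 2) / n.+1%:R `^ (1 / 2)) :> R.
  rewrite e2 powRM//; congr (_ * _).
  rewrite -powRD ?(gt_eqF n0) ?implybT// -powRB ?(gt_eqF n0) ?implybT//.
  by congr (_ `^ _); field.
rewrite E (@powRD _ _ (2 * c - p - 1) n.*2.+1%:R) ?pnatr_eq0 ?implybT// powR_mulrn//.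
have yn : 0 < n.*2.+2%:R + (2 * c - p - 1) by rewrite addr_gt0.
have g1 := lt0r_neq0 (Gamma_pos_gt0 n0).
have g2 : Gamma_pos n.*2.+2%:R != 0 :> R by rewrite lt0r_neq0 ?Gamma_pos_gt0.
have g3 := lt0r_neq0 (Gamma_pos_gt0 yn).
have g4 : Gamma_pos (n.+1%:R + 1 / 2) != 0 :> R by rewrite lt0r_neq0// Gamma_pos_gt0// addr_gt0.
have q1 x : n.+1%:R `^ x != 0 :> R by rewrite lt0r_neq0 ?powR_gt0.
have q2 : 2 `^ (2 * c - p - 1) != 0 :> R by rewrite lt0r_neq0 ?powR_gt0.
have q3 : 2 ^+ n.*2.+1 != 0 :> R by rewrite expf_neq0.
move: D (q1 c) (q1 (c - p - 1 / 2)) (q1 (1 / 2)) g1 g2 g3 g4 q2 q3 sqrtpi.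
move: (Gamma_pos n.+1%:R) (Gamma_pos n.*2.+2%:R) (Gamma_pos (n.*2.+2%:R + _)) (Gamma_pos (n.+1%:R + 1 / 2)).
move: (Gamma_pos (n.+1%:R + c)) (Gamma_pos (n.+1%:R + (c - p - 1 / 2))).
move: (n.+1%:R `^ c) (n.+1%:R `^ (c - p - 1 / 2)) (n.+1%:R `^ (1 / 2)) (2 `^ (2 * c - p - 1)) (2 ^+ n.*2.+1) (Num.sqrt pi).
move=> a1 a2 a3 P1 P2 s G1 G2 H1 H2 H3 H4 D b1 b2 b3 h1 h2 h3 h4 Q1 Q2 s0.
have -> : H2 = H1 * H4 * P2 / s by rewrite D; field.
field.
by rewrite b1 b2 b3 h1 h3 h4 Q1 Q2 s0.
Qed.

Local Opaque hval.

(* Both sides obey the same contiguity relation in c, hence their quotient is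
   invariant under c -> c + 1, and it tends to 1 at infinity. *)
Lemma hsumE p c : 0 < p -> p + 1 / 2 < c -> hsum p c = hval p c.
Proof.
move=> p0 pc; have c0 : 0 < c by apply: lt_trans pc; rewrite addr_gt0.
have pcn n : p + 1 / 2 < c + n%:R by rewrite ltr_wpDr.
have H n : hsum p (c + n%:R) / hval p (c + n%:R) = hsum p c / hval p c.
  elim: n => [|n IH]; first by have -> : c + 0%:R = c by rewrite addr0.
  rewrite -[RHS]IH {IH} -natr1 addrA.
  have /lt0r_neq0 h0 := pos1 (pcn n).
  have /lt0r_neq0 v0 := hval_gt0 p0 (pcn n).
  have E1 := hsum_contiguous p0 (pcn n); have E2 := hval_contiguous p0 (pcn n).
  have pcn1 : p + 1 / 2 < c + n%:R + 1 by apply: lt_trans (pcn n) _; rewrite ltrDl.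
  have /lt0r_neq0 v1 := hval_gt0 p0 pcn1.
  have k0 : (c + n%:R - p / 2) * (c + n%:R - (p + 1) / 2) != 0.
    by apply: contra_neq (mulf_neq0 h0 v0) => k0; rewrite E2 k0 mul0r.
  move: E1 E2 v0 v1 k0; move: (hsum p (c + n%:R)) (hsum p (c + n%:R + 1)) (hval p (c + n%:R)) => S0 S1 V0.
  move: (hval p (c + n%:R + 1)) (_ - p - 1 / 2) (_ * (_ - (p + 1) / 2)) => V1 D K E1 E2 v0 v1 k0.
  apply/eqP; rewrite eqr_div//; apply/eqP/(mulfI k0).
  by rewrite mulrA -E1 mulrAC E2 -mulrA (mulrC V1).
have /lt0r_neq0 v0 := hval_gt0 p0 pc.
suff R1 : hsum p c / hval p c = 1 by rewrite -[LHS](divfK v0) R1 mul1r.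
have C : Gamma_pos (c + n.+1%:R) * hsum p (c + n.+1%:R) /
    (Gamma_pos (c + n.+1%:R) * hval p (c + n.+1%:R)) @[n --> \oo] --> (1 : R).
  rewrite -[X in _ --> X]divr1.
  exact: cvgM (cvg_hsum p0 pc) (cvgV (oner_neq0 R) (cvg_hval p0 pc)).
rewrite -(cvg_lim _ C)//; apply/esym/cvg_lim => //.
rewrite (_ : (fun n => _) = fun=> hsum p c / hval p c); first exact: cvg_cst.
apply/funext => n; transitivity (hsum p (c + n.+1%:R) / hval p (c + n.+1%:R)); last exact: H.
have G0 : Gamma_pos (c + n.+1%:R) != 0 by rewrite lt0r_neq0// Gamma_pos_gt0// ltr_wpDr.
move: (hsum p _) (hval p _) (Gamma_pos _) G0 => S V G G0.
by rewrite invfM mulrACA (divff G0) mul1r.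
Qed.
End hypergeometric.

(** * Lebesgue measure on R^n: iterated integrals, dilations, products *)

Section lebesgueRn_theory.
Context {R : realType}.
Local Notation mu := (@lebesgue_measure R).
Local Open Scope ereal_scope.

(** The image of Lebesgue measure under the dilation, multiplied by [c], agrees with Lebesgue
    measure on half-open intervals, hence everywhere. *)
Lemma ge0_integral_dilation1 (c : R) (f : R -> \bar R) : (0 < c)%R ->
  measurable_fun setT f -> (forall x, 0 <= f x) ->
  \int[mu]_x f x = c%:E * \int[mu]_x f (c * x)%R.
Proof.
move=> c0 mf f0.
pose phi : measurableTypeR R -> measurableTypeR R := fun x => (c * x)%R.
have mphi : measurable_fun setT phi by exact: mulrl_measurable.
pose nu := mscale (NngNum (ltW c0))
  (measure_function_pushforward__canonical__measure_function_Measure mu mphi).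
transitivity (\int[nu]_x f x).
  apply: eq_measure_integral => A mA _.
  apply: (@lebesgue_measure_unique R nu) => // _ [[a b]] _ <-.
  change (mu `]a, b] = c%:E * mu (phi @^-1` `]a, b])).
  have -> : phi @^-1` `]a, b]%classic = `](a / c)%R, (b / c)%R]%classic.
    apply/seteqP; split => x; rewrite /= !in_itv/= /phi.
      by rewrite ltr_pdivrMr// ler_pdivlMr// mulrC.
    by rewrite ltr_pdivrMr// ler_pdivlMr// mulrC.
  rewrite !lebesgue_measure_itv/= !lte_fin ltr_pM2r ?invr_gt0//.
  case: ifPn => _; last by rewrite mule0.
  by rewrite -!EFinB -EFinM -mulrBl mulrC divfK// gt_eqF.
rewrite ge0_integral_mscale//=.
by rewrite (ge0_integral_pushforward mphi).
Qed.

Lemma measurable_tcons_fst n (x : R) :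
  measurable_fun setT (fun t : n.-tuple R => tcons (x, t)).
Proof. exact: measurableT_comp (@measurable_tcons R n) (pair1_measurable x). Qed.

Lemma ge0_integral_lebesgueRnS n (f : n.+1.-tuple R -> \bar R) :
  measurable_fun setT f -> (forall x, 0 <= f x) ->
  \int[lebesgueRn R n.+1]_x f x = \int[mu]_x \int[lebesgueRn R n]_t f (tcons (x, t)).
Proof.
move=> mf f0.
transitivity (\int[pushforward (mu \x lebesgueRn R n) (@tcons R n)]_x f x).
  reflexivity.
rewrite (ge0_integral_pushforward (@measurable_tcons R n))// preimage_setT.
rewrite fubini_tonelli1//; first exact: measurableT_comp mf (@measurable_tcons R n).
by move=> p; exact: f0.
Qed.

Lemma integral_lebesgueRn0 (f : 0.-tuple R -> \bar R) : measurable_fun setT f ->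
  \int[lebesgueRn R 0]_x f x = f [tuple].
Proof.
move=> mf; transitivity (\int[\d_([tuple] : 0.-tuple R)]_x f x).
  reflexivity.
by rewrite integral_dirac// diracT mul1e.
Qed.

Definition dilation n (c : R) (t : n.-tuple R) : n.-tuple R :=
  [tuple (c * tnth t i)%R | i < n].

Lemma measurable_dilation n c : measurable_fun setT (@dilation n c).
Proof.
apply/measurable_fun_tnthP => i.
rewrite (_ : _ \o _ = fun t : n.-tuple R => (c * tnth t i)%R); last first.
  by apply/funext => t; rewrite /= tnth_mktuple.
by apply: measurable_funM => //; exact: measurable_tnth.
Qed.

Lemma tnth_tcons0 n (p : measurableTypeR R * n.-tuple R) : tnth (tcons p) ord0 = p.1.
Proof. by rewrite (tnth_nth 0%R). Qed.

Lemma tnth_tconsS n (p : measurableTypeR R * n.-tuple R) i :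
  tnth (tcons p) (lift ord0 i) = tnth p.2 i.
Proof. by rewrite !(tnth_nth 0%R). Qed.

Lemma dilation_tcons n c x (t : n.-tuple R) :
  dilation c (tcons (x, t)) = tcons (c * x, dilation c t)%R.
Proof.
apply: eq_from_tnth => i; rewrite tnth_mktuple.
case: (unliftP ord0 i) => [j ->|->]; last by rewrite !tnth_tcons0.
by rewrite !tnth_tconsS tnth_mktuple.
Qed.

Lemma ge0_integral_dilation n c (f : n.-tuple R -> \bar R) : (0 < c)%R ->
  measurable_fun setT f -> (forall x, 0 <= f x) ->
  \int[lebesgueRn R n]_x f x = (c ^+ n)%:E * \int[lebesgueRn R n]_x f (dilation c x).
Proof.
move=> c0; elim: n f => [|n IH] f mf f0.
  rewrite expr0 mul1e; apply: eq_integral => x _; congr f.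
  by apply: eq_from_tnth => -[].
rewrite !ge0_integral_lebesgueRnS//; last exact: measurableT_comp mf (measurable_dilation c).
pose G x := \int[lebesgueRn R n]_t f (tcons (x, dilation c t)).
have mftc : measurable_fun setT (fun p : R * n.-tuple R => f (tcons p)).
  exact: measurableT_comp mf (@measurable_tcons R n).
have mfd : measurable_fun setT (fun p : R * n.-tuple R => f (tcons (p.1, dilation c p.2))).
  apply: measurableT_comp mftc _; apply/measurable_fun_pairP; split.
    exact: measurable_fst.
  exact: measurableT_comp (measurable_dilation c) measurable_snd.
have mG : measurable_fun setT G by exact: (measurable_fun_fubini_tonelli_F _ mfd).
have G0 x : 0 <= G x by exact: integral_ge0.
transitivity (\int[mu]_x ((c ^+ n)%:E * G x)).
  by apply: eq_integral => x _; rewrite IH//; exact: measurableT_comp mf (measurable_tcons_fst x).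
rewrite ge0_integralZl//; last first.
  by rewrite lee_fin exprn_ge0// ltW.
rewrite (ge0_integral_dilation1 c0 mG G0) muleA -EFinM -exprSr; congr (_ * _).
by apply: eq_integral => x _; apply: eq_integral => t _; rewrite dilation_tcons.
Qed.

Lemma enorm_dilation n c (x : n.-tuple R) : (0 <= c)%R -> enorm (dilation c x) = (c * enorm x)%R.
Proof.
move=> c0; rewrite /enorm; under eq_bigr do rewrite tnth_mktuple exprMn.
by rewrite -mulr_sumr sqrtrM ?sqr_ge0// sqrtr_sqr ger0_norm.
Qed.

Lemma enorm_ge0 n (x : n.-tuple R) : (0 <= enorm x)%R.
Proof. exact: sqrtr_ge0. Qed.

Lemma sqr_enorm n (x : n.-tuple R) : (enorm x ^+ 2 = \sum_(i < n) tnth x i ^+ 2)%R.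
Proof. by rewrite sqr_sqrtr// sumr_ge0// => i _; exact: sqr_ge0. Qed.

Section product.
Variable phi : nat -> R -> R.
Hypothesis iphi : forall i, mu.-integrable setT (EFin \o phi i).

(** Integrability and value go through the induction together, because Fubini for signed functions
    needs the former to give the latter. *)
Lemma integral_lebesgueRn_prod n (a : 'I_n -> nat) :
  let F := fun t : n.-tuple R => (\prod_(i < n) phi (a i) (tnth t i))%R in
  (lebesgueRn R n).-integrable setT (EFin \o F) /\
  \int[lebesgueRn R n]_t (F t)%:E = (\prod_(i < n) \int[mu]_x phi (a i) x)%:E.
Proof.
have mphi i : measurable_fun setT (phi i) by apply/measurable_EFinP; case/integrableP: (iphi i).
elim: n a => [|n IH] a F.
  have F1 : F = cst 1%R by apply/funext => t; rewrite /F big_ord0.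
  rewrite F1 big_ord0; split.
    apply/integrableP; split; first exact: (@measurable_cst _ _ _ _ setT 1%:E).
    by rewrite integral_lebesgueRn0//= ltry.
  by rewrite integral_lebesgueRn0//; exact: (@measurable_cst _ _ _ _ setT 1%:E).
pose b i := a (lift ord0 i).
have [I1 I2] := IH b.
set G := fun t : n.-tuple R => (\prod_(i < n) phi (b i) (tnth t i))%R in I1 I2.
have mG : measurable_fun setT G by apply/measurable_EFinP; case/integrableP: I1.
pose H (p : R * n.-tuple R) := (phi (a ord0) p.1 * G p.2)%:E.
have FE p : (F (tcons p))%:E = H p.
  rewrite /F /H big_ord_recl tnth_tcons0; congr ((_ * _)%:E).
  by apply: eq_bigr => i _; rewrite tnth_tconsS.
have mH : measurable_fun setT H.
  by apply/measurable_EFinP; apply: measurable_funM; exact: measurableT_comp.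
have iH : (mu \x lebesgueRn R n).-integrable setT H.
  apply/(integrable12ltyP mu (lebesgueRn R n) mH).
  rewrite (_ : \int[mu]_x _ = \int[mu]_x (`|phi (a ord0) x|%:E * \int[lebesgueRn R n]_t `|G t|%:E)).
    rewrite ge0_integralZr//.
    - apply: lte_mul_pinfty => //.
      + exact: integral_ge0.
      + by case/integrableP: (iphi (a ord0)) => ? ?; rewrite ge0_fin_numE//; exact: integral_ge0.
      + by case/integrableP: I1.
    - by apply/measurable_EFinP; apply: measurableT_comp => //; exact: mphi.
    - exact: integral_ge0.
  apply: eq_integral => x _; rewrite -ge0_integralZl//.
    by apply: eq_integral => t _; rewrite /H /= normrM.
  by apply/measurable_EFinP; exact: measurableT_comp.
have mF : measurable_fun setT (EFin \o F).
  apply/measurable_EFinP; apply: measurable_prod => i _.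
  exact: measurableT_comp (measurable_tnth _).
have iF : (mu \x lebesgueRn R n).-integrable setT ((EFin \o F) \o @tcons R n).
  by rewrite (_ : _ \o _ = H)//; apply/funext => p; exact: FE.
split.
  have := @integrable_pushforward _ _ _ _ _ _ (@measurable_tcons R n) (mu \x lebesgueRn R n)%E setT _ mF.
  rewrite preimage_setT => /(_ iF measurableT) /integrableP[_ H1].
  by apply/integrableP; split.
transitivity (\int[pushforward (mu \x lebesgueRn R n) (@tcons R n)]_x (EFin \o F) x).
  reflexivity.
rewrite (integral_pushforward (@measurable_tcons R n))// preimage_setT.
transitivity (\int[mu \x lebesgueRn R n]_x H x); first by apply: eq_integral => p _; exact: FE.
rewrite -(integral12_prod_meas1 iH) big_ord_recl EFinM -/G.
transitivity (\int[mu]_x ((phi (a ord0) x)%:E * (\prod_(i < n) \int[mu]_x phi (b i) x)%:E)).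
  apply: eq_integral => x _; rewrite /fubini_F -I2 -integralZl//.
rewrite integralZr//.
  by rewrite /Rintegral fineK//; exact: integrable_fin_num (iphi (a ord0)).
exact: iphi.
Qed.
End product.

End lebesgueRn_theory.

Local Opaque lebesgueRn.

(** * Polar coordinates with a Gaussian weight *)

Section polar.
Context {R : realType} (n : nat).
Local Notation mu := (@lebesgue_measure R).
Local Notation d := n.+1.
Local Notation L := (lebesgueRn R d).
Local Open Scope ereal_scope.

Lemma direction_dilation (c : R) (x : d.-tuple R) : (0 < c)%R ->
  direction (dilation c x) = direction x.
Proof.
move=> c0; rewrite /direction; congr insubd; apply: eq_from_tnth => i.
by rewrite !tnth_mktuple enorm_dilation ?(ltW c0)// -mulf_div divff ?mul1r// gt_eqF.
Qed.

Lemma direction_val (x : d.-tuple R) : (0 < enorm x)%R ->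
  sphere_val (direction x) = [tuple (tnth x i / enorm x)%R | i < d].
Proof.
move=> x0; rewrite -[LHS]/(val _) val_insubd.
rewrite (_ : [tuple _ | i < d] = dilation (enorm x)^-1 x); last first.
  by apply: eq_from_tnth => i; rewrite !tnth_mktuple mulrC.
by rewrite enorm_dilation ?invr_ge0 ?enorm_ge0// mulVf ?eqxx// gt_eqF.
Qed.

Lemma ge0_integral_mrestr dd (T : measurableType dd) (m : {measure set T -> \bar R})
    (D : set T) (mD : measurable D) (f : T -> \bar R) :
  measurable_fun setT f -> (forall x, 0 <= f x) ->
  \int[mrestr m mD]_x f x = \int[m]_(x in D) f x.
Proof.
move=> mf f0; rewrite -(setUv D) ge0_integral_setU//; last 3 first.
- exact: measurableC.
- by rewrite setUv.
- exact/disj_setPCl.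
rewrite [X in _ + X]null_set_integral ?adde0; last 3 first.
- exact: measurableC.
- exact: measurable_funTS.
- by transitivity (m (~` D `&` D)) => //; rewrite setICl measure0.
apply: eq_measure_integral => A mA AD.
by transitivity (m (A `&` D)) => //; rewrite setIidl.
Qed.

(** Made for the surface measure, which has this shape with [f] the direction map, [D] the punctured
    unit ball and [k] the dimension. *)
Lemma ge0_integral_restr_pushforward dd dd' (T : measurableType dd) (S : measurableType dd')
    (m : {measure set T -> \bar R}) (nu : {measure set S -> \bar R}) (f : T -> S)
    (mf : measurable_fun setT f) (D : set T) (mD : measurable D) (k : {nonneg R}) (h : S -> \bar R) :
  (forall A, measurable A -> nu A = k%:num%:E * m (f @^-1` A `&` D)) ->
  measurable_fun setT h -> (forall x, 0 <= h x) ->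
  \int[nu]_y h y = k%:num%:E * \int[m]_(x in D) h (f x).
Proof.
move=> nuE mh h0.
pose cone := measure_function_pushforward__canonical__measure_function_Measure (mrestr m mD) mf.
transitivity (\int[mscale k cone]_t h t).
  by apply: eq_measure_integral => A mA _; rewrite nuE.
rewrite ge0_integral_mscale//=; congr (_ * _).
rewrite (ge0_integral_pushforward mf)// preimage_setT.
rewrite ge0_integral_mrestr//; first exact: measurableT_comp mh mf.
by move=> x; exact: h0.
Qed.

Variable g : sphere R n -> \bar R.
Hypotheses (mg : measurable_fun setT g) (g0 : forall x, 0 <= g x).

(** The extension of [g] that is constant along rays; it is 0 at the origin, where [direction] has a
    junk value. *)
Let G (x : d.-tuple R) : \bar R := if (0 < enorm x)%R then g (direction x) else 0.

Let mG : measurable_fun setT G.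
Proof.
apply: measurable_fun_ifT => //.
  by apply: measurable_fun_ltr => //; exact: measurable_enorm.
exact: measurableT_comp mg (@measurable_direction R n).
Qed.

Let G0 x : 0 <= G x. Proof. by rewrite /G; case: ifPn. Qed.

Let G_dilation c x : (0 < c)%R -> G (dilation c x) = G x.
Proof.
by move=> c0; rewrite /G enorm_dilation ?(ltW c0)// pmulr_rgt0// direction_dilation.
Qed.

Let W m u := \int[L]_(x in [set x | (enorm x <= u)%R]) ((enorm x ^+ m)%:E * G x).

Let mle u : measurable [set x : d.-tuple R | (enorm x <= u)%R].
Proof.
rewrite [X in measurable X](_ : _ = @enorm R d @^-1` `]-oo, u]%classic).
  by rewrite -[X in measurable X]setTI; exact: measurable_enorm.
by apply/seteqP; split => x; rewrite /= in_itv.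
Qed.

Let mnG m : measurable_fun setT (fun x => (enorm x ^+ m)%:E * G x).
Proof.
by apply: emeasurable_funM => //; apply/measurable_EFinP/measurable_funX; exact: measurable_enorm.
Qed.

Let nG0 m x : 0 <= (enorm x ^+ m)%:E * G x.
Proof. by rewrite mule_ge0// lee_fin exprn_ge0// enorm_ge0. Qed.

Let in_ball x u : (x \in [set x : d.-tuple R | (enorm x <= u)%R]) = (enorm x <= u)%R.
Proof. by apply/idP/idP; rewrite inE. Qed.

Let WE m u : (0 < u)%R -> W m u = (u ^+ (m + d))%:E * W m 1%R.
Proof.
move=> u0; rewrite /W [LHS]integral_mkcond (ge0_integral_dilation u0); last 2 first.
- by apply/(measurable_restrictT _ (mle u)); exact: measurable_funTS (mnG m).
- by move=> x; rewrite patchE; case: ifPn.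
rewrite addnC exprD EFinM -muleA; congr (_ * _).
rewrite -ge0_integralZl//; last 2 first.
- exact: measurable_funTS (mnG m).
- by rewrite lee_fin exprn_ge0// ltW.
rewrite [RHS]integral_mkcond; apply: eq_integral => x _; rewrite !patchE.
rewrite !in_ball enorm_dilation ?(ltW u0)// ger_pMr//.
by case: ifPn => // _; rewrite exprMn G_dilation// EFinM muleA.
Qed.

Lemma integral_surface_measureE : \int[@surface_measure R n]_t g t = d%:R%:E * W 0 1%R.
Proof.
pose ball : set (d.-tuple R) := [set x | (0 < enorm x <= 1)%R].
have mball : measurable ball.
  rewrite (_ : ball = @enorm R d @^-1` `]0%R, 1%R]%classic); last first.
    by apply/seteqP; split => x; rewrite /= in_itv.
  by rewrite -[X in measurable X]setTI; exact: measurable_enorm.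
rewrite (@ge0_integral_restr_pushforward _ _ _ _ L _ _ (@measurable_direction R n) _ mball (NngNum (ler0n R d)))//=; last first.
  by move=> A mA; congr (_ * L _); apply/seteqP; split => x [].
congr (_ * _).
rewrite /W [LHS]integral_mkcond [RHS]integral_mkcond; apply: eq_integral => x _.
rewrite !patchE expr0 mul1e /G in_ball.
have -> : (x \in ball) = (0 < enorm x <= 1)%R by apply/idP/idP; rewrite inE.
by case: ltP => //= _; rewrite if_same.
Qed.

(* Fubini for 1 - |x|^m, the measure of the v in [|x|^m, 1], avoids
   differentiating the volume of the cones in the radius. *)
Let W_radial m : (m != 0%N -> W 0 1%R < +oo) -> (m + d)%:R%:E * W m 1%R = d%:R%:E * W 0 1%R.
Proof.
case: m => [//|m /(_ isT) Woo].
have W00 k u : 0 <= W k u by exact: integral_ge0.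
pose F (z : (d.-tuple R) * R) := if (enorm z.1 <= 1)%R && (0 < z.2 <= 1)%R &&
  (enorm z.1 ^+ m.+1 <= z.2)%R then G z.1 else 0.
have F0 z : 0 <= F z by rewrite /F; case: ifPn.
have mF : measurable_fun setT F.
  have men : measurable_fun setT (fun z : d.-tuple R * R => enorm z.1).
    by apply: measurableT_comp => //; exact: measurable_enorm.
  apply: measurable_fun_ifT => //.
    apply: measurable_and; last first.
      by apply: measurable_fun_ler => //; exact: measurable_funX.
    apply: measurable_and; first exact: measurable_fun_ler.
    by apply: measurable_and; [exact: measurable_fun_ltr|exact: measurable_fun_ler].
  exact: measurableT_comp.
have := @fubini_tonelli _ _ _ _ _ L mu F mF F0.
pose w : R := (d%:R / m.+1%:R)%R.
have w0 : (0 < w + 1 :> R)%R by rewrite ltr_wpDl ?divr_ge0.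
have -> : \int[mu]_v \int[L]_x F (x, v) = (m.+1%:R / (m.+1 + d)%:R)%:E * W 0 1%R.
  transitivity (\int[mu]_(v in `]0%R, 1%R]) (W 0 1%R * (v `^ (w + 1 - 1))%:E)).
    rewrite [RHS]integral_mkcond; apply: eq_integral => v _.
    rewrite patchE mem_setE in_itv/=; case: ifPn => [/andP[v0 v1]|]; last first.
      by move=> /negbTE v01; apply: integral0_eq => x _; rewrite /F/= v01 andbF.
    have vw0 : (0 < v `^ (m.+1%:R^-1))%R by rewrite powR_gt0.
    transitivity (W 0 (v `^ (m.+1%:R^-1))%R); last first.
      rewrite (WE 0 vw0) muleC; congr (_ * _%:E).
      by rewrite -powR_mulrn ?powR_ge0// -powRrM addrK /w mulrC.
    rewrite /W [RHS]integral_mkcond; apply: eq_integral => x _.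
    rewrite patchE expr0 mul1e /F/= v0 v1/= andbT.
    have E : (enorm x ^+ m.+1 <= v)%R = (enorm x <= v `^ (m.+1%:R^-1))%R.
      have vE : v = ((v `^ (m.+1%:R^-1)) ^+ m.+1)%R.
        by rewrite -powR_mulrn ?powR_ge0// -powRrM mulVf// powRr1// ltW.
      by rewrite [in LHS]vE ler_pXn2r// nnegrE ?enorm_ge0 ?powR_ge0.
    rewrite in_ball E; case: (leP (enorm x) (v `^ (m.+1%:R^-1))%R) => xv; last by rewrite andbF.
    rewrite andbT (le_trans xv)//.
    have q0 : (0 <= m.+1%:R^-1 :> R)%R by rewrite invr_ge0.
    have vn : v \in Num.nneg by rewrite nnegrE ltW.
    have on : (1%R : R) \in Num.nneg by rewrite nnegrE.
    by have := ge0_ler_powR q0 vn on v1; rewrite powR1.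
  rewrite ge0_integralZl//.
  - rewrite integral_powR// powR1 muleC; congr (_%:E * _).
    have n0 : (m.+1 + d)%:R != 0%R :> R by rewrite pnatr_eq0.
    have m0 : m.+1%:R != 0%R :> R by rewrite pnatr_eq0.
    move: n0 m0; rewrite /w natrD; move: (m.+1%:R : R) (d%:R : R) => M D n0 m0.
    have -> : (D / M + 1)%R = ((M + D) / M)%R by rewrite mulrDl divff// addrC.
    by rewrite div1r invf_div.
  - by apply/measurable_EFinP/measurable_funTS; exact: measurable_powR.
  - by move=> v _; rewrite lee_fin powR_ge0.
have -> : \int[L]_x \int[mu]_v F (x, v) =
    \int[L]_(x in [set x | (enorm x <= 1)%R]) ((1 - enorm x ^+ m.+1)%:E * G x).
  rewrite [RHS]integral_mkcond; apply: eq_integral => x _.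
  rewrite patchE in_ball; case: ifPn => x1; last by apply: integral0_eq => v _; rewrite /F/= (negbTE x1).
  have [x0|x0] := ltP 0%R (enorm x); last first.
    have Gx : G x = 0 by rewrite /G ltNge x0.
    by rewrite Gx mule0; apply: integral0_eq => v _; rewrite /F/= Gx if_same.
  have xm0 : (0 < enorm x ^+ m.+1)%R by rewrite exprn_gt0.
  have xm1 : (enorm x ^+ m.+1 <= 1)%R by rewrite exprn_ile1// ltW.
  transitivity (\int[mu]_(v in `[(enorm x ^+ m.+1)%R, 1%R]) (cst (G x) v)).
    rewrite [RHS]integral_mkcond; apply: eq_integral => v _.
    rewrite patchE mem_setE in_itv/= /F/= x1/= [in LHS]andbC.
    case: (leP (enorm x ^+ m.+1)%R v) => //= xv.
    by rewrite (lt_le_trans xm0 xv).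
  rewrite integral_cst//= lebesgue_measure_itv/= lte_fin muleC; congr (_ * _).
  by case: ltP => // h; rewrite -?EFinB//; congr EFin; apply/esym/eqP; rewrite subr_eq0 eq_le h.
move=> E.
have Wsum : W 0 1%R = W m.+1 1%R + (m.+1%:R / (m.+1 + d)%:R)%:E * W 0 1%R.
  rewrite -E /W -ge0_integralD//; last 3 first.
  - exact: measurable_funTS (mnG _).
  - move=> x /= x1; apply: mule_ge0 => //; rewrite lee_fin subr_ge0.
    by apply: exprn_ile1 => //; exact: enorm_ge0.
  - apply: measurable_funTS; apply: emeasurable_funM => //; apply/measurable_EFinP.
    by apply: measurable_funB => //; apply: measurable_funX; exact: measurable_enorm.
  apply: eq_integral => x; rewrite inE/= => x1.
  rewrite -ge0_muleDl ?lee_fin ?exprn_ge0 ?enorm_ge0//; last first.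
    by rewrite subr_ge0 exprn_ile1// enorm_ge0.
  by rewrite -EFinD addrC subrK expr0.
have Wf : W 0 1%R \is a fin_num by rewrite ge0_fin_numE.
have Wmf : W m.+1 1%R \is a fin_num.
  rewrite ge0_fin_numE// (le_lt_trans _ Woo)// [leRHS]Wsum leeDl// mule_ge0// lee_fin divr_ge0//.
move: Wsum; rewrite -(fineK Wf) -(fineK Wmf) -!EFinM -EFinD => -[Ws]; congr EFin.
have n0 : (m.+1 + d)%:R != 0%R :> R by rewrite pnatr_eq0.
move: Ws n0; rewrite natrD; move: (fine (W 0 1%R)) (fine (W m.+1 1%R)) (m.+1%:R : R) (d%:R : R) => a b M D Ws n0.
have -> : b = (a - M / (M + D) * a)%R by apply/eqP; rewrite eq_sym subr_eq -Ws.
by field.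
Qed.

(** Layer cake with [rho x = |x|^2]: the integrals over balls scale like u^((m + d)/2), and
    [W_radial] converts the one over the unit ball into the surface integral. Finiteness is
    requested for [m > 0], so that the case [m = 0], [g = 1] can serve to prove that the sphere has
    finite area. *)
Lemma integral_polar_gauss m : (m != 0%N -> \int[@surface_measure R n]_t g t < +oo) ->
  \int[L]_x ((enorm x ^+ m)%:E * G x * (expR (- enorm x ^+ 2))%:E) =
  (Gamma_pos ((m + d)%:R / 2) / 2)%:E * \int[@surface_measure R n]_t g t.
Proof.
move=> Soo.
have md0 : (0 < (m + d)%:R / 2 :> R)%R by rewrite divr_gt0// ltr0n addnS.
have W00 k u : 0 <= W k u by exact: integral_ge0.
rewrite (@layer_cake_expRN _ _ _ L (fun x => enorm x ^+ 2)%R (fun x => (enorm x ^+ m)%:E * G x))//; last 2 first.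
- by apply: measurable_funX; exact: measurable_enorm.
- by move=> x; exact: sqr_ge0.
transitivity (\int[mu]_(u in `]0%R, +oo[) ((expR (- u))%:E * ((u `^ ((m + d)%:R / 2))%:E * W m 1%R))).
  apply: eq_integral => u; rewrite inE/= in_itv/= andbT => u0; congr (_ * _).
  have s0 : (0 < Num.sqrt u)%R by rewrite sqrtr_gt0.
  rewrite (_ : (u `^ _)%:E * _ = W m (Num.sqrt u)).
    rewrite /W; congr integral; apply/seteqP; split => x /=.
      by rewrite -[in X in X -> _](sqr_sqrtr (ltW u0)) ler_pXn2r// nnegrE ?enorm_ge0// ltW.
    by rewrite -[in X in _ -> X](sqr_sqrtr (ltW u0)) ler_pXn2r// nnegrE ?enorm_ge0// ltW.
  rewrite (WE _ s0); congr (_%:E * _).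
  by rewrite -(powR12_sqrt (ltW u0)) -(powR_mulrn _ (powR_ge0 _ _)) -powRrM mulrC.
rewrite Gamma_pos_layer_cake//.
rewrite Gamma_posS// integral_surface_measureE -(@W_radial m); last first.
  move=> /Soo; rewrite integral_surface_measureE; apply: contraTT.
  rewrite -!leNgt !leye_eq => /eqP ->.
  by rewrite mulry gtr0_sg// mul1e.
rewrite muleA -EFinM; congr (_ %:E * _).
by field.
Qed.

End polar.

(** * Gaussian moments on the line *)

Section gauss_moments.
Context {R : realType}.
Local Notation mu := (@lebesgue_measure R).
Local Open Scope ereal_scope.

Definition gaussX (j : nat) (x : R) : R := (x ^+ j * expR (- x ^+ 2))%R.

Definition gmom (j : nat) : R := (\int[mu]_x gaussX j x)%R.

Lemma measurable_gaussX j : measurable_fun setT (gaussX j).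
Proof.
apply: measurable_funM; first exact: measurable_funX.
apply: measurableT_comp => //; apply: measurableT_comp => //; exact: measurable_funX.
Qed.

Let integrable_even i : mu.-integrable setT (EFin \o gaussX i.*2).
Proof.
apply/integrableP; split.
  by apply/measurable_EFinP; exact: measurable_gaussX.
under eq_integral => x _.
  rewrite /= ger0_norm; last first.
    by rewrite /gaussX -mul2n exprM mulr_ge0// ?expR_ge0// exprn_ge0// sqr_ge0.
  over.
by rewrite integral_even_gauss ltry.
Qed.

(** Odd powers are dominated by even ones: |x|^j <= 1 + |x|^(j+1). *)
Lemma integrable_gaussX j : mu.-integrable setT (EFin \o gaussX j).
Proof.
have [jo|je] := boolP (odd j); last first.
  by rewrite -(odd_double_half j) (negbTE je) add0n; exact: integrable_even.
pose h (x : R) := (gaussX 0 x + gaussX j.+1 x)%R.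
have ih : mu.-integrable setT (EFin \o h).
  rewrite (_ : EFin \o h = (EFin \o gaussX 0) \+ (EFin \o gaussX j.+1)); last exact/funext.
  apply: integrableD => //; first exact: (integrable_even 0).
  by rewrite (_ : j.+1 = (j.+1)./2.*2); [exact: integrable_even|
    rewrite -[LHS]odd_double_half /= jo].
apply: le_integrable ih => //; first by apply/measurable_EFinP; exact: measurable_gaussX.
move=> x _; rewrite !abse_EFin lee_fin /h /gaussX -mulrDl !normrM.
rewrite ler_wpM2r// expr0 normrX.
have -> : (x ^+ j.+1 = `|x| ^+ j.+1)%R.
  by rewrite -[RHS]normrX ger0_norm// exprn_even_ge0//= jo.
rewrite (@ger0_norm _ (1 + _)%R); last by rewrite addr_ge0// exprn_ge0.
have [x1|x1] := leP `|x|%R 1%R.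
  rewrite (@le_trans _ _ 1%R)//; first exact: exprn_ile1.
  by rewrite lerDl exprn_ge0.
rewrite (@le_trans _ _ (`|x| ^+ j.+1)%R)//; last by rewrite lerDr.
by apply: ler_weXn2l => //; exact: ltW.
Qed.

Lemma gmomE j : (gmom j)%:E = \int[mu]_x (gaussX j x)%:E.
Proof. by rewrite /gmom /Rintegral fineK// integrable_fin_num//; exact: integrable_gaussX. Qed.

Lemma gmom_even i : gmom i.*2 = Gamma_pos (i%:R + 1 / 2)%R.
Proof. by apply: EFin_inj; rewrite gmomE; exact: integral_even_gauss. Qed.

Lemma ge0_integral_oppr (f : R -> \bar R) : measurable_fun setT f -> (forall x, 0 <= f x) ->
  \int[mu]_x f x = \int[mu]_x f (- x)%R.
Proof.
move=> mf f0.
have mN : measurable_fun setT (-%R : measurableTypeR R -> measurableTypeR R).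
  exact: oppr_measurable.
pose nu := measure_function_pushforward__canonical__measure_function_Measure mu mN.
transitivity (\int[nu]_x f x).
  by apply: eq_measure_integral => A mA _; exact: (esym (lebesgue_measureN mA)).
by rewrite (ge0_integral_pushforward mN).
Qed.

(** The reflection exchanges the positive and the negative part, whose integrals are finite and
    therefore cancel. *)
Lemma gmom_odd j : odd j -> gmom j = 0%R.
Proof.
move=> o; apply: EFin_inj; rewrite gmomE [LHS]integralE.
have mg := (measurable_EFinP _ _).2 (measurable_gaussX j).
rewrite (ge0_integral_oppr (f := (EFin \o gaussX j)^\+)) => [|| //]; last first.
  exact: measurable_funepos.
rewrite (_ : (fun x => _ (- x)%R) = (EFin \o gaussX j)^\-); last first.
  apply/funext => x; rewrite funeposE funenegE /gaussX /= sqrrN exprNn -signr_odd o expr1.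
  by rewrite mulN1r mulNr.
by rewrite subee// integrable_neg_fin_num//; exact: integrable_gaussX.
Qed.

(** Integration by parts in disguise: even moments are values of Gamma at half-integers, related by
    the functional equation. *)
Lemma gmomSS j : gmom j.+2 = (j.+1%:R / 2 * gmom j)%R.
Proof.
have [jo|je] := boolP (odd j); first by rewrite !gmom_odd/= ?jo// mulr0.
have -> : j = (j./2).*2 by rewrite -[LHS]odd_double_half (negbTE je).
rewrite -doubleS !gmom_even -[in LHS]natr1 addrAC Gamma_posS; last first.
  by rewrite ltr_wpDl// divr_gt0.
congr (_ * _)%R; rewrite -[(j./2).*2.+1%:R]natr1 -muln2 natrM.
by rewrite (_ : j./2%:R * 2%:R + 1 = (j./2%:R + 1 / 2) * 2)%R ?mulfK//; lra.
Qed.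

End gauss_moments.

(** * The surface measure: finiteness and integrals of monomials *)

Section sphere_moments.
Context {R : realType} (n : nat).
Local Notation mu := (@lebesgue_measure R).
Local Notation d := n.+1.
Local Notation L := (lebesgueRn R d).
Local Notation S := (@surface_measure R n).
Local Open Scope ereal_scope.

Definition tmono k (a : 'I_k -> nat) (x : k.-tuple R) : R := (\prod_(i < k) tnth x i ^+ a i)%R.

Lemma measurable_tmono k (a : 'I_k -> nat) : measurable_fun setT (tmono a).
Proof.
by apply: measurable_prod => i _; apply: measurable_funX; exact: measurable_tnth.
Qed.

Lemma tmono_dilation k (a : 'I_k -> nat) c (x : k.-tuple R) :
  tmono a (dilation c x) = (c ^+ (\sum_i a i) * tmono a x)%R.
Proof.
rewrite /tmono expr_sum -big_split; apply: eq_bigr => i _.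
by rewrite tnth_mktuple exprMn.
Qed.

Lemma integral_gauss_mono k (a : 'I_k -> nat) :
  (lebesgueRn R k).-integrable setT (fun x => (tmono a x * expR (- enorm x ^+ 2))%:E) /\
  \int[lebesgueRn R k]_x (tmono a x * expR (- enorm x ^+ 2))%:E = (\prod_i gmom (a i))%:E.
Proof.
have [iF IF] := integral_lebesgueRn_prod (@integrable_gaussX R) a.
have E : (fun x => (tmono a x * expR (- enorm x ^+ 2))%:E) =
  EFin \o (fun t : k.-tuple R => (\prod_(i < k) gaussX (a i) (tnth t i))%R).
  apply/funext => x /=; congr EFin; rewrite /gaussX big_split/=; congr (_ * _)%R.
  by rewrite sqr_enorm -sumrN expR_sum.
by rewrite E.
Qed.

Lemma enorm_sphere (x : sphere R n) : enorm (sphere_val x) = 1%R.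
Proof. by apply/eqP; exact: sphere_valP. Qed.

Lemma le_tnth_enorm k (x : k.-tuple R) i : (`|tnth x i| <= enorm x)%R.
Proof.
rewrite -ler_sqr ?nnegrE ?enorm_ge0// sqr_enorm real_normK ?num_real//.
by rewrite (bigD1 i)//= lerDl sumr_ge0// => j _; exact: sqr_ge0.
Qed.

Lemma tmono_le1 (a : 'I_d -> nat) (x : sphere R n) : (`|tmono a (sphere_val x)| <= 1)%R.
Proof.
rewrite normr_prod; apply: prodr_ile1 => i _; rewrite normrX exprn_ge0//=.
by rewrite exprn_ile1// -[leRHS](enorm_sphere x); exact: le_tnth_enorm.
Qed.

Lemma measurable_sphere_val : measurable_fun setT (@sphere_val R n).
Proof. by move=> _ B mB; exists B. Qed.

Lemma gauss_integral_lty : \int[L]_x (expR (- enorm x ^+ 2))%:E < +oo.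
Proof.
have [+ _] := @integral_gauss_mono d (fun=> 0%N).
move=> /integrableP[_]; apply: le_lt_trans; rewrite le_eqVlt; apply/orP; left; apply/eqP.
apply: eq_integral => x _; rewrite /tmono big1 ?mul1r => [|i _]; last by rewrite expr0.
by rewrite /= ger0_norm// expR_ge0.
Qed.

Lemma measurable_gauss : measurable_fun setT (fun x : d.-tuple R => expR (- enorm x ^+ 2)).
Proof.
apply: measurableT_comp => //; apply: measurableT_comp => //; apply: measurable_funX.
exact: measurable_enorm.
Qed.

(** The polar formula with [m = 0] and [g = 1] makes the area, times a positive constant, at most
    the Gaussian integral over R^d. *)
Lemma surface_measure_lty : S setT < +oo.
Proof.
have := @integral_polar_gauss R n (cst 1) (measurable_cst _) (fun=> lee01) 0%N (fun h => False_ind _ (elimN eqP h erefl)).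
rewrite integral_cst// mul1e => E.
have G0 : (0 < Gamma_pos ((0 + d)%:R / 2) / 2 :> R)%R.
  by rewrite divr_gt0// Gamma_pos_gt0// divr_gt0.
have : (Gamma_pos ((0 + d)%:R / 2) / 2)%:E * S setT < +oo.
  rewrite -E; apply: le_lt_trans gauss_integral_lty.
  apply: ge0_le_integral => //.
  - by move=> x _; case: ifPn; rewrite ?mule0 ?mul0e// mule1 mul1e lee_fin expR_ge0.
  - apply: emeasurable_funM; last by apply/measurable_EFinP; exact: measurable_gauss.
    apply: emeasurable_funM.
      by apply/measurable_EFinP/measurable_funX; exact: measurable_enorm.
    apply: measurable_fun_ifT => //.
    by apply: measurable_fun_ltr => //; exact: measurable_enorm.
  - by apply/measurable_EFinP; exact: measurable_gauss.
  - move=> x _; case: ifPn => _; first by rewrite mule1 mul1e.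
    by rewrite mule0 mul0e lee_fin expR_ge0.
apply: contraTT; rewrite -!leNgt !leye_eq => /eqP ->.
by rewrite mulry gtr0_sg// mul1e.
Qed.

(** The origin is invariant under dilation by 2, so its mass equals 2^d times itself; the mass is
    finite, since the Gaussian is 1 there, and hence 0. *)
Lemma lebesgueRn_origin : L [set x | enorm x = 0%R] = 0.
Proof.
set Z := [set x | _].
have mZ : measurable Z.
  by rewrite -[Z]setTI; exact: (@measurable_enorm R d measurableT [set 0%R] (measurable_set1 _)).
have Zoo : L Z < +oo.
  apply: le_lt_trans gauss_integral_lty.
  rewrite -(setIT Z) -integral_indic//; apply: ge0_le_integral => //.
  - by apply/measurable_EFinP; exact: measurable_indic.
  - by apply/measurable_EFinP; exact: measurable_gauss.
  - move=> x _; rewrite lee_fin indicE; case: (boolP (x \in Z)) => [|_]; last exact: expR_ge0.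
    by rewrite inE /Z/= => ->; rewrite expr0n oppr0 expR0.
have E : L Z = (2 ^+ d)%R%:E * L Z.
  rewrite -[in LHS](setIT Z) -[in RHS](setIT Z) -!integral_indic//.
  rewrite [LHS](@ge0_integral_dilation _ _ 2%R)//; last first.
    by apply/measurable_EFinP; exact: measurable_indic.
  congr (_ * _); apply: eq_integral => x _; congr (_%:R%:E); congr nat_of_bool.
  apply/idP/idP; rewrite !inE /Z/= enorm_dilation//; last by move=> ->; rewrite mulr0.
  by move=> /eqP; rewrite mulf_eq0 pnatr_eq0/= => /eqP.
have Zf : L Z \is a fin_num by rewrite ge0_fin_numE.
move: E; rewrite -(fineK Zf) -EFinM => -[] /eqP.
rewrite -subr_eq0 -{1}[fine _]mul1r -mulrBl mulf_eq0 subr_eq0 => /orP[|/eqP->//].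
by rewrite eq_sym gt_eqF// exprn_egt1// ltr1n.
Qed.

Let F (a : 'I_d -> nat) x := (tmono a x * expR (- enorm x ^+ 2))%R.

(** The polar formula takes nonnegative functions: [e = 1] and [e = -1] give the positive and the
    negative part of the monomial. By homogeneity, |x|^m times the value at x/|x| is the monomial
    itself, off the null set of the origin. *)
Lemma integral_polar_monoW (a : 'I_d -> nat) (e : R) : (`|e| = 1)%R ->
  \int[L]_x (Num.max (e * F a x) 0)%:E =
  (Gamma_pos ((\sum_i a i + d)%:R / 2) / 2)%:E *
    \int[S]_t (Num.max (e * tmono a (sphere_val t)) 0)%:E.
Proof.
move=> e1.
have mg : measurable_fun setT (fun t : sphere R n => Num.max (e * tmono a (sphere_val t)) 0)%R.
  apply: measurable_funS (@measurableT _ _) _ _ => //.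
  apply: measurable_maxr => //; apply: measurable_funM => //.
  exact: measurableT_comp (measurable_tmono a) measurable_sphere_val.
rewrite -integral_polar_gauss; last 3 first.
- by apply/measurable_EFinP.
- by move=> x; rewrite lee_fin le_max lexx orbT.
- move=> _; apply: (@le_lt_trans _ _ (\int[S]_t (cst 1 t))); last first.
    by rewrite integral_cst// mul1e surface_measure_lty.
  apply: ge0_le_integral => //.
  - by move=> x _; rewrite lee_fin le_max lexx orbT.
  - by apply/measurable_EFinP.
  - move=> x _; rewrite lee_fin ge_max ler01 andbT (le_trans (ler_norm _))//.
    by rewrite normrM e1 mul1r tmono_le1.
apply: ae_eq_integral => //.
- apply/measurable_EFinP; apply: measurable_maxr => //; apply: measurable_funM => //.
  by apply: measurable_funM; [exact: measurable_tmono|exact: measurable_gauss].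
- apply: emeasurable_funM; last by apply/measurable_EFinP; exact: measurable_gauss.
  apply: emeasurable_funM.
    by apply/measurable_EFinP/measurable_funX; exact: measurable_enorm.
  apply: measurable_fun_ifT => //.
    by apply: measurable_fun_ltr => //; exact: measurable_enorm.
  exact: measurableT_comp ((measurable_EFinP _ _).2 mg) (@measurable_direction R n).
exists [set x | enorm x = 0%R]; split; last 1 first.
- move=> x /=; apply: contra_notP => /eqP x0 _.
  have {}x0 : (0 < enorm x)%R by rewrite lt_neqAle eq_sym x0 enorm_ge0.
  rewrite x0 -!EFinM; congr EFin.
  rewrite maxr_pMr ?exprn_ge0 ?enorm_ge0// mulr0.
  rewrite maxr_pMl ?expR_ge0// mul0r; congr Num.max.
  rewrite [in RHS]mulrCA -mulrA; congr (e * (_ * _))%R.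
  rewrite -tmono_dilation; congr tmono.
  apply/esym; apply: eq_from_tnth => i; rewrite tnth_mktuple direction_val// tnth_mktuple.
  by rewrite mulrC divfK// gt_eqF.
- rewrite -[X in measurable X]setTI.
  exact: (@measurable_enorm R d measurableT [set 0%R] (measurable_set1 _)).
- exact: lebesgueRn_origin.
Qed.

Lemma integrable_tmono (a : 'I_d -> nat) :
  S.-integrable setT (fun t => (tmono a (sphere_val t))%:E).
Proof.
have mg : measurable_fun setT (fun t : sphere R n => tmono a (sphere_val t)).
  exact: measurableT_comp (measurable_tmono a) measurable_sphere_val.
apply/integrableP; split; first by apply/measurable_EFinP.
apply: (@le_lt_trans _ _ (\int[S]_t (cst 1 t))); last first.
  by rewrite integral_cst// mul1e surface_measure_lty.
apply: ge0_le_integral => //.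
- by apply/measurable_EFinP; exact: measurableT_comp.
- by move=> x _; rewrite lee_fin tmono_le1.
Qed.

(** The Gaussian integral of the monomial computed twice: as a product of moments on the line, and
    in polar coordinates, where the radial factor depends on the total degree only. *)
Lemma integral_tmono (a : 'I_d -> nat) :
  (\int[S]_t (tmono a (sphere_val t)) =
  2 * \prod_i gmom (a i) / Gamma_pos ((\sum_i a i + d)%:R / 2))%R.
Proof.
have [_] := integral_gauss_mono a.
rewrite [X in X = _ -> _]integralE.
under eq_integral => x _ do rewrite funeposE -EFin_max -[(tmono a x * _)%R]mul1r.
under [X in _ - X]eq_integral => x _ do rewrite funenegE -EFinN -mulN1r -EFin_max.
rewrite !integral_polar_monoW ?normr1 ?normrN1//.
have g0 : (0 < Gamma_pos ((\sum_i a i + d)%:R / 2) :> R)%R.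
  by apply: Gamma_pos_gt0; rewrite divr_gt0// ltr0n addnS.
have := integrable_tmono a => im.
have E : \int[S]_t (tmono a (sphere_val t))%:E =
    \int[S]_t (Num.max (1 * tmono a (sphere_val t)) 0)%:E
  - \int[S]_t (Num.max (-1 * tmono a (sphere_val t)) 0)%:E.
  rewrite integralE; congr (_ - _); apply: eq_integral => t _.
    by rewrite funeposE -EFin_max mul1r.
  by rewrite funenegE -EFinN -EFin_max mulN1r.
have fp : \int[S]_t (Num.max (1 * tmono a (sphere_val t)) 0)%:E \is a fin_num.
  rewrite (_ : (fun t => _) = (fun t => (tmono a (sphere_val t))%:E)^\+).
    exact: integrable_pos_fin_num.
  by apply/funext => t; rewrite funeposE -EFin_max mul1r.
have fn : \int[S]_t (Num.max (-1 * tmono a (sphere_val t)) 0)%:E \is a fin_num.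
  rewrite (_ : (fun t => _) = (fun t => (tmono a (sphere_val t))%:E)^\-).
    exact: integrable_neg_fin_num.
  by apply/funext => t; rewrite funenegE -EFinN -EFin_max mulN1r.
rewrite /Rintegral E; move: fp fn.
move: (\int[S]_t _) (\int[S]_t _) => [p| |] [q| |]//= _ _ [].
by move: g0; move: (Gamma_pos _) (\prod_i _)%R => g P g0 <-; field; rewrite gt_eqF.
Qed.

End sphere_moments.

HB.instance Definition _ (R : realType) (n : nat) :=
  @Measure_isFinite.Build _ _ _ (@surface_measure R n) (lty_fin_num_fun (@surface_measure_lty R n)).

(** * Moments of powers of x.y times a harmonic polynomial *)

Section gauss_coef.
Variable F : numFieldType.

(* The Funk-Hecke coefficient of (x.y)^j on harmonics of degree k: nonzero only
   for j = k + 2 i, where it is j! / (2^j i!). *)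
Definition gcoef (j k : nat) : F :=
  if (k <= j)%N && ~~ odd (j - k) then j`!%:R / (2 ^+ j * ((j - k)./2)`!%:R) else 0.

Lemma gcoef_even k i : gcoef (k + i.*2) k = (k + i.*2)`!%:R / (2 ^+ (k + i.*2) * i`!%:R).
Proof. by rewrite /gcoef leq_addr addKn odd_double doubleK. Qed.

Lemma gcoef_eq0 j k : (forall i, j != (k + i.*2)%N) -> gcoef j k = 0.
Proof.
rewrite /gcoef => h; case: ifPn => // /andP[kj e].
have := h (j - k)./2; rewrite -[X in (k + X)%N]add0n.
by rewrite -[0%N]/(nat_of_bool false) -(negbTE e) odd_double_half subnKC// eqxx.
Qed.

Lemma gcoef0 k : gcoef 0 k = (k == 0)%:R.
Proof.
case: k => [|k]; first by rewrite (gcoef_even 0 0) expr0 mul1r divff.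
by rewrite gcoef_eq0.
Qed.

(** The recursion that integration by parts produces in [mom_dotp_harmonic]: spending one factor x.y
    either lowers the remaining exponent or differentiates the harmonic. The truncated predecessors
    at 0 come with the factor [j] or [k], which is 0 there. *)
Lemma gcoefS j k : gcoef j.+1 k = 2^-1 * (j%:R * gcoef j.-1 k + k%:R * gcoef j k.-1).
Proof.
have f0 i : (i`!%:R : F) != 0 by rewrite pnatr_eq0 -lt0n fact_gt0.
have [[i ji]|h] := pselect (exists i, j.+1 = (k + i.*2)%N); last first.
  have h' i : j.+1 != (k + i.*2)%N by apply/eqP => ji; apply: h; exists i.
  rewrite gcoef_eq0//.
  have -> : j%:R * gcoef j.-1 k = 0.
    case: j {h} h' => [|j] h'; first by rewrite mul0r.
    rewrite gcoef_eq0 ?mulr0// => i /=; apply: contra (h' i.+1) => /eqP ->.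
    by rewrite doubleS !addnS.
  have -> : k%:R * gcoef j k.-1 = 0.
    case: k {h} h' => [|k] h'; first by rewrite mul0r.
    by rewrite gcoef_eq0 ?mulr0// => i; apply: contra (h' i) => /eqP ->.
  by rewrite addr0 mulr0.
have R2 : (2 : F) != 0 by rewrite pnatr_eq0.
case: i ji => [|i] ji.
  rewrite addn0 in ji; subst k => /=.
  have -> : j%:R * gcoef j.-1 j.+1 = 0.
    case: j => [|j]; first by rewrite mul0r.
    by rewrite gcoef_eq0 ?mulr0// => i; rewrite neq_ltn/= !addSn ltnS leqW// leq_addr.
  have := gcoef_even j.+1 0; rewrite addn0 => ->.
  have := gcoef_even j 0; rewrite addn0 => ->.
  rewrite fact0 !mulr1 add0r exprS factS natrM.
  by field; rewrite expf_neq0.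
have -> : j = (k + i.*2).+1 by move: ji; rewrite doubleS !addnS => -[].
rewrite -!addnS -doubleS gcoef_even /= addnS/= gcoef_even.
have -> : k%:R * gcoef (k + i.*2).+1 k.-1 =
    k%:R * ((k + i.*2).+1`!%:R / (2 ^+ (k + i.*2).+1 * i.+1`!%:R)).
  case: k {ji} => [|k]; first by rewrite !mul0r.
  by rewrite -[(k.+1 + i.*2).+1]addSn addSnnS addSnnS -doubleS gcoef_even.
rewrite doubleS !addnS !exprS !factS !natrM.
rewrite -[(k + i.*2).+2%:R]natr1 -[(k + i.*2).+1%:R]natr1 -[i.+1%:R]natr1 natrD.
have -> : i.*2%:R = i%:R * 2 :> F by rewrite -muln2 natrM.
have p0 : (2 ^+ (k + i.*2) : F) != 0 by rewrite expf_neq0.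
have i0 : i%:R + 1 != 0 :> F by rewrite natr1 pnatr_eq0.
move: (f0 i) p0 i0.
move: (2 ^+ (k + i.*2) : F) ((k + i.*2)`!%:R : F) (i`!%:R : F) (i%:R : F) (k%:R : F).
move=> p q f u v f0i p0 i0; move: (u + 1) (addrK 1 u) i0 => u1 <- i0.
by field; rewrite p0 f0i i0.
Qed.

End gauss_coef.

(* [MSS] is integration by parts for the moments [M j] of exp(- x^2) on the line;
   [mom] is then the integral of a polynomial against exp(- |x|^2). *)
Section moment_functional.
Variables (F : numFieldType) (d : nat) (M : nat -> F).
Hypotheses (M1 : M 1 = 0) (MSS : forall j, M j.+2 = j.+1%:R / 2 * M j).
Local Notation poly := (mpoly d F).
Local Notation X i := (mpolyX F (mnm1 i)).

Definition mweight (m : multinom d) : F := \prod_i M (m i).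

Definition mom (p : poly) : F := \sum_(m <- msupp p) mcoeff m p * mweight m.

(** The sum over all monomials of bounded degree, a range common to [p], [q] and [c *: p + q],
    whereas their supports differ; linearity is proved on it. *)
Let momw K (p : poly) : F := \sum_(m : bmultinom d K) mcoeff (bmnm m) p * mweight (bmnm m).

Let mom_wE K p : (mmeasure mdeg p <= K)%N -> mom p = momw K p.
Proof.
move=> pK; rewrite /mom /momw (ssrcomplements.big_mksub (bmultinom d K))//=; last 2 first.
- by rewrite msupp_uniq.
- by move=> m /msize_mdeg_lt /leq_trans; apply.
by rewrite big_rmcond //= => m /memN_msupp_eq0 ->; rewrite mul0r.
Qed.

Lemma mom_linear : GRing.linear_for *%R mom.
Proof.
move=> c p q; pose K := maxn (mmeasure mdeg p) (maxn (mmeasure mdeg q) (mmeasure mdeg (c *: p + q))).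
rewrite !(@mom_wE K) ?leq_max ?leqnn ?orbT// /momw mulr_sumr -big_split; apply: eq_bigr => m _ /=.
by rewrite mcoeffD mcoeffZ mulrDl mulrA.
Qed.

HB.instance Definition _ := GRing.isLinear.Build F poly F *%R mom mom_linear.

Lemma momX m : mom (mpolyX F m) = mweight m.
Proof. by rewrite /mom msuppX big_seq1 mcoeffX eqxx mul1r. Qed.

(** On a monomial, both sides are products of moments on the line that differ only in the factor of
    index [i], where [MSS] applies, or [M1] if the exponent is 0. *)
Lemma mom_mulX i q : mom (X i * q) = 2^-1 * mom (mderiv i q).
Proof.
elim/mpolyind: q => [|c m p _ _ IH]; first by rewrite mulr0 mderiv0 linear0 mulr0.
rewrite mulrDr mderivD !linearD/= mulrDr IH; congr (_ + _).
rewrite -scalerAr mderivZ !linearZ/= mulrCA; congr (_ * _).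
rewrite -mpolyXD mderivX linearZ/= !momX /mweight (bigD1 i)//= [in RHS](bigD1 i)//=.
rewrite mnmDE mnm1E eqxx mnmBE mnm1E eqxx add1n subn1.
have -> : \prod_(j | j != i) M (mnm_add (mnm1 i) m j) = \prod_(j | j != i) M (mnm_sub m (mnm1 i) j).
  by apply: eq_bigr => j ji; rewrite mnmDE mnmBE mnm1E eq_sym (negbTE ji) subn0.
case: (m i) => [|k] /=; first by rewrite M1 !mul0r mulr0.
by rewrite MSS -!mulrA mulrCA.
Qed.

Lemma mpoly_euler k p : p \is ishomog1 k (@mdeg d) -> \sum_i X i * mderiv i p = k%:R *: p.
Proof.
move=> /dhomogP hp; rewrite [in RHS](mpolyE p) scaler_sumr.
transitivity (\sum_i \sum_(m <- msupp p) (mcoeff m p * (m i)%:R) *: mpolyX F m).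
  apply: eq_bigr => i _; rewrite [in LHS](mpolyE p) raddf_sum mulr_sumr; apply: eq_bigr => m _.
  rewrite /= mderivZ mderivX scalerA -scalerAr -mpolyXD.
  have [->|m0] := posnP (m i); first by rewrite mulr0 !scale0r.
  congr (_ *: mpolyX F _); apply/mnmP => j; rewrite mnmDE mnmBE mnm1E.
  by case: eqP => [<-|_]; rewrite ?add0n ?subn0// subnKC.
rewrite exchange_big/= big_seq [RHS]big_seq; apply: eq_bigr => m mp.
rewrite -scaler_suml -mulr_sumr -natr_sum -mdegE hp// scalerA.
by rewrite mulrC.
Qed.

Lemma homog_mderiv k (p : poly) i : p \is ishomog1 k (@mdeg d) -> (mderiv i p : poly) \is ishomog1 k.-1 (@mdeg d).
Proof.
move=> /dhomogP hp; apply/dhomogP => m; rewrite mcoeff_msupp mcoeff_mderiv => h.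
have : mnm_add m (mnm1 i) \in msupp p.
  by rewrite mcoeff_msupp; apply: contra h => /eqP ->; rewrite mul0rn.
by move=> /hp /=; rewrite mdegD mdeg1 addn1 => <-.
Qed.

Definition laplacian p : poly := \sum_i mderiv i (mderiv i p).

Variable w : 'I_d -> F.
Hypothesis w1 : \sum_i w i ^+ 2 = 1.

Definition dotp : poly := \sum_i w i *: X i.

Let D p : poly := \sum_i w i *: mderiv i p.

Let homog_D k p : p \is ishomog1 k (@mdeg d) -> D p \is ishomog1 k.-1 (@mdeg d).
Proof. by move=> hp; apply: rpred_sum => i _; apply: rpredZ; exact: homog_mderiv. Qed.

Let mderiv_sum i (G : 'I_d -> poly) : mderiv i (\sum_j G j) = \sum_j mderiv i (G j).
Proof. by rewrite (big_morph _ (mderivD i) (mderiv0 _ i)). Qed.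

Let laplacian_D p : laplacian p = 0 -> laplacian (D p) = 0.
Proof.
move=> h; rewrite /laplacian /D.
transitivity (\sum_i w i *: mderiv i (laplacian p)); last first.
  by rewrite big1// => i _; rewrite h mderiv0 scaler0.
under eq_bigr => i _ do rewrite !mderiv_sum.
rewrite exchange_big/=; apply: eq_bigr => j _.
rewrite /laplacian mderiv_sum [RHS]scaler_sumr; apply: eq_bigr => i _.
by rewrite !mderivZ (mderiv_comm i j (mderiv i p)) (mderiv_comm i j).
Qed.

Let meval_D k p : p \is ishomog1 k (@mdeg d) -> meval w (D p) = k%:R * meval w p.
Proof.
move=> /mpoly_euler /(congr1 (meval w)); rewrite mevalZ raddf_sum => <-.
rewrite raddf_sum; apply: eq_bigr => i _.
by rewrite /= mevalZ mevalM mevalXU.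
Qed.

Lemma mderiv_dotp i : mderiv i dotp = mpolyC d (w i).
Proof.
rewrite /dotp raddf_sum (bigD1 i)//= big1 ?addr0 => [|j ji].
  rewrite mderivZ mderivX mnm1E eqxx scale1r.
  have -> : mnm_sub (mnm1 i) (mnm1 i) = mnm0 by apply/mnmP => j; rewrite mnmBE subnn mnm0E.
  by rewrite mpolyX0 -mul_mpolyC mulr1.
by rewrite mderivZ mderivX mnm1E (negbTE ji) scale0r scaler0.
Qed.

Lemma mderiv_dotpX i j : mderiv i (dotp ^+ j) = (j%:R * w i) *: dotp ^+ j.-1.
Proof.
elim: j => [|j IH]; first by rewrite expr0 mul0r scale0r mderivC.
rewrite exprS mderivM IH mderiv_dotp mul_mpolyC -scalerAr.
case: j {IH} => [|j]; first by rewrite mul0r scale0r addr0 mul1r.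
by rewrite /= -exprS -scalerDl; congr (_ *: _); rewrite -[in RHS]natr1 mulrDl mul1r addrC.
Qed.

(** If [j = 0] and the degree is positive, Euler's identity writes a multiple of [p] as the sum of
    the [X i * mderiv i p], whose moment is half that of the Laplacian: the mean is 0. If [j > 0],
    one factor [dotp] is spent: differentiating the other factors gives [|w|^2 = 1], and
    differentiating [p] gives its derivative along [w], which is harmonic of degree [k - 1] and
    equals [k * p] at [w]. *)
Lemma mom_dotp_harmonic j k p : p \is ishomog1 k (@mdeg d) -> laplacian p = 0 ->
  mom (dotp ^+ j * p) = M 0 ^+ d * gcoef F j k * meval w p.
Proof.
elim/ltn_ind: j k p => -[|j] IH k p hp lp.
  rewrite expr0 mul1r gcoef0; case: k hp => [|k] hp.
    have [c ->] : exists c, p = mpolyC d c.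
      exists (mcoeff mnm0 p); apply/mpolyP => m; rewrite mcoeffC.
      have [->|m0] := eqVneq m mnm0; first by rewrite mulr1.
      rewrite mulr0; apply/eqP; rewrite mcoeff_eq0; apply: contra m0 => mp.
      by rewrite -mdeg_eq0 (dhomog_mf hp mp).
    rewrite mevalC -[mpolyC d c]mulr1 mul_mpolyC linearZ/= -mpolyX0 momX mulr1 mulrC; congr (_ * _).
    by rewrite /mweight (eq_bigr (fun=> M 0)) ?prodr_const ?card_ord// => i _; rewrite mnm0E.
  rewrite mulr0 mul0r; apply/eqP.
  rewrite -(mulrI_eq0 _ (@mulfI F k.+1%:R _)) ?pnatr_eq0// -linearZ/=.
  rewrite -(mpoly_euler hp) raddf_sum.
  rewrite (eq_bigr (fun i => 2^-1 * mom (mderiv i (mderiv i p)))) => [|i _]; last by rewrite /= mom_mulX.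
  by rewrite -mulr_sumr -raddf_sum/= -/(laplacian p) lp linear0 mulr0.
have -> : mom (dotp ^+ j.+1 * p) =
    2^-1 * (j%:R * mom (dotp ^+ j.-1 * p) + mom (dotp ^+ j * D p)).
  rewrite exprS -mulrA {1}/dotp mulr_suml raddf_sum /=.
  transitivity (\sum_i 2^-1 * (j%:R * (w i ^+ 2 * mom (dotp ^+ j.-1 * p)) +
      mom (dotp ^+ j * (w i *: mderiv i p)))).
    apply: eq_bigr => i _; rewrite -scalerAl linearZ/= mom_mulX mulrCA; congr (_ * _).
    rewrite mderivM mderiv_dotpX linearD/= mulrDr -scalerAl -scalerAr !linearZ/=; congr (_ + _).
    change (w i * (j%:R * w i * mom (dotp ^+ j.-1 * p)) = j%:R * (w i ^+ 2 * mom (dotp ^+ j.-1 * p))).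
      by ring.
    by rewrite -scalerAr linearZ.
  rewrite -mulr_sumr big_split/= -mulr_sumr -mulr_suml w1 mul1r; congr (_ * (_ + _)).
  by rewrite -raddf_sum -mulr_sumr.
rewrite (IH j _ k.-1 (D p)) ?homog_D ?laplacian_D// (meval_D hp).
have -> : j%:R * mom (dotp ^+ j.-1 * p) = j%:R * (M 0 ^+ d * gcoef F j.-1 k * meval w p).
  case: j {IH} (IH) => [|j] IH; first by rewrite !mul0r.
  by rewrite (IH j _ k)//= leqW.
by rewrite gcoefS; ring.
Qed.

End moment_functional.

(** * Complex integrals and polynomials on the sphere *)

Section complex_integral.
Context d (T : measurableType d) (R : realType) (mu : {measure set T -> \bar R}).
Implicit Types f g : T -> R[i].

Lemma cintegrableD f g : cintegrable mu f -> cintegrable mu g ->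
  cintegrable mu (fun x => f x + g x).
Proof.
move=> [rf imf] [rg img]; split.
- rewrite (_ : (fun x => _) = (fun x => ((complex.Re (f x))%:E + (complex.Re (g x))%:E)%E)).
    exact: integrableD.
  by apply/funext => x; case: (f x) (g x) => [? ?] [? ?].
- rewrite (_ : (fun x => _) = (fun x => ((complex.Im (f x))%:E + (complex.Im (g x))%:E)%E)).
    exact: integrableD.
  by apply/funext => x; case: (f x) (g x) => [? ?] [? ?].
Qed.

Lemma cintegralD f g : cintegrable mu f -> cintegrable mu g ->
  cintegral mu (fun x => f x + g x) = cintegral mu f + cintegral mu g.
Proof.
move=> [rf imf] [rg img]; rewrite /cintegral; apply/eqP; rewrite eq_complex/=.
rewrite -!RintegralD//; apply/andP; split; apply/eqP; congr Rintegral; apply/funext => x.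
- by case: (f x) (g x) => [? ?] [? ?].
- by case: (f x) (g x) => [? ?] [? ?].
Qed.

Lemma cintegrable_scale (c : R[i]) (h : T -> R) : mu.-integrable setT (EFin \o h) ->
  cintegrable mu (fun x => c * (h x)%:C) /\
  cintegral mu (fun x => c * (h x)%:C) = c * (\int[mu]_x h x)%:C.
Proof.
case: c => a b ih.
have rE : (fun x => complex.Re ((a +i* b) * (h x)%:C)) = (fun x => a * h x).
  by apply/funext => x; rewrite /= mulr0 subr0.
have iE : (fun x => complex.Im ((a +i* b) * (h x)%:C)) = (fun x => b * h x).
  by apply/funext => x; rewrite /= mulr0 add0r.
split; first split.
- rewrite (_ : (fun x => _) = (fun x => (a%:E * (h x)%:E)%E)); first exact: integrableZl.
  by apply/funext => x; rewrite (congr1 (@^~ x) rE).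
- rewrite (_ : (fun x => _) = (fun x => (b%:E * (h x)%:E)%E)); first exact: integrableZl.
  by apply/funext => x; rewrite (congr1 (@^~ x) iE).
rewrite /cintegral rE iE !RintegralZl//; apply/eqP; rewrite eq_complex/=.
by rewrite !mulr0 subr0 add0r !eqxx.
Qed.

Lemma cintegral_sum (I : Type) (s : seq I) (c : I -> R[i]) (h : I -> T -> R) :
  (forall i, mu.-integrable setT (EFin \o h i)) ->
  cintegrable mu (fun x => \sum_(i <- s) c i * (h i x)%:C) /\
  cintegral mu (fun x => \sum_(i <- s) c i * (h i x)%:C) =
    \sum_(i <- s) c i * (\int[mu]_x h i x)%:C.
Proof.
move=> ih; elim: s => [|i s [IH1 IH2]].
  under eq_fun do rewrite big_nil; rewrite big_nil.
  split; first by split; exact: integrable0.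
  by rewrite /cintegral /Rintegral /= integral0.
under eq_fun do rewrite big_cons; rewrite big_cons.
have [iS iE] := cintegrable_scale (c i) (ih i).
by split; [exact: cintegrableD|rewrite cintegralD// iE IH2].
Qed.

End complex_integral.

Section sphere_polynomials.
Context {R : realType} (n : nat).
Local Notation d := n.+1.
Local Notation S := (@surface_measure R n).
Local Notation poly := (mpoly d R[i]).

Definition sdot (x y : sphere R n) : R := \sum_i tnth x i * tnth y i.

Let gm (j : nat) : R[i] := (gmom j : R)%:C.

Lemma sphere_restr_tmono (p : poly) : sphere_restr p =
  (fun t => \sum_(m <- msupp p) mcoeff m p * (tmono (fun i => m i) (sphere_val t))%:C).
Proof.
apply/funext => t; rewrite /sphere_restr mevalE; apply: eq_bigr => m _; congr (_ * _).
by rewrite /tmono rmorph_prod; apply: eq_bigr => i _; rewrite rmorphXn.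
Qed.

Lemma cintegrable_sphere_restr (p : poly) : cintegrable S (sphere_restr p).
Proof.
rewrite sphere_restr_tmono; have [+ _] := cintegral_sum (msupp p) (fun m => mcoeff m p)
  (fun m : multinom d => integrable_tmono (fun i => m i)).
by [].
Qed.

Lemma cintegral_sphere_restr j (p : poly) : p \is ishomog1 j (@mdeg d) ->
  cintegral S (sphere_restr p) = (2 / Gamma_pos ((j + d)%:R / 2))%:C * mom gm p.
Proof.
move=> hp; rewrite sphere_restr_tmono.
have [_ ->] := cintegral_sum (msupp p) (fun m => mcoeff m p)
  (fun m : multinom d => integrable_tmono (fun i => m i)).
rewrite /mom mulr_sumr big_seq [RHS]big_seq; apply: eq_bigr => m mp.
rewrite integral_tmono -mdegE (dhomog_mf hp mp) mulrCA; congr (_ * _).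
by rewrite /mweight -rmorph_prod -rmorphM/= mulrAC.
Qed.

Lemma sum_sqr_sphere (x : sphere R n) : \sum_i tnth x i ^+ 2 = 1.
Proof. by rewrite -sqr_enorm enorm_sphere expr1n. Qed.

Lemma gcoef_complex j k : gcoef R[i] j k = (gcoef R j k)%:C.
Proof.
rewrite /gcoef; case: ifPn => _; last by rewrite rmorph0.
by rewrite rmorphM fmorphV rmorphM rmorphXn !rmorph_nat.
Qed.

Lemma homog_dotpX (w : 'I_d -> R[i]) j : dotp w ^+ j \is ishomog1 j (@mdeg d).
Proof.
have := @dhomogMn d R[i] mdeg 1 (dotp w) j; rewrite mul1n; apply.
apply: rpred_sum => i _; apply: rpredZ; rewrite dhomogX; apply/eqP; exact: mdeg1.
Qed.

(** The Funk-Hecke formula for powers. The integrand is the restriction of a homogeneous polynomial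
    of degree [j + k], so a single Gamma factor relates its surface integral to the Gaussian
    functional [mom]. *)
Lemma cintegral_dot_harmonic (w : sphere R n) j k (P : poly) : solid_harmonic k P ->
  cintegrable S (fun t => ((sdot w t) ^+ j)%:C * sphere_restr P t) /\
  cintegral S (fun t => ((sdot w t) ^+ j)%:C * sphere_restr P t) =
  (2 * Num.sqrt pi ^+ d * gcoef R j k / Gamma_pos ((j + k + d)%:R / 2))%:C * sphere_restr P w.
Proof.
move=> [hP lP]; pose w' i : R[i] := (tnth w i)%:C.
have w1 : \sum_i w' i ^+ 2 = 1.
  by rewrite -[RHS](rmorph1 (real_complex R)) -(sum_sqr_sphere w) rmorph_sum; apply: eq_bigr => i _; rewrite rmorphXn.
rewrite (_ : (fun t => _) = sphere_restr (dotp w' ^+ j * P)); last first.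
  apply/funext => t; rewrite /sphere_restr mevalM rmorphXn rmorphXn; congr (_ ^+ _ * _).
  rewrite /sdot /dotp raddf_sum rmorph_sum; apply: eq_bigr => i _.
  by rewrite /= mevalZ mevalXU rmorphM.
split; first exact: cintegrable_sphere_restr.
rewrite (cintegral_sphere_restr (dhomogM (homog_dotpX w' j) hP)).
rewrite (mom_dotp_harmonic _ _ w1 _ hP)//; last 2 first.
- by rewrite /gm gmom_odd// rmorph0.
- by move=> i; rewrite /gm gmomSS !rmorphM fmorphV !rmorph_nat.
rewrite mulrA; congr (_ * _); rewrite gcoef_complex /gm.
have -> : gmom 0 = Num.sqrt pi :> R by rewrite (gmom_even 0) add0r Gamma_pos_half.
by rewrite -rmorphXn -!rmorphM; congr (_%:C); ring.
Qed.

End sphere_polynomials.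

(** * The binomial series *)

Section binomial_series.
Context {R : realType}.
Implicit Types b x : R.

Definition rising b (j : nat) : R := \prod_(0 <= i < j) (b + i%:R).

Definition bcoef b (j : nat) : R := rising b j / j`!%:R.

Lemma rising0 b : rising b 0 = 1. Proof. by rewrite /rising big_geq. Qed.

Lemma risingS b j : rising b j.+1 = rising b j * (b + j%:R).
Proof. by rewrite /rising big_nat_recr. Qed.

Lemma risingSl b j : rising b j.+1 = b * rising (b + 1) j.
Proof.
rewrite /rising big_nat_recl//= addr0; congr (_ * _); apply: eq_bigr => i _.
by rewrite -natr1; ring.
Qed.

Lemma risingD b j k : rising b (j + k) = rising b j * rising (b + j%:R) k.
Proof.
elim: k => [|k IH]; first by rewrite addn0 rising0 mulr1.
by rewrite addnS !risingS IH natrD addrA mulrA.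
Qed.

Lemma rising_gt0 b j : 0 < b -> 0 < rising b j.
Proof. by move=> b0; apply: prodr_gt0 => i _; rewrite ltr_wpDr. Qed.

Let fact_neq0 j : (j`!%:R : R) != 0. Proof. by rewrite pnatr_eq0 -lt0n fact_gt0. Qed.

Lemma bcoef_gt0 b j : 0 < b -> 0 < bcoef b j.
Proof. by move=> b0; rewrite divr_gt0 ?rising_gt0// ltr0n fact_gt0. Qed.

Lemma bcoef0 b : bcoef b 0 = 1. Proof. by rewrite /bcoef rising0 fact0 divr1. Qed.

Lemma bcoefS b j : bcoef b j.+1 = bcoef b j * ((b + j%:R) / j.+1%:R).
Proof. by rewrite /bcoef risingS factS natrM; field; rewrite fact_neq0 nat1r pnatr_eq0. Qed.

Lemma bcoef_diffs b : pseries_diffs (bcoef b) = (fun j => b * bcoef (b + 1) j).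
Proof.
apply/funext => j; rewrite /pseries_diffs /bcoef risingSl factS natrM.
by field; rewrite fact_neq0 nat1r pnatr_eq0.
Qed.

Lemma bcoef_succ b j : bcoef (b + 1) j.+1 - bcoef (b + 1) j = bcoef b j.+1.
Proof.
rewrite /bcoef risingS [in RHS]risingSl factS natrM -natr1.
by field; rewrite fact_neq0 natr1 pnatr_eq0.
Qed.

(** The ratio test made explicit: [q] lies strictly between |x| and 1, beyond [N] each term is at
    most [q] times the previous one, and [C] absorbs the terms up to [N]. *)
Lemma is_cvg_bcoef b x : 0 < b -> `|x| < 1 -> cvgn (pseries (bcoef b) x).
Proof.
move=> b0 x1; apply: normed_cvg.
pose q := (1 + `|x|) / 2.
have xq : `|x| < q by rewrite /q; lra.
have q1 : q < 1 by rewrite /q; lra.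
have q0 : 0 <= q by rewrite (le_trans _ (ltW xq)).
pose N := (Num.truncn (b / (q - `|x|))).+1.
have hN j : (N <= j)%N -> `|x| * ((b + j%:R) / j.+1%:R) <= q.
  move=> Nj; rewrite mulrA ler_pdivrMr//.
  have : b / (q - `|x|) < j%:R by apply: lt_le_trans (truncnS_gt _) _; rewrite ler_nat.
  rewrite ltr_pdivrMr ?subr_gt0// => bj.
  rewrite -[in leRHS]natr1; nra.
have q_gt0 : 0 < q by rewrite (le_lt_trans _ xq).
pose C := \sum_(k < N.+1) `|bcoef b k * x ^+ k| / q ^+ k.
have hC j : `|bcoef b j * x ^+ j| <= C * q ^+ j.
  have small k : (k <= N)%N -> `|bcoef b k * x ^+ k| <= C * q ^+ k.
    move=> kN; rewrite -ler_pdivrMr ?exprn_gt0// /C (bigD1 (Ordinal (kN : (k < N.+1)%N)))//= lerDl.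
    by apply: sumr_ge0 => i _; rewrite divr_ge0// exprn_ge0.
  elim: j => [|j IH]; first exact: small.
  have [jN|Nj] := leqP j.+1 N; first exact: small.
  rewrite bcoefS (exprSr x) mulrACA normrM (exprSr q) mulrA.
  apply: ler_pM => //; rewrite normrM mulrC [X in _ * X]ger0_norm ?hN//.
  by rewrite divr_ge0// addr_ge0// ltW.
apply: (@series_le_cvg _ _ (geometric C q)) => //=.
- by move=> k; rewrite /geometric/= (le_trans _ (hC k)).
- by apply: is_cvg_geometric_series; rewrite ger0_norm.
Qed.

Definition bser b x : R := limn (pseries (bcoef b) x).

Lemma is_derive_bser b x : 0 < b -> `|x| < 1 ->
  is_derive x 1 (bser b) (b * bser (b + 1) x).
Proof.
move=> b0 x1; pose K := (1 + `|x|) / 2.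
have K0 : 0 <= K by rewrite /K divr_ge0// addr_ge0.
have xK : `|x| < `|K| by rewrite (ger0_norm K0) /K; lra.
have K1 : `|K| < 1 by rewrite (ger0_norm K0) /K; lra.
have cvgZ c u y : 0 < u -> `|y| < 1 ->
    pseries (fun j => c * bcoef u j) y n @[n --> \oo] --> c * bser u y.
  move=> u0 y1; rewrite (_ : pseries _ y = (fun n => c * pseries (bcoef u) y n)); last first.
    apply/funext => m; rewrite /pseries /series/= mulr_sumr.
    by apply: eq_bigr => i _; rewrite mulrA.
  by apply: cvgMl_tmp; exact: is_cvg_bcoef.
have b1 : 0 < b + 1 by rewrite addr_gt0.
have b2 : 0 < b + 1 + 1 by rewrite addr_gt0.
(* Termwise differentiation asks for the convergence of the first two formal derivatives; both are
   multiples of binomial series, with parameters [b + 1] and [b + 2]. *)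
have D2 : pseries_diffs (pseries_diffs (bcoef b)) = (fun j => (b * (b + 1)) * bcoef (b + 1 + 1) j).
  rewrite bcoef_diffs; apply/funext => j; rewrite /pseries_diffs mulrCA.
  by rewrite -[_.+1%:R * _]/(pseries_diffs (bcoef (b + 1)) j) bcoef_diffs mulrA.
have -> : b * bser (b + 1) x = limn (pseries (pseries_diffs (bcoef b)) x).
  by rewrite bcoef_diffs; apply/esym/cvg_lim => //; exact: cvgZ.
apply: (@pseries_snd_diffs _ _ K) => //.
- exact: is_cvg_bcoef.
- by rewrite bcoef_diffs; apply/cvg_ex; eexists; exact: cvgZ.
- by rewrite D2; apply/cvg_ex; eexists; exact: cvgZ.
Qed.

(** The Pascal relation [bcoef_succ] telescopes: the partial sums of the two sides differ by
    [bcoef (b + 1) n * x ^+ n.+1], which tends to 0. *)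
Lemma bser_succ b x : 0 < b -> `|x| < 1 -> (1 - x) * bser (b + 1) x = bser b x.
Proof.
move=> b0 x1.
have b1 : 0 < b + 1 by rewrite addr_gt0.
have c1 := is_cvg_bcoef b1 x1.
have t0 : bcoef (b + 1) n * x ^+ n.+1 @[n --> \oo] --> (0 : R).
  rewrite (_ : (fun n => _) = (fun n => (bcoef (b + 1) n * x ^+ n) * x)); last first.
    by apply/funext => m; rewrite exprSr mulrA.
  by rewrite -[X in _ --> X](mul0r x); apply: cvgMr_tmp; exact: cvg_series_cvg_0 c1.
suff : pseries (bcoef b) x n.+1 @[n --> \oo] --> (1 - x) * bser (b + 1) x.
  by move=> h; apply/esym/cvg_lim => //; rewrite -cvg_shiftS; exact: h.
have -> : (fun n => pseries (bcoef b) x n.+1) =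
    (fun n => (1 - x) * pseries (bcoef (b + 1)) x n.+1 + bcoef (b + 1) n * x ^+ n.+1).
  apply/funext; elim=> [|m IH].
    by rewrite /pseries /series/= !big_nat1 !bcoef0 !expr0; ring.
  have E u : pseries (bcoef u) x m.+2 = pseries (bcoef u) x m.+1 + bcoef u m.+1 * x ^+ m.+1.
    by rewrite /pseries /series/= big_nat_recr.
  rewrite !E IH -bcoef_succ (exprS x m.+1).
  by move: (pseries _ _ _) (bcoef _ _) (bcoef _ m.+1) (x ^+ m.+1) => A B C D; ring.
rewrite -[X in _ --> X]addr0; apply: cvgD => //.
by apply: cvgMl_tmp; rewrite (cvg_shiftS (pseries (bcoef (b + 1)) x)).
Qed.

(** The product of [bser b y] and (1 - y)^b has derivative 0 on []-1, 1[] and value 1 at 0;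
    [bser_succ] makes the two terms of the derivative cancel. *)
Lemma bserE b x : 0 < b -> `|x| < 1 -> bser b x = (1 - x) `^ (- b).
Proof.
move=> b0 x1; pose g (y : R) := bser b y * (1 - y) `^ b.
have dg (y : R) : `|y| < 1 -> is_derive y 1 g 0.
  move=> y1; have y0 : 0 < 1 - y by rewrite subr_gt0 (le_lt_trans (ler_norm _)).
  have d1 := is_derive_bser b0 y1.
  have d2 : is_derive y 1 (fun z : R => (1 - z) `^ b) (- (b * (1 - y) `^ (b - 1))).
    have d3 : is_derive ((cst 1 - id : R -> R) y) 1 ((@powR R)^~ b) (b * (1 - y) `^ (b - 1)) by exact: is_derive1_powR.
    have d4 : is_derive y 1 (cst 1 - id : R -> R) (- 1) by apply: is_derive_eq; rewrite sub0r.
    have := is_derive1_comp d3 d4.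
    by rewrite mulrN1.
  apply: is_derive_eq.
  rewrite -(bser_succ b0 y1) /GRing.scale/=.
  have -> : (1 - y) `^ b = (1 - y) `^ (b - 1) * (1 - y).
    by rewrite -[X in _ * X]powRr1 ?(ltW y0)// -powRD ?subrK// gt_eqF ?implybT.
  by move: (bser _ _) (_ `^ _) => A B; ring.
have cg (u v : R) : -1 < u -> v < 1 -> {within `[u, v], continuous g}.
  move=> u1 v1; apply: derivable_within_continuous => y; rewrite in_itv/= => /andP[uy yv].
  have y1 : `|y| < 1 by rewrite ltr_norml (lt_le_trans u1)// (le_lt_trans yv).
  by have [] := dg _ y1.
have g0 : g 0 = 1.
  rewrite /g subr0 powR1 mulr1; apply: cvg_lim => //; rewrite -cvg_shiftS.
  rewrite (_ : (fun n => _) = cst 1); first exact: cvg_cst.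
  apply/funext => m; rewrite /pseries /series/= big_nat_recl//= big1 ?addr0 => [|i _].
    by rewrite bcoef0 mul1r.
  by rewrite exprS mul0r mulr0.
have : g x = 1.
  move: (x1); rewrite ltr_norml => /andP[x11 x12].
  have [x0|x0] := leP 0 x.
    have [|c _] := @MVT_segment R g (fun=> 0) 0 x x0 _ (cg _ _ (ltrN10 R) x12).
      move=> y; rewrite in_itv/= => /andP[y0 yx]; apply: dg.
      by rewrite ltr_norml (lt_trans _ y0)// (lt_trans yx).
    by rewrite mul0r g0 => /eqP; rewrite subr_eq0 => /eqP.
  have [|c _] := @MVT_segment R g (fun=> 0) x 0 (ltW x0) _ (cg _ _ x11 ltr01).
    move=> y; rewrite in_itv/= => /andP[y0 yx]; apply: dg.
    by rewrite ltr_norml (lt_trans _ y0)// (lt_trans yx).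
  by rewrite mul0r g0 => /eqP; rewrite subr_eq0 => /eqP.
rewrite /g => gx; rewrite powRN -[LHS]mulr1 -[in LHS](@divff _ ((1 - x) `^ b)) ?mulrA ?gx ?mul1r//.
by rewrite gt_eqF// powR_gt0// subr_gt0 (le_lt_trans (ler_norm _)).
Qed.

End binomial_series.

(** * Gamma at negative arguments *)

Section Gamma_continuation.
Context {R : realType}.
Implicit Types x s b : R.

Lemma rising_neq0 x k : (forall i : nat, x + i%:R != 0) -> rising x k != 0.
Proof.
by move=> h; elim: k => [|k IH]; rewrite ?rising0 ?oner_eq0// risingS mulf_neq0.
Qed.

Lemma Gamma_posD x k : 0 < x -> Gamma_pos (x + k%:R) = rising x k * Gamma_pos x.
Proof.
move=> x0; elim: k => [|k IH]; first by rewrite addr0 rising0 mul1r.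
rewrite -natr1 addrA Gamma_posS; last by rewrite ltr_wpDr.
by rewrite IH risingS mulrCA mulrA.
Qed.

Lemma GammaE x : 0 < x -> Gamma x = Gamma_pos x.
Proof. by rewrite /Gamma => ->. Qed.

(** The definition uses the least shift that makes the argument positive; any larger one gives the
    same value, so that two arguments differing by an integer can be brought to the same point. *)
Lemma Gamma_shift x N : (forall i : nat, x + i%:R != 0) -> 0 < x + N%:R ->
  Gamma x = Gamma_pos (x + N%:R) / rising x N.
Proof.
move=> xn xN.
have rn M : rising x M != 0 by exact: rising_neq0.
suff [M [MN M0 ->]] : exists M, [/\ (M <= N)%N, 0 < x + M%:R & Gamma x = Gamma_pos (x + M%:R) / rising x M].
  have -> : rising x N = rising x M * rising (x + M%:R) (N - M) by rewrite -risingD subnKC.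
  have -> : x + N%:R = x + M%:R + (N - M)%:R by rewrite -addrA -natrD subnKC.
  rewrite (Gamma_posD _ M0).
  have r0 := lt0r_neq0 (rising_gt0 (N - M) M0).
  by field; rewrite rn r0.
rewrite /Gamma; case: ifPn => [x0|]; first by exists 0%N; rewrite addr0 rising0 divr1.
rewrite -leNgt => x0; exists (Num.truncn (- x)).+1.
have /andP[h1 h2] : (Num.truncn (- x))%:R <= - x < (Num.truncn (- x)).+1%:R.
  by rewrite truncn_itv// oppr_ge0.
split=> //; last by lra.
by rewrite -(ltr_nat R) (le_lt_trans h1)//; lra.
Qed.

Lemma rising_reflect s k : rising (s - k%:R) k = (-1) ^+ k * rising (1 - s) k.
Proof.
elim: k => [|k IH]; first by rewrite !rising0 mul1r.
rewrite risingSl risingS exprS.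
have -> : s - k.+1%:R + 1 = s - k%:R by rewrite -natr1; ring.
by rewrite IH -natr1; ring.
Qed.

(** Both branches of [Gamma_quot] give the same product, so the convention at the poles disappears
    from the eigenvalues; the sign (-1)^k will cancel the one in [TS_lambda]. *)
Lemma Gamma_quot_rising b k : 0 < b -> Gamma_quot (1 - b) k = (-1) ^+ k * rising b k.
Proof.
move=> b0; have -> : rising b k = rising (1 - (1 - b)) k by rewrite opprB addrC subrK.
rewrite /Gamma_quot; case: ifPn => [_|sn].
  elim: k => [|k IH]; first by rewrite big_geq// rising0 mulr1.
  by rewrite big_nat_recr//= IH risingS exprS -natr1; ring.
set s := 1 - b in sn *.
(* Since [b > 0], [s < 1]: an integer [s] would be nonpositive and belong to the first branch. Hence
   neither [s] nor [s - k] is a pole. *)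
have snint : s \isn't a Num.int.
  apply: contra sn => si; rewrite si/=.
  have : s < 1 by rewrite /s; lra.
  by move: si => /intrP[z ->]; rewrite ltrz1 lerz0 -ltzD1.
have sn0 i : s + i%:R != 0.
  apply: contra snint; rewrite addr_eq0 => /eqP ->.
  by rewrite rpredN; apply: natr_int.
have skn0 i : s - k%:R + i%:R != 0.
  apply: contra snint; rewrite addr_eq0 => /eqP h.
  have -> : s = k%:R - i%:R by rewrite -h; ring.
  by rewrite rpredB// natr_int.
pose N := (Num.truncn (- s)).+1.
have sN : 0 < s + N%:R.
  have [s0|s0] := ltP 0 s; first by rewrite ltr_wpDr.
  have /andP[_ h2] : (Num.truncn (- s))%:R <= - s < (Num.truncn (- s)).+1%:R.
    by rewrite truncn_itv// oppr_ge0.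
  by rewrite /N; lra.
have E : s - k%:R + (k + N)%:R = s + N%:R by rewrite natrD; ring.
rewrite (Gamma_shift sn0 sN) (Gamma_shift (N := k + N) skn0) ?E//.
rewrite risingD subrK rising_reflect.
have g0 := lt0r_neq0 (Gamma_pos_gt0 sN).
have r1 : rising s N != 0 by exact: rising_neq0.
have r2 : rising (1 - s) k != 0.
  by rewrite lt0r_neq0// rising_gt0// /s opprB addrC subrK.
by field; rewrite g0 r1 r2 signr_eq0.
Qed.

End Gamma_continuation.

(** * The eigenvalues: closed form, monotonicity, limit *)

Lemma cvg_powRN {R : realType} (s : R) : 0 < s -> n.+1%:R `^ (- s) @[n --> \oo] --> (0 : R).
Proof.
move=> s0; apply/cvgrPdist_le => e e0; near=> n.
rewrite sub0r normrN ger0_norm ?powR_ge0// powRN.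
rewrite -[leRHS]invrK lef_pV2 ?posrE ?powR_gt0 ?invr_gt0//.
have -> : e^-1 = (e^-1 `^ s^-1) `^ s by rewrite -powRrM mulVf ?gt_eqF// powRr1// invr_ge0 ltW.
apply: ge0_ler_powR; rewrite ?nnegrE ?powR_ge0 ?(ltW s0)//.
apply: (@le_trans _ _ n%:R); last by rewrite ler_nat.
by near: n; exact: nbhs_infty_ger.
Unshelve. all: by end_near. Qed.

Section eigenvalues.
Context {R : realType} (n : nat) (a : R).
Local Notation d := n.+1.
Let b : R := d%:R / 2 + a - 1.
Hypothesis a_range : 1 - d%:R / 2 < a < 1 / 2.

Let b0 : 0 < b. Proof. by case/andP: a_range; rewrite /b; lra. Qed.
Let bd : b + 1 / 2 < d%:R / 2. Proof. by case/andP: a_range; rewrite /b; lra. Qed.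

(** The factor by which integration against (x.y)^j multiplies a harmonic of degree [k]. *)
Definition sharm (j k : nat) : R :=
  2 * Num.sqrt pi ^+ d * gcoef R j k / Gamma_pos ((j + k + d)%:R / 2).

Lemma sharm_ge0 j k : 0 <= sharm j k.
Proof.
rewrite /sharm !mulr_ge0// ?exprn_ge0 ?sqrtr_ge0//.
  by rewrite /gcoef; case: ifPn => // _; rewrite divr_ge0// mulr_ge0.
by rewrite invr_ge0 ltW// Gamma_pos_gt0// divr_gt0// ltr0n addnS.
Qed.

(** Splitting (b)_j at [k], with [j = k + 2 * i], turns the terms into those of the hypergeometric
    sum of parameters [b + k] and [d/2 + k]. *)
Lemma bcoef_sharm k i : bcoef b (k + i.*2) * sharm (k + i.*2) k =
  2 * Num.sqrt pi ^+ d * (rising b k / 2 ^+ k) * hterm (b + k%:R) (d%:R / 2 + k%:R) i.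
Proof.
rewrite /sharm gcoef_even /bcoef risingD /hterm -/(rising _ _).
have -> : (k + i.*2 + k + d)%:R / 2 = d%:R / 2 + k%:R + i%:R :> R.
  by rewrite -muln2 !natrD natrM; field.
have -> : 2 ^+ (k + i.*2) = 2 ^+ k * 4 ^+ i :> R.
  by rewrite exprD -mul2n exprM; congr (_ * _ ^+ _); ring.
have f0 j : (j`!%:R : R) != 0 by rewrite pnatr_eq0 -lt0n fact_gt0.
have g0 : Gamma_pos (d%:R / 2 + k%:R + i%:R) != 0 :> R.
  by rewrite lt0r_neq0// Gamma_pos_gt0// !ltr_wpDr// divr_gt0.
have p2 : (2 : R) ^+ k != 0 by rewrite expf_neq0.
have p4 : (4 : R) ^+ i != 0 by rewrite expf_neq0.
move: (f0 (k + i.*2)%N) (f0 i) g0 p2 p4.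
move: (Gamma_pos _) (_`!%:R) (i`!%:R) (2 ^+ k) (4 ^+ i) => A B C D E A0 B0 C0 D0 E0.
by field; rewrite A0 B0 C0 D0 E0.
Qed.

Lemma sum_bcoef_sharm k m :
  \sum_(0 <= j < k + m.*2) bcoef b j * sharm j k =
  2 * Num.sqrt pi ^+ d * (rising b k / 2 ^+ k) * series (hterm (b + k%:R) (d%:R / 2 + k%:R)) m.
Proof.
have z j : (forall i, j != (k + i.*2)%N) -> bcoef b j * sharm j k = 0.
  by move=> h; rewrite /sharm gcoef_eq0// mulr0 mul0r mulr0.
elim: m => [|m IH].
  rewrite double0 addn0 [in RHS]/series/= [in RHS]big_geq// mulr0 big_nat_cond big1// => j /andP[/andP[_ jk] _].
  by apply: z => i; rewrite neq_ltn (leq_trans jk)// leq_addr.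
rewrite doubleS !addnS !big_nat_recr//= IH (z (k + m.*2).+1) ?addr0; last first.
  move=> i; rewrite -addnS eqn_add2l; apply/eqP => /(congr1 odd).
  by rewrite /= !odd_double.
by rewrite bcoef_sharm /series/= big_nat_recr//= mulrDr.
Qed.

(** For every [k] the condition [p + 1/2 < c] of the summation theorem reads [b + 1/2 < d/2], that
    is [a < 1/2]. The factor 2^-b comes from the kernel, the division by 2 from the operator. *)
Lemma cvg_sum_bcoef_sharm k :
  2 `^ (- b) / 2 * \sum_(0 <= j < k + m.*2) bcoef b j * sharm j k @[m --> \oo] -->
  pi `^ ((d%:R - 1) / 2) / 2 `^ (2 * a) *
    (Gamma_pos (1 / 2 - a) * rising b k / Gamma_pos (- a + d%:R / 2 + k%:R)).
Proof.
have p0 : 0 < b + k%:R by rewrite ltr_wpDr.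
have pc : b + k%:R + 1 / 2 < d%:R / 2 + k%:R by move: bd; lra.
have -> : (fun m => 2 `^ (- b) / 2 * \sum_(0 <= j < k + m.*2) bcoef b j * sharm j k) =
  (fun m => (2 `^ (- b) / 2 * (2 * Num.sqrt pi ^+ d * (rising b k / 2 ^+ k))) *
    series (hterm (b + k%:R) (d%:R / 2 + k%:R)) m).
  by apply/funext => m; rewrite sum_bcoef_sharm mulrA.
rewrite (_ : pi `^ _ / _ * _ = (2 `^ (- b) / 2 * (2 * Num.sqrt pi ^+ d * (rising b k / 2 ^+ k))) *
    hsum (b + k%:R) (d%:R / 2 + k%:R)).
  by apply: cvgMl_tmp; exact: is_cvg_hterm.
rewrite hsumE// /hval.
have -> : d%:R / 2 + k%:R - (b + k%:R) - 1 / 2 = 1 / 2 - a by rewrite /b; field.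
have -> : 2 * (d%:R / 2 + k%:R) - (b + k%:R) - 1 = - a + d%:R / 2 + k%:R by rewrite /b; field.
have -> : 2 * (d%:R / 2 + k%:R) - (b + k%:R) - 2 = b + k%:R - 2 * a by rewrite /b; field.
have P : Num.sqrt pi ^+ d = pi `^ ((d%:R - 1) / 2) * Num.sqrt pi :> R.
  rewrite -powR12_sqrt ?pi_ge0// -powR_mulrn ?powR_ge0// -powRrM -powRD; last first.
    by rewrite gt_eqF ?pi_gt0// implybT.
  by congr (_ `^ _); field.
rewrite P powRB ?pnatr_eq0 ?implybT// powRD ?pnatr_eq0 ?implybT// powR_mulrn// powRN.
have s0 : Num.sqrt pi != 0 :> R by rewrite lt0r_neq0// sqrtr_gt0 pi_gt0.
have q1 : 2 `^ b != 0 :> R by rewrite lt0r_neq0 ?powR_gt0.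
have q2 : 2 `^ (2 * a) != 0 :> R by rewrite lt0r_neq0 ?powR_gt0.
have q3 : 2 ^+ k != 0 :> R by rewrite expf_neq0.
have g0 : Gamma_pos (- a + d%:R / 2 + k%:R) != 0.
  by rewrite lt0r_neq0// Gamma_pos_gt0// ltr_wpDr//; move: b0 bd; rewrite /b; lra.
move: s0 q1 q2 q3 g0.
move: (Num.sqrt pi) (2 `^ b) (2 `^ (2 * a)) (2 ^+ k) (Gamma_pos (- a + d%:R / 2 + k%:R)) (Gamma_pos _) (pi `^ _) (rising _ _).
by move=> A B C D E F G H A0 B0 C0 D0 E0; field; rewrite A0 B0 C0 D0 E0.
Qed.

Lemma TS_lambdaE k : TS_lambda n a k =
  pi `^ ((d%:R - 1) / 2) / 2 `^ (2 * a) *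
    (Gamma_pos (1 / 2 - a) * rising b k / Gamma_pos (- a + d%:R / 2 + k%:R)).
Proof.
rewrite /TS_lambda; congr (_ * _).
have -> : 2 - a - d%:R / 2 = 1 - b by rewrite /b; ring.
rewrite Gamma_quot_rising// (@GammaE _ (1 / 2 - a)) ?(@GammaE _ (- a + _ + _)); last 2 first.
- by rewrite ltr_wpDr//; move: b0 bd; rewrite /b; lra.
- by case/andP: a_range; lra.
congr (_ / _); move: (Gamma_pos (1 / 2 - a)) => G.
by rewrite mulrCA !mulrA -expr2 sqrr_sign mul1r.
Qed.

Let c : R := - a + d%:R / 2.

Let bc : b < c. Proof. by case/andP: a_range; rewrite /b /c; lra. Qed.
Let c0 : 0 < c. Proof. exact: lt_trans bc. Qed.

Let C : R := pi `^ ((d%:R - 1) / 2) / 2 `^ (2 * a) * Gamma_pos (1 / 2 - a).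

Let C0 : 0 < C.
Proof.
rewrite /C !mulr_gt0 ?invr_gt0 ?powR_gt0 ?pi_gt0//.
by rewrite Gamma_pos_gt0//; case/andP: a_range; lra.
Qed.

Let lambdaE k : TS_lambda n a k = C * (rising b k / Gamma_pos (c + k%:R)).
Proof. by rewrite TS_lambdaE /C -!mulrA. Qed.

Lemma TS_lambda_gt0 k : 0 < TS_lambda n a k.
Proof. by rewrite lambdaE mulr_gt0// divr_gt0 ?rising_gt0// Gamma_pos_gt0// ltr_wpDr. Qed.

(** Consecutive eigenvalues have ratio [(b + k) / (c + k)], and [b < c] amounts to [a < 1/2]. *)
Lemma TS_lambda_decreasing : decreasing_seq (TS_lambda n a).
Proof.
apply/decreasing_seqP => k; rewrite !lambdaE ltr_pM2l//.
rewrite -[k.+1%:R]natr1 addrA (@Gamma_posS _ (c + k%:R)); last by rewrite ltr_wpDr.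
have G0 : 0 < Gamma_pos (c + k%:R) by rewrite Gamma_pos_gt0// ltr_wpDr.
have ck : 0 < c + k%:R by rewrite ltr_wpDr.
rewrite (_ : _ / _ = rising b k / Gamma_pos (c + k%:R) * ((b + k%:R) / (c + k%:R))); last first.
  by rewrite risingS invfM; ring.
rewrite gtr_pMr ?divr_gt0 ?rising_gt0//.
by rewrite ltr_pdivrMr// mul1r ltrD2r.
Qed.

(** By the asymptotics of Gamma, the eigenvalues decay like the power -(c - b) of [k], with
    [c - b = 1 - 2 * a]. *)
Lemma cvg_TS_lambda : TS_lambda n a @ \oo --> (0 : R).
Proof.
suff : TS_lambda n a m.+1 @[m --> \oo] --> (0 : R) by rewrite (cvg_shiftS (TS_lambda n a)).
pose r (x : R) m := Gamma_pos (m.+1%:R + x) / (m.+1%:R `^ x * Gamma_pos m.+1%:R).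
have r1 x : 0 <= x -> r x m @[m --> \oo] --> (1 : R) by exact: cvg_Gamma_pos_ratio.
rewrite (_ : (fun m => _) = (fun m => (C / Gamma_pos b) * (r b m / r c m * m.+1%:R `^ (- (c - b))))).
  have h1 : r b m / r c m @[m --> \oo] --> (1 / 1 : R).
    by apply: cvgM; [exact/r1/ltW|apply: cvgV; [exact: oner_neq0|exact/r1/ltW]].
  have h2 : m.+1%:R `^ (- (c - b)) @[m --> \oo] --> (0 : R) by apply: cvg_powRN; rewrite subr_gt0.
  have h3 : C / Gamma_pos b @[m --> \oo] --> (C / Gamma_pos b : R) by exact: cvg_cst.
  have z : C / Gamma_pos b * (1 / 1 * 0) = 0 by rewrite !mulr0.
  by rewrite -z; exact: cvgM h3 (cvgM h1 h2).
apply/funext => m; rewrite lambdaE /r opprB (@powRB R _ b c) ?pnatr_eq0 ?implybT//.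
rewrite (addrC _ b) (addrC _ c) (Gamma_posD m.+1 b0).
have m0 : 0 < m.+1%:R :> R by [].
have g1 := lt0r_neq0 (Gamma_pos_gt0 b0).
have g2 : Gamma_pos (c + m.+1%:R) != 0 by rewrite lt0r_neq0// Gamma_pos_gt0// addr_gt0.
have g3 := lt0r_neq0 (Gamma_pos_gt0 m0).
have p1 : m.+1%:R `^ b != 0 :> R by rewrite lt0r_neq0 ?powR_gt0.
have p2 : m.+1%:R `^ c != 0 :> R by rewrite lt0r_neq0 ?powR_gt0.
move: C g1 g2 g3 p1 p2.
move: (Gamma_pos b) (Gamma_pos (c + _)) (Gamma_pos m.+1%:R) (_ `^ b) (_ `^ c) (rising _ _).
by move=> x1 x2 x3 x4 x5 x6 x7 a1 a2 a3 a4 a5; field; rewrite a1 a2 a3 a4 a5.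
Qed.

Lemma TS_lambda0 : TS_lambda n a 0 =
  pi `^ ((d%:R - 1) / 2) / 2 `^ (2 * a) * (Gamma (1 / 2 - a) / Gamma (- a + d%:R / 2)).
Proof.
rewrite TS_lambdaE rising0 mulr1 addr0 !GammaE//.
by case/andP: a_range; lra.
Qed.

End eigenvalues.

(** * Squared norms and Schur's test *)

Section squared_norm.
Context d (T : measurableType d) (R : realType).
Variable mu : {finite_measure set T -> \bar R}.
Implicit Types f g h : T -> R.

(** Squared norms of real functions keep the estimates free of roots; a complex function is treated
    through its two parts. *)
Definition sqn h : \bar R := (\int[mu]_x (h x ^+ 2)%:E)%E.

Lemma measurable_sqr h : measurable_fun setT h -> measurable_fun setT (fun x => (h x ^+ 2)%:E).
Proof. by move=> mh; apply/measurable_EFinP; exact: measurable_funX. Qed.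

Lemma sqn_ge0 h : (0 <= sqn h)%E.
Proof. by apply: integral_ge0 => x _; rewrite lee_fin sqr_ge0. Qed.

Lemma le_sqn f g : measurable_fun setT f -> measurable_fun setT g ->
  (forall x, `|f x| <= `|g x|) -> (sqn f <= sqn g)%E.
Proof.
move=> mf mg fg; apply: ge0_le_integral => //.
- by move=> x _; rewrite lee_fin sqr_ge0.
- exact: measurable_sqr.
- exact: measurable_sqr.
- move=> x _; rewrite lee_fin -(real_normK (num_real (f x))) -(real_normK (num_real (g x))).
  by rewrite lerXn2r ?nnegrE.
Qed.

Lemma sqnZ c h : measurable_fun setT h -> sqn (fun x => c * h x) = ((c ^+ 2)%:E * sqn h)%E.
Proof.
move=> mh; rewrite /sqn -ge0_integralZl//; last 3 first.
- exact: measurable_sqr.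
- by move=> x _; rewrite lee_fin sqr_ge0.
- by rewrite lee_fin sqr_ge0.
by apply: eq_integral => x _; rewrite exprMn EFinM.
Qed.

Lemma sqnD f g : measurable_fun setT f -> measurable_fun setT g ->
  (sqn (fun x => f x + g x)%R <= 2%:E * (sqn f + sqn g))%E.
Proof.
move=> mf mg; rewrite /sqn -ge0_integralD//; last 4 first.
- by move=> x _; rewrite lee_fin sqr_ge0.
- exact: measurable_sqr.
- by move=> x _; rewrite lee_fin sqr_ge0.
- exact: measurable_sqr.
rewrite -ge0_integralZl//; last 2 first.
- by apply: emeasurable_funD; exact: measurable_sqr.
- by move=> x _; rewrite lee_fin addr_ge0 ?sqr_ge0.
apply: ge0_le_integral => //.
- by move=> x _; rewrite lee_fin sqr_ge0.
- by apply: measurable_sqr; exact: measurable_funD.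
- by apply: measurable_funeM; apply: emeasurable_funD; exact: measurable_sqr.
- by move=> x _; rewrite lee_fin; have := sqr_ge0 (f x - g x); nra.
Qed.

Lemma sqn_integrable h : measurable_fun setT h -> (sqn h < +oo)%E ->
  mu.-integrable setT (EFin \o h).
Proof.
move=> mh hoo.
have i2 : mu.-integrable setT (fun x => (1 + h x ^+ 2)%:E).
  apply: (@eq_integrable _ _ _ _ _ measurableT (fun x => ((cst 1%:E x) + (h x ^+ 2)%:E)%E)) => //.
  apply: integrableD => //.
    apply/integrableP; split => //; rewrite /= normr1 integral_cst// mul1e.
    by rewrite ltey_eq fin_num_measure.
  apply/integrableP; split; first exact: measurable_sqr.
  by under eq_integral do rewrite /= ger0_norm ?sqr_ge0//.
apply: le_integrable i2 => //; first exact/measurable_EFinP.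
move=> x _; rewrite /= lee_fin (@ger0_norm _ (1 + _)) ?addr_ge0 ?sqr_ge0//.
rewrite -(real_normK (num_real (h x))).
by have := sqr_ge0 (`|h x| - 1); nra.
Qed.

Lemma sqn_cst (c : R) : sqn (cst c) = ((c ^+ 2)%:E * mu setT)%E.
Proof.
by rewrite /sqn (_ : (fun x => _) = cst (c ^+ 2)%:E)// integral_cst.
Qed.

End squared_norm.

Section schur.
Context d (T : measurableType d) (R : realType).
Variable mu : {finite_measure set T -> \bar R}.
Local Open Scope ereal_scope.
Variables (q : T * T -> \bar R) (t : R).
Hypotheses (mq : measurable_fun setT q) (q0 : forall z, 0 <= q z) (t0 : (0 < t)%R).
Hypothesis qsym : forall x y, q (x, y) = q (y, x).
Hypothesis qt : forall x, \int[mu]_y q (x, y) <= t%:E.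

(** Extended-valued, hence meaningful at every [x]; for square integrable [h] it is finite almost
    everywhere by [schur_ae]. *)
Definition schur_int (h : T -> R) x : \bar R := \int[mu]_y (q (x, y) * `|h y|%:E).

Let mq1 x : measurable_fun setT (fun y => q (x, y)).
Proof. exact: measurableT_comp (pair1_measurable x). Qed.

Lemma measurable_schur_int h : measurable_fun setT h -> measurable_fun setT (schur_int h).
Proof.
move=> mh.
apply: (@measurable_fun_fubini_tonelli_F _ _ T T R mu (fun z => q z * `|h z.2|%:E)).
  apply: emeasurable_funM => //; apply/measurable_EFinP.
  by apply: measurableT_comp => //; exact: measurableT_comp.
by move=> z; rewrite mule_ge0.
Qed.

Lemma schur_int_ge0 h x : 0 <= schur_int h x.
Proof. by apply: integral_ge0 => y _; rewrite mule_ge0. Qed.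

Let J (h : T -> R) x := \int[mu]_y (q (x, y) * (h y ^+ 2)%:E).

(* AM-GM [|h| <= s / 2 + h^2 / (2 s)], optimised in [s], replaces Cauchy-Schwarz. *)
Let schur_pointwise h x : measurable_fun setT h ->
  schur_int h x * schur_int h x <= t%:E * J h x.
Proof.
move=> mh.
have mJ : measurable_fun setT (fun y => q (x, y) * (h y ^+ 2)%:E).
  by apply: emeasurable_funM => //; exact: measurable_sqr.
have J0 : 0 <= J h x by apply: integral_ge0 => y _; rewrite mule_ge0// lee_fin sqr_ge0.
have amgm (s : R) : (0 < s)%R ->
    schur_int h x <= (s * t / 2)%:E + ((s^-1 / 2)%:E * J h x).
  move=> s0.
  have s20 : (0 <= s / 2)%R by rewrite divr_ge0 ?ltW.
  have s21 : (0 <= s^-1 / 2)%R by rewrite divr_ge0 ?invr_ge0 ?ltW.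
  apply: (@le_trans _ _ ((s / 2)%:E * (\int[mu]_y q (x, y)) + (s^-1 / 2)%:E * J h x)); last first.
    by apply: leeD => //; rewrite mulrAC [leRHS]EFinM; apply: lee_wpmul2l.
  rewrite -!ge0_integralZl//; last first.
    by move=> y _; rewrite mule_ge0// lee_fin sqr_ge0.
  rewrite -ge0_integralD//; last 4 first.
  - by move=> y _; rewrite mule_ge0// lee_fin.
  - exact: measurable_funeM.
  - by move=> y _; rewrite !mule_ge0// lee_fin// sqr_ge0.
  - exact: measurable_funeM.
  apply: ge0_le_integral => //.
  - by move=> y _; rewrite mule_ge0.
  - apply: emeasurable_funM => //; apply/measurable_EFinP; exact: measurableT_comp.
  - by apply: emeasurable_funD; exact: measurable_funeM.
  move=> y _; rewrite muleCA -EFinM [_%:E * q _]muleC -ge0_muleDr ?lee_fin//; last by rewrite mulr_ge0// sqr_ge0.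
  apply: lee_wpmul2l => //; rewrite -EFinD lee_fin -(real_normK (num_real (h y))).
  have := sqr_ge0 (s - `|h y|)%R; set u := `|h y|%R => H.
  have -> : (s^-1 / 2 * u ^+ 2 = u ^+ 2 / s / 2)%R by ring.
  have : (2 * u - s <= u ^+ 2 / s)%R by rewrite ler_pdivlMr//; nra.
  lra.
have [Joo|Joo] := eqVneq (J h x) +oo.
  by rewrite Joo gt0_muley ?lte_fin// leey.
have Jf : J h x \is a fin_num by rewrite ge0_fin_numE// ltey.
have If : schur_int h x \is a fin_num.
  rewrite ge0_fin_numE ?schur_int_ge0// (le_lt_trans (amgm 1%R ltr01))// ltey_eq.
  by rewrite fin_numD fin_numM.
move: amgm (schur_int_ge0 h x) J0; rewrite -(fineK Jf) -(fineK If) -!EFinM !lee_fin.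
move: (fine _) (fine _) => j i amgm; rewrite le_eqVlt => /predU1P[<-|i0] j0.
  by rewrite mul0r mulr_ge0// ltW.
have := amgm (i / t)%R; rewrite divr_gt0// -EFinM -EFinD lee_fin => /(_ isT).
rewrite invf_div divfK ?gt_eqF// => H.
have {}H : (i / 2 <= t * j / i / 2)%R.
  have -> : (t * j / i / 2 = t / i / 2 * j)%R by ring.
  lra.
by move: H; rewrite ler_pM2r// ler_pdivlMr.
Qed.

(** The pointwise bound is integrated in [x] and the integrals are exchanged; symmetry of [q] bounds
    the columns by the same [t] as the rows. *)
Lemma schur h : measurable_fun setT h ->
  \int[mu]_x (schur_int h x * schur_int h x) <= (t ^+ 2)%:E * sqn mu h.
Proof.
move=> mh.
have mF : measurable_fun setT (fun z : T * T => q z * (h z.2 ^+ 2)%:E).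
  apply: emeasurable_funM => //; apply/measurable_EFinP/measurable_funX.
  exact: measurableT_comp.
have F0 z : 0 <= q z * (h z.2 ^+ 2)%:E by rewrite mule_ge0// lee_fin sqr_ge0.
have mJ : measurable_fun setT (J h).
  exact: (@measurable_fun_fubini_tonelli_F _ _ T T R mu _ mF F0).
have J0 x : 0 <= J h x by apply: integral_ge0 => y _; rewrite mule_ge0// lee_fin sqr_ge0.
apply: (@le_trans _ _ (\int[mu]_x (t%:E * J h x))).
  apply: ge0_le_integral => //.
  - by move=> x _; rewrite mule_ge0// schur_int_ge0.
  - by apply: emeasurable_funM; exact: measurable_schur_int.
  - exact: measurable_funeM.
  - by move=> x _; exact: schur_pointwise.
rewrite ge0_integralZl//; last by rewrite lee_fin ltW.
rewrite expr2 EFinM -muleA; apply: lee_wpmul2l; first by rewrite lee_fin ltW.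
have -> : \int[mu]_x J h x = \int[mu]_y \int[mu]_x (q (x, y) * (h y ^+ 2)%:E).
  exact: (@fubini_tonelli _ _ T T R mu mu _ mF F0).
rewrite /sqn -ge0_integralZl//; last 3 first.
- exact: measurable_sqr.
- by move=> x _; rewrite lee_fin sqr_ge0.
- by rewrite lee_fin ltW.
apply: ge0_le_integral => //.
- by move=> y _; apply: integral_ge0 => x _; rewrite mule_ge0// lee_fin sqr_ge0.
- have := @measurable_fun_fubini_tonelli_G _ _ T T R mu _ mF F0; exact.
- by apply: measurable_funeM; exact: measurable_sqr.
move=> y _; under eq_integral do rewrite qsym.
rewrite ge0_integralZr// ?lee_fin ?sqr_ge0//.
by apply: lee_wpmul2r; [rewrite lee_fin sqr_ge0|exact: qt].
Qed.

Lemma schur_ae h : measurable_fun setT h -> sqn mu h < +oo ->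
  \forall x \ae mu, schur_int h x \is a fin_num.
Proof.
move=> mh hoo.
have : mu.-integrable setT (fun x => schur_int h x * schur_int h x).
  apply/integrableP; split.
    by apply: emeasurable_funM; exact: measurable_schur_int.
  under eq_integral do rewrite gee0_abs ?mule_ge0 ?schur_int_ge0//.
  apply: le_lt_trans (schur mh) _; rewrite ltey_eq fin_numM//.
  by rewrite ge0_fin_numE// sqn_ge0.
move=> /(integrable_ae measurableT); apply: filterS => x /(_ I).
have := schur_int_ge0 h x; case: (schur_int h x) => //.
Qed.

End schur.

(** * Integral operators with a dominated kernel *)

Section kernel_operator.
Context d (T : measurableType d) (R : realType).
Variable mu : {finite_measure set T -> \bar R}.
Local Open Scope ereal_scope.

Implicit Types (K P : T * T -> R) (f g h : T -> R) (x : T) (c : R).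

Definition rop (K : T * T -> R) (h : T -> R) (x : T) : R := (\int[mu]_y (K (x, y) * h y))%R.

Lemma measurable_kernel_section (K : T * T -> R) (h : T -> R) x : measurable_fun setT K ->
  measurable_fun setT h -> measurable_fun setT (fun y => K (x, y) * h y)%R.
Proof.
move=> mK mh; apply: measurable_funM => //.
exact: measurableT_comp (pair1_measurable x).
Qed.

Lemma measurable_rop K h : measurable_fun setT K -> measurable_fun setT h ->
  measurable_fun setT (rop K h).
Proof.
move=> mK mh; pose F (z : T * T) := (K z * h z.2)%:E.
have mF : measurable_fun setT F.
  by apply/measurable_EFinP; apply: measurable_funM => //; exact: measurableT_comp.
have -> : rop K h = fine \o (fun x => \int[mu]_y F^\+ (x, y) - \int[mu]_y F^\- (x, y)).
  apply/funext => x; rewrite /rop /Rintegral integralE /=; congr (fine (_ - _)).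
    by apply: eq_integral => y _; rewrite !funeposE.
  by apply: eq_integral => y _; rewrite !funenegE.
apply: measurableT_comp => //; apply: emeasurable_funB.
- apply: (@measurable_fun_fubini_tonelli_F _ _ T T R mu) => //; exact: measurable_funepos.
- apply: (@measurable_fun_fubini_tonelli_F _ _ T T R mu) => //; exact: measurable_funeneg.
Qed.

(** The images agree at every point, not only almost everywhere; [TS_eigenvalue] evaluates one at
    the pole. *)
Lemma rop_ae_eq K f g : measurable_fun setT K -> measurable_fun setT f -> measurable_fun setT g ->
  f = g %[ae mu] -> rop K f = rop K g.
Proof.
move=> mK mf mg fg; apply/funext => x; congr fine; apply: ae_eq_integral => //.
- by apply/measurable_EFinP; exact: measurable_kernel_section.
- by apply/measurable_EFinP; exact: measurable_kernel_section.
by apply: filterS fg => y /= /(_ I) -> _.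
Qed.

Variables (q : T * T -> \bar R) (t : R).
Hypotheses (mq : measurable_fun setT q) (q0 : forall z, 0 <= q z) (t0 : (0 < t)%R).
Hypothesis qsym : forall x y, q (x, y) = q (y, x).
Hypothesis qt : forall x, \int[mu]_y q (x, y) <= t%:E.

Lemma rop_schur (D : T * T -> R) h x : measurable_fun setT D -> measurable_fun setT h ->
  (forall z, `|D z|%:E <= q z) -> schur_int mu q h x \is a fin_num ->
  mu.-integrable setT (fun y => (D (x, y) * h y)%:E) /\ `|rop D h x|%:E <= schur_int mu q h x.
Proof.
move=> mD mh Dq hx.
have mDh : measurable_fun setT (fun y => (D (x, y) * h y)%:E).
  by apply/measurable_EFinP; exact: measurable_kernel_section.
have le : \int[mu]_y `|(D (x, y) * h y)%:E| <= schur_int mu q h x.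
  apply: ge0_le_integral => //.
  - exact: measurableT_comp.
  - apply: emeasurable_funM; first exact: measurableT_comp (pair1_measurable x).
    by apply/measurable_EFinP; exact: measurableT_comp.
  - by move=> y _; rewrite /= normrM EFinM; apply: lee_wpmul2r.
have iD : mu.-integrable setT (fun y => (D (x, y) * h y)%:E).
  by apply/integrableP; split=> //; apply: le_lt_trans le _; rewrite ltey_eq hx.
split => //; apply: le_trans le; rewrite /rop /Rintegral EFin_normr_Rintegral//.
exact: le_abse_integral.
Qed.

(** Integrability for [K] is that for [P] plus that of a remainder dominated by [q], so it can be
    obtained at each point where [schur_int] is finite. *)
Lemma rop_approx K P h x : measurable_fun setT K -> measurable_fun setT P ->
  measurable_fun setT h -> (forall z, `|K z - P z|%:E <= q z) ->
  schur_int mu q h x \is a fin_num -> mu.-integrable setT (fun y => (P (x, y) * h y)%:E) ->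
  mu.-integrable setT (fun y => (K (x, y) * h y)%:E) /\
  `|rop K h x - rop P h x|%:E <= schur_int mu q h x.
Proof.
move=> mK mP mh Kq hx iP; pose D (z : T * T) := (K z - P z)%R.
have mD : measurable_fun setT D by exact: measurable_funB.
have [iD leD] := rop_schur mD mh Kq hx.
have E : (fun y => (K (x, y) * h y)%:E) = (fun y => (P (x, y) * h y)%:E + (D (x, y) * h y)%:E).
  by apply/funext => y; rewrite -EFinD -mulrDl /D addrC subrK.
split; first by rewrite E; exact: integrableD.
have -> : (rop K h x - rop P h x = rop D h x)%R; last by [].
rewrite /rop /Rintegral E integralD// fineD ?integrable_fin_num//.
by rewrite addrAC subrr add0r.
Qed.

Lemma rop_linear_ae K c f g : measurable_fun setT K -> (forall z, `|K z|%:E <= q z) ->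
  measurable_fun setT f -> measurable_fun setT g -> sqn mu f < +oo -> sqn mu g < +oo ->
  \forall x \ae mu, rop K (fun y => c * f y + g y)%R x = (c * rop K f x + rop K g x)%R.
Proof.
move=> mK Kq mf mg foo goo.
apply: filterS2 (schur_ae mq q0 t0 qsym qt mf foo) (schur_ae mq q0 t0 qsym qt mg goo) => x fx gx.
have [if_ _] := rop_schur mK mf Kq fx; have [ig _] := rop_schur mK mg Kq gx.
rewrite /rop -RintegralZl//.
rewrite -RintegralD//; last first.
  by apply: (@eq_integrable _ _ _ _ _ measurableT (fun y => c%:E * (K (x, y) * f y)%:E)) => //; exact: integrableZl.
by congr Rintegral; apply/funext => y; rewrite mulrDr mulrCA.
Qed.

Lemma sqn_rop K h : measurable_fun setT K -> (forall z, `|K z|%:E <= q z) ->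
  measurable_fun setT h -> sqn mu h < +oo -> sqn mu (rop K h) <= (t ^+ 2)%:E * sqn mu h.
Proof.
move=> mK Kq mh hoo; apply: le_trans (schur mq q0 t0 qsym qt mh).
have mI : measurable_fun setT (schur_int mu q h) by exact: measurable_schur_int.
apply: ae_ge0_le_integral => //.
- by move=> x _; rewrite lee_fin sqr_ge0.
- by apply: measurable_sqr; exact: measurable_rop.
- by move=> x _; rewrite mule_ge0// schur_int_ge0.
- exact: emeasurable_funM.
apply: filterS (schur_ae mq q0 t0 qsym qt mh hoo) => x hx _.
have [_] := rop_schur mK mh Kq hx.
rewrite -(fineK hx) -EFinM !lee_fin => le; rewrite -(real_normK (num_real (rop K h x))) expr2.
by rewrite ler_pM.
Qed.

(** [K] is split into [P], whose image is bounded by [D], and a remainder of Schur bound [t]; the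
    factor 2 comes from [(D + w)^2 <= 2 * (D^2 + w^2)]. *)
Lemma sqn_rop_approx K P h (D : R) : measurable_fun setT K -> measurable_fun setT P ->
  (forall z, `|K z - P z|%:E <= q z) ->
  measurable_fun setT h -> sqn mu h < +oo ->
  (forall x, mu.-integrable setT (fun y => (P (x, y) * h y)%:E)) ->
  (forall x, `|rop P h x| <= D)%R ->
  sqn mu (rop K h) <= 2%:E * ((D ^+ 2)%:E * mu setT + (t ^+ 2)%:E * sqn mu h).
Proof.
move=> mK mP Kq mh hoo iP PD.
have mI : measurable_fun setT (schur_int mu q h) by exact: measurable_schur_int.
have I0 x : 0 <= schur_int mu q h x by exact: schur_int_ge0.
have mII : measurable_fun setT (fun x => schur_int mu q h x * schur_int mu q h x).
  exact: emeasurable_funM.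
have D20 : 0 <= (D ^+ 2)%:E :> \bar R by rewrite lee_fin sqr_ge0.
apply: (@le_trans _ _ (\int[mu]_x (2%:E * ((D ^+ 2)%:E + schur_int mu q h x * schur_int mu q h x)))); last first.
  rewrite ge0_integralZl//; last 2 first.
  - exact: emeasurable_funD.
  - by move=> x _; rewrite adde_ge0// mule_ge0.
  apply: lee_wpmul2l => //; rewrite ge0_integralD//; last by move=> x _; rewrite mule_ge0.
  rewrite integral_cst//; apply: leeD => //; exact: (schur mq q0 t0 qsym qt mh).
apply: ae_ge0_le_integral => //.
- by move=> x _; rewrite lee_fin sqr_ge0.
- by apply: measurable_sqr; exact: measurable_rop.
- by move=> x _; rewrite mule_ge0// adde_ge0// mule_ge0.
- by apply: measurable_funeM; exact: emeasurable_funD.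
apply: filterS (schur_ae mq q0 t0 qsym qt mh hoo) => x hx _.
have [_] := rop_approx mK mP mh Kq hx (iP x).
have := PD x; move: (rop K h x) (rop P h x) => u v vD.
rewrite -(fineK hx); move: (fine _) => w; rewrite -[w%:E * w%:E]EFinM.
rewrite -EFinD -EFinM !lee_fin => uvw.
have u1 : (`|u| <= D + w)%R.
  by rewrite -[u](subrK v) (le_trans (ler_normD _ _))// addrC lerD.
rewrite -(real_normK (num_real u)).
have := sqr_ge0 (D - w)%R; have : (`|u| ^+ 2 <= (D + w) ^+ 2)%R.
  by rewrite lerXn2r// nnegrE// (le_trans _ u1).
nra.
Qed.

End kernel_operator.

(** * Cauchy sequences, limits along ultrafilters, completeness of L^2 *)

Lemma dyadic_cauchy (R : realType) (u : nat -> R) (s : R) :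
  (forall m, `|u m.+1 - u m| <= s * 2^-1 ^+ m) ->
  exists2 l, u @ \oo --> l & forall m, `|l - u m| <= 2 * s * 2^-1 ^+ m.
Proof.
move=> hu.
have s0 : 0 <= s by have := hu 0%N; rewrite expr0 mulr1; apply: le_trans.
have w0 m : 0 <= (2^-1 : R) ^+ m by rewrite exprn_ge0.
have tail m p : `|u (m + p)%N - u m| <= 2 * s * (2^-1 ^+ m - 2^-1 ^+ (m + p)).
  elim: p => [|p IH]; first by rewrite addn0 !subrr normr0 mulr0.
  rewrite -[X in X - u m](subrK (u (m + p)%N)) -addrA (le_trans (ler_normD _ _))//.
  have := hu (m + p)%N; rewrite addnS exprS.
  move: IH (w0 (m + p)%N); move: (2^-1 ^+ m) (2^-1 ^+ (m + p)) => x y.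
  by move: `|_ - _| `|_ - _| => A B; nra.
have tail2 m p : `|u (m + p)%N - u m| <= 2 * s * 2^-1 ^+ m.
  apply: le_trans (tail m p) _; rewrite ler_wpM2l// ?mulr_ge0//.
  by rewrite gerBl.
have cu : cvgn u.
  apply/cauchy_cvgP/cauchy_exP => e e0.
  have [m hm] : exists m, 2 * s * 2^-1 ^+ m < e.
    have : 2 * s * 2^-1 ^+ m @[m --> \oo] --> (2 * s * 0 : R).
      by apply: cvgMl_tmp; apply: cvg_expr; rewrite ger0_norm// invf_lt1// ltr1n.
    rewrite mulr0 => /cvgrPdist_lt/(_ _ e0)[N _ /(_ N (leqnn N))].
    by rewrite /= sub0r normrN ger0_norm ?mulr_ge0// => h; exists N.
  exists (u m); exists m => // p /= mp; rewrite /ball/= distrC.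
  by rewrite -(subnKC mp) (le_lt_trans (tail2 _ _)).
exists (limn u); first exact: cu.
move=> m; have h : `|u p - u m| @[p --> \oo] --> `|limn u - u m|.
  by apply: cvg_norm; apply: cvgB => //; exact: cvg_cst.
rewrite -(cvg_lim _ h)//; apply: limr_le; first by apply/cvg_ex; eexists; exact: h.
by exists m => // p /= mp; rewrite -(subnKC mp).
Qed.

(** The image ultrafilter lives on the compact interval [[-M, M]] and so converges. All bounded
    sequences acquire limits along the same [U], without extraction of subsequences. *)
Lemma ultra_bounded_cvg (R : realType) (U : set_system nat) (v : nat -> R) (M : R) :
  UltraFilter U -> (forall i, `|v i| <= M) ->
  exists l, forall e, 0 < e -> U [set i | `|v i - l| <= e].
Proof.
move=> UF vM.
have UV : UltraFilter (v @ U).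
  apply: Build_UltraFilter => G GF sub; apply/seteqP; split => B; last exact: sub.
  move=> GB; have [//|UB] := in_ultra_setVsetC (v @^-1` B) UF.
  have : G (~` B) by apply: sub.
  by move=> /(filterI GB); rewrite setICr => /filter_not_empty.
have := @segment_compact R (- M) M; rewrite compact_ultra => /(_ _ UV)[].
  suff : U [set i | `[- M, M]%classic (v i)] by [].
  have UT : U setT by exact: filterT.
  by apply: filterS UT => i _ /=; rewrite in_itv/= -ler_norml.
move=> l [_ vl]; exists l => e e0.
move: vl => /cvgrPdist_le/(_ _ e0).
by apply: filterS => i /=; rewrite distrC.
Qed.

Section riesz_fischer.
Context d (T : measurableType d) (R : realType).
Variable mu : {finite_measure set T -> \bar R}.
Local Open Scope ereal_scope.

(** The weights 4^m share out the decay 16^-m: [G], the sum of the 4^m D_m^2, has integral at most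
    2, and where [G] is finite |D_m| is at most sqrt(G) 2^-m. The dyadic bound gives (h_m - l)^2 <=
    4 G 4^-m there, and integration yields the constant 8. *)
Lemma riesz_fischer (h : nat -> T -> R) : (forall m, measurable_fun setT (h m)) ->
  (forall m, sqn mu (fun x => h m.+1 x - h m x)%R <= (16^-1 ^+ m)%:E) ->
  exists2 g : T -> R, measurable_fun setT g &
    forall m, sqn mu (fun x => h m x - g x)%R <= (8 * 4^-1 ^+ m)%:E.
Proof.
move=> mh hh.
pose D m x := (h m.+1 x - h m x)%R.
have mD m : measurable_fun setT (D m) by exact: measurable_funB.
pose F m x := (4 ^+ m * D m x ^+ 2)%R%:E.
have F0 m x : 0 <= F m x by rewrite lee_fin; apply: mulr_ge0; [exact: exprn_ge0|exact: sqr_ge0].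
have mF m : measurable_fun setT (F m).
  by apply/measurable_EFinP; apply: measurable_funM => //; exact: measurable_funX.
pose G x := \sum_(m <oo) F m x.
have mG : measurable_fun setT G by apply: ge0_emeasurable_sum.
have G0 x : 0 <= G x by apply: nneseries_ge0.
have iG : \int[mu]_x G x <= 2%:E.
  rewrite integral_nneseries//; apply: lime_le; first by apply: is_cvg_nneseries => m _ _; exact: integral_ge0.
  apply: nearW => k; apply: (@le_trans _ _ (\sum_(0 <= m < k) (4^-1 ^+ m)%:E)).
    apply: lee_sum => m _; rewrite /F.
    under eq_integral do rewrite EFinM.
    rewrite ge0_integralZl//; last 2 first.
    - exact: measurable_sqr.
    - by move=> x _; rewrite lee_fin sqr_ge0.
    apply: le_trans (lee_wpmul2l _ (hh m)) _; first by rewrite lee_fin exprn_ge0.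
    by rewrite -EFinM -exprMn lee_fin (_ : 4 * 16^-1 = 4^-1 :> R)%R//; field.
  rewrite sumEFin lee_fin.
  suff : (\sum_(0 <= m < k) 4^-1 ^+ m <= 2 - 2 * 4^-1 ^+ k :> R)%R.
    by move=> /le_trans; apply; rewrite gerBl mulr_ge0// exprn_ge0.
  elim: k => [|k IH]; first by rewrite big_geq// expr0 mulr1 subrr.
  rewrite big_nat_recr//= exprS.
  have : (0 <= 4^-1 ^+ k :> R)%R by rewrite exprn_ge0.
  by move: IH; move: (_ ^+ k)%R (\sum_(_ <= _ < _) _)%R => y z; lra.
pose A := [set x | G x \is a fin_num].
have mA : measurable A.
  rewrite -[A]setTI; exact: (emeasurable_fin_num measurableT mG).
have cv x : A x -> exists2 l, h m x @[m --> \oo] --> l &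
    forall m, ((h m x - l) ^+ 2 <= 4 * fine (G x) * 4^-1 ^+ m)%R.
  move=> Ax; have g0 : (0 <= fine (G x))%R by rewrite fine_ge0.
  have hD m : (`|D m x| <= Num.sqrt (fine (G x)) * 2^-1 ^+ m)%R.
    rewrite -ler_sqr ?nnegrE ?mulr_ge0 ?sqrtr_ge0 ?exprn_ge0//.
    rewrite exprMn sqr_sqrtr// real_normK ?num_real// -exprM mulnC exprM.
    have -> : (2^-1 ^+ 2 = 4^-1 :> R)%R by field.
    rewrite exprVn ler_pdivlMr ?exprn_gt0// mulrC -lee_fin fineK//.
    apply: le_trans (@nneseries_lim_ge _ (F^~ x) xpredT 0%N m.+1 _) => //.
    by rewrite big_nat_recr//= leeDr// sume_ge0.
  have [l hl lD] := dyadic_cauchy hD; exists l => // m.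
  rewrite -(real_normK (num_real (_ - _)%R)) distrC.
  apply: (@le_trans _ _ ((2 * Num.sqrt (fine (G x)) * 2^-1 ^+ m) ^+ 2)%R).
    by rewrite lerXn2r// nnegrE ?mulr_ge0 ?sqrtr_ge0 ?exprn_ge0.
  rewrite !exprMn sqr_sqrtr// -exprM mulnC exprM.
  have -> : (2^-1 ^+ 2 = 4^-1 :> R)%R by field.
  by have -> : (2 ^+ 2 = 4 :> R)%R by ring.
(* Cutting off outside the set [A] where [G] is finite makes the sequence converge everywhere,
   whence a measurable limit. *)
pose g x := limn (fun m => h m x * \1_A x)%R.
have gcv x : (h m x * \1_A x)%R @[m --> \oo] --> g x.
  have [xA|xA] := pselect (A x).
    have [l hl _] := cv _ xA; apply/cvg_ex; exists (l * \1_A x)%R.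
    by apply: cvgMr_tmp.
  by rewrite /g indicE memNset//; under eq_fun do rewrite mulr0; rewrite lim_cst//; exact: cvg_cst.
have mg : measurable_fun setT g.
  apply: (@measurable_fun_cvg _ _ _ _ (fun m x => h m x * \1_A x)%R) => // m.
  by apply: measurable_funM => //; exact: measurable_indic.
exists g => // m.
have aeA : \forall x \ae mu, A x.
  have : mu.-integrable setT G.
    apply/integrableP; split => //.
    by under eq_integral do rewrite gee0_abs//; apply: le_lt_trans iG _; rewrite ltry.
  by move=> /(integrable_ae measurableT); apply: filterS => x /(_ I).
apply: (@le_trans _ _ (\int[mu]_x ((4 * 4^-1 ^+ m)%:E * G x))); last first.
  rewrite ge0_integralZl//.
  apply: le_trans (lee_wpmul2l _ iG) _; first by rewrite lee_fin mulr_ge0// exprn_ge0.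
  by rewrite -EFinM lee_fin mulrAC -natrM.
apply: ae_ge0_le_integral => //.
- by move=> x _; rewrite lee_fin sqr_ge0.
- by apply: measurable_sqr; exact: measurable_funB.
- by move=> x _; rewrite mule_ge0// lee_fin mulr_ge0// exprn_ge0.
- exact: measurable_funeM.
apply: filterS aeA => x Ax _; have [l hl lD] := cv _ Ax.
have -> : g x = l.
  rewrite /g indicE mem_set//; under eq_fun do rewrite mulr1; exact: cvg_lim.
by rewrite -(fineK Ax) -EFinM lee_fin mulrAC.
Qed.

End riesz_fischer.

(** * Finite-rank kernels and compactness by approximation *)

Section separated_kernels.
Context d (T : measurableType d) (R : realType).
Variable mu : {finite_measure set T -> \bar R}.

Definition bmeasurable (h : T -> R) := measurable_fun setT h /\ exists C, forall x, `|h x| <= C.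

(** Kernels of finite rank. The factors are bounded, so that they can be integrated against any
    integrable function and the class is closed under products. *)
Definition separated (P : T * T -> R) := exists (I : finType) (a b : I -> T -> R),
  [/\ forall i, bmeasurable (a i), forall i, bmeasurable (b i) &
      P = (fun z => \sum_i a i z.1 * b i z.2)].

Lemma bmeasurableM h k : bmeasurable h -> bmeasurable k -> bmeasurable (fun x => h x * k x).
Proof.
move=> [mh [C hC]] [mk [D kD]]; split; first exact: measurable_funM.
by exists (C * D) => x; rewrite normrM ler_pM.
Qed.

Lemma separated_prod a b : bmeasurable a -> bmeasurable b -> separated (fun z => a z.1 * b z.2).
Proof.
move=> ba bb; exists unit, (fun=> a), (fun=> b); split => //.
by apply/funext => z; rewrite big_const card_unit /= addr0.
Qed.

Lemma bmeasurable_cst c : bmeasurable (cst c).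
Proof. by split => //; exists `|c|. Qed.

Lemma separated_cst c : separated (cst c).
Proof.
have := separated_prod (bmeasurable_cst c) (bmeasurable_cst 1).
by rewrite (_ : (fun z => _) = cst c)//; apply/funext => z; rewrite mulr1.
Qed.

Lemma separatedD P Q : separated P -> separated Q -> separated (fun z => P z + Q z).
Proof.
move=> [I [a [b [ba bb ->]]]] [J [a' [b' [ba' bb' ->]]]].
exists (I + J)%type, (fun ij => match ij with inl i => a i | inr j => a' j end),
  (fun ij => match ij with inl i => b i | inr j => b' j end).
by split; [case|case|apply/funext => z; rewrite big_sumType].
Qed.

Lemma separatedM P Q : separated P -> separated Q -> separated (fun z => P z * Q z).
Proof.
move=> [I [a [b [ba bb ->]]]] [J [a' [b' [ba' bb' ->]]]].
exists (I * J)%type, (fun ij x => a ij.1 x * a' ij.2 x), (fun ij x => b ij.1 x * b' ij.2 x).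
split; [by move=> ij; exact: bmeasurableM|by move=> ij; exact: bmeasurableM|].
apply/funext => z; rewrite mulr_suml.
under eq_bigr do rewrite mulr_sumr.
by rewrite pair_big/=; apply: eq_bigr => -[i j] _; rewrite mulrACA.
Qed.

Lemma separatedX P j : separated P -> separated (fun z => P z ^+ j).
Proof.
move=> sP; elim: j => [|j IH].
  by rewrite (_ : (fun z => _) = cst 1); [exact: separated_cst|exact/funext].
rewrite (_ : (fun z => _) = (fun z => P z * P z ^+ j)); first exact: separatedM.
by apply/funext => z; rewrite exprS.
Qed.

Lemma separated_sum (I : Type) (r : seq I) (P : I -> T * T -> R) :
  (forall i, separated (P i)) -> separated (fun z => \sum_(i <- r) P i z).
Proof.
move=> sP; elim: r => [|i r IH].
  by rewrite (_ : (fun z => _) = cst 0); [exact: separated_cst|apply/funext => z; rewrite big_nil].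
rewrite (_ : (fun z => _) = (fun z => P i z + \sum_(i <- r) P i z)); first exact: separatedD.
by apply/funext => z; rewrite big_cons.
Qed.

Lemma measurable_separated P : separated P -> measurable_fun setT P.
Proof.
move=> [I [a [b [ba bb ->]]]]; apply: measurable_sum => i.
have [ma _] := ba i; have [mb _] := bb i.
by apply: measurable_funM; exact: measurableT_comp.
Qed.

Lemma integrable_bmeasurableM b h : bmeasurable b -> mu.-integrable setT (EFin \o h) ->
  mu.-integrable setT (fun y => (b y * h y)%:E).
Proof.
move=> [mb [C bC]] ih.
have iC : mu.-integrable setT (fun y => (C%:E * (h y)%:E)%E) by exact: integrableZl.
apply: le_integrable iC => //.
  apply/measurable_EFinP; apply: measurable_funM => //.
  by apply/measurable_EFinP; exact: measurable_int ih.
move=> y _; rewrite /= lee_fin !normrM ler_wpM2r//.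
exact: le_trans (bC y) (ler_norm C).
Qed.

Lemma separated_rop (I : finType) (a b : I -> T -> R) h x :
  (forall i, bmeasurable (b i)) -> mu.-integrable setT (EFin \o h) ->
  let P := (fun z => \sum_i a i z.1 * b i z.2) in
  mu.-integrable setT (fun y => (P (x, y) * h y)%:E) /\
  rop mu P h x = \sum_i a i x * \int[mu]_y (b i y * h y).
Proof.
move=> bb ih P.
have ib i := integrable_bmeasurableM (bb i) ih.
have E : (fun y => P (x, y) * h y) = (fun y => \sum_i a i x * (b i y * h y)).
  by apply/funext => y; rewrite /P/= mulr_suml; apply: eq_bigr => i _; rewrite mulrA.
have iab i : mu.-integrable setT (fun y => (a i x * (b i y * h y))%:E).
  by apply: (@eq_integrable _ _ _ _ _ measurableT (fun y => ((a i x)%:E * (b i y * h y)%:E)%E)) => //; exact: integrableZl.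
split.
  apply: (@eq_integrable _ _ _ _ _ measurableT (fun y => (\sum_i (a i x * (b i y * h y))%:E)%E)).
    by move=> y _ /=; rewrite sumEFin; congr EFin; rewrite -(congr1 (@^~ y) E).
  by apply: integrable_sum => // i _; exact: iab.
rewrite /rop E /Rintegral.
under eq_integral do rewrite -sumEFin.
rewrite integral_sum// -sum_fine; last by move=> i _; apply: integrable_fin_num => //; exact: iab.
by apply: eq_bigr => i _; exact: (@RintegralZl _ _ _ mu setT (fun y => b i y * h y) (a i x) measurableT (ib i)).
Qed.

End separated_kernels.

Section compactness.
Context d (T : measurableType d) (R : realType).
Variable mu : {finite_measure set T -> \bar R}.
Variable K : T * T -> R.
Hypothesis mK : measurable_fun setT K.
(** Approximation in operator norm, stated through a symmetric majorant of the error to which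
    Schur's test applies. *)
Hypothesis approx : forall t : R, 0 < t -> exists (P : T * T -> R) (q : T * T -> \bar R),
  [/\ separated P, measurable_fun setT q /\ (forall z, (0 <= q z)%E),
      forall x y, q (x, y) = q (y, x),
      forall x, (\int[mu]_y q (x, y) <= t%:E)%E &
      forall z, (`|K z - P z|%:E <= q z)%E].
Variables (f : nat -> T -> R) (M : R).
Hypothesis mf : forall j, measurable_fun setT (f j).
Hypothesis fM : forall j, (sqn mu (f j) <= M%:E)%E.
Variable U : set_system nat.
Hypothesis UU : UltraFilter U.

Let M0 : 0 <= M.
Proof. by rewrite -lee_fin; apply: le_trans (fM 0); exact: sqn_ge0. Qed.

Let foo j : (sqn mu (f j) < +oo)%E.
Proof. by apply: le_lt_trans (fM j) _; rewrite ltry. Qed.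

Let if_ j : mu.-integrable setT (EFin \o f j).
Proof. exact: sqn_integrable. Qed.

Let mdf i j : measurable_fun setT (fun y => f i y - f j y).
Proof. exact: measurable_funB. Qed.

Let sqn_df i j : (sqn mu (fun y => f i y - f j y)%R <= (4 * M)%:E)%E.
Proof.
have -> : (fun y => f i y - f j y) = (fun y => f i y + -1 * f j y).
  by apply/funext => y; rewrite mulN1r.
have mN : measurable_fun setT (fun y => -1 * f j y) by exact: measurable_funM.
apply: le_trans (sqnD mu (mf i) mN) _; rewrite sqnZ// sqrrN expr1n mul1e.
have -> : (4 * M)%:E = (2%:E * (M%:E + M%:E))%E by rewrite -EFinD -EFinM; congr EFin; ring.
by apply: lee_wpmul2l => //; exact: leeD.
Qed.

Let idf i j : mu.-integrable setT (EFin \o (fun y => f i y - f j y)).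
Proof.
apply: sqn_integrable => //; apply: le_lt_trans (sqn_df i j) _; exact: ltry.
Qed.

(* A bounded sequence converges weakly along the ultrafilter [U], so finite-rank
   operators send it to Cauchy sequences along [U]. *)
Lemma ultra_int_cauchy (b : T -> R) : bmeasurable b -> forall e, 0 < e ->
  exists2 A, U A & forall i j, A i -> A j -> `|\int[mu]_y (b y * (f i y - f j y))| <= e.
Proof.
move=> bb e e0; have [mb [C bC]] := bb.
have C0 : 0 <= `|C| by [].
have ib j := integrable_bmeasurableM bb (if_ j).
pose v j := \int[mu]_y (b y * f j y).
have vV j : `|v j| <= C ^+ 2 * fine (mu setT) + M.
  rewrite -lee_fin EFinD EFinM fineK ?fin_num_measure//.
  have mbf : measurable_fun setT (fun y => (b y * f j y)%:E).
    by apply/measurable_EFinP; exact: measurable_funM.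
  rewrite /v EFin_normr_Rintegral; [|by []|exact: ib].
  apply: le_trans (le_abse_integral mu measurableT mbf) _.
  apply: le_trans (_ : _ <= (C ^+ 2)%:E * mu setT + sqn mu (f j))%E _; last exact: leeD.
  rewrite -(integral_cst mu measurableT) /sqn -ge0_integralD//; last 3 first.
  - by move=> y _; rewrite lee_fin sqr_ge0.
  - by move=> y _; rewrite lee_fin sqr_ge0.
  - exact: measurable_sqr.
  apply: ge0_le_integral => //.
  - by apply: measurableT_comp => //; apply/measurable_EFinP; exact: measurable_funM.
  - by apply: emeasurable_funD => //; exact: measurable_sqr.
  move=> y _; rewrite /= -EFinD lee_fin normrM.
  rewrite -(real_normK (num_real (f j y))); have := bC y.
  have := normr_ge0 (b y); have := normr_ge0 (f j y).
  move: `|b y| `|f j y| => B F F0 B0 BC.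
  have := sqr_ge0 (F - C); nra.
have [l hl] := ultra_bounded_cvg UU vV.
have e20 : 0 < e / 2 by rewrite divr_gt0.
exists [set i | `|v i - l| <= e / 2]; first exact: hl.
move=> i j /= vi vj; rewrite (_ : \int[mu]_y _ = v i - v j).
  rewrite -[v i](subrK l) -addrA (le_trans (ler_normD _ _))// [leRHS]splitr.
  by rewrite lerD// distrC.
have -> : (fun y => b y * (f i y - f j y)) = (fun y => b y * f i y - b y * f j y).
  by apply/funext => y; exact: mulrBr.
exact: (@RintegralB _ _ _ mu setT (fun y => b y * f i y) (fun y => b y * f j y) measurableT (ib i) (ib j)).
Qed.

(** The error of a finite-rank approximation is small uniformly in [i] and [j] by Schur's test. The
    finite-rank part depends on finitely many integrals, each Cauchy along [U], and finitely many
    members of [U] intersect in a member. *)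
Lemma ultra_rop_cauchy e : 0 < e -> exists2 A, U A &
  forall i j, A i -> A j -> (sqn mu (rop mu K (fun y => f i y - f j y)%R) <= e%:E)%E.
Proof.
(* The squared norm of a difference is at most [4 * M], so this choice makes [t ^+ 2 * (4 * M)] at
   most [e / 4]; the added 1 covers [M = 0]. *)
move=> e0; pose t := Num.sqrt (e / (16 * (M + 1))).
have M1 : 0 < M + 1 by rewrite ltr_wpDl.
have t0 : 0 < t by rewrite sqrtr_gt0 divr_gt0// mulr_gt0.
have [P [q [sP [mq q0] qsym qt Kq]]] := approx t0.
have mP := measurable_separated sP.
have [I [a [b [ba bb PE]]]] := sP.
have [C aC] : exists C : I -> R, forall i x, `|a i x| <= C i.
  have := fun i => (ba i).2; move/choice => [C hC]; by exists C.
pose m := fine (mu setT).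
have m0 : 0 <= m by rewrite fine_ge0.
(* Likewise [D ^+ 2 * m] is at most [e / 4]; the factor 2 in [sqn_rop_approx] then brings the total
   to [e]. *)
pose D := Num.sqrt (e / (4 * (m + 1))).
have m1 : 0 < m + 1 by rewrite ltr_wpDl.
have D0 : 0 < D by rewrite sqrtr_gt0 divr_gt0// mulr_gt0.
pose S := \sum_i `|C i| + 1.
have S0 : 0 < S by rewrite ltr_wpDl// sumr_ge0.
have DS : 0 < D / S by rewrite divr_gt0.
have /choice[A hA] : forall s : I, exists A : set nat, U A /\
    forall i j, A i -> A j -> `|\int[mu]_y (b s y * (f i y - f j y))| <= D / S.
  by move=> s; have [A UA HA] := ultra_int_cauchy (bb s) DS; exists A.
exists [set i | forall s, A s i].
  by apply: filter_forall => s; exact: (hA s).1.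
move=> i j Ai Aj.
have rP x : `|rop mu P (fun y => f i y - f j y) x| <= D.
  rewrite PE (separated_rop a x bb (idf i j)).2.
  apply: le_trans (ler_norm_sum _ _ _) _.
  apply: (@le_trans _ _ (\sum_s `|C s| * (D / S))).
    apply: ler_sum => s _; rewrite normrM ler_pM//.
      exact: le_trans (aC s x) (ler_norm _).
    exact: (hA s).2.
  rewrite -mulr_suml mulrCA ler_piMr ?(ltW D0)// ler_pdivrMr// mul1r.
  by rewrite lerDl.
have iP x : mu.-integrable setT (fun y => (P (x, y) * (f i y - f j y))%:E).
  by rewrite PE; exact: (separated_rop a x bb (idf i j)).1.
have doo : (sqn mu (fun y => f i y - f j y)%R < +oo)%E.
  by apply: le_lt_trans (sqn_df i j) _; exact: ltry.
apply: le_trans (sqn_rop_approx mq q0 t0 qsym qt mK mP Kq (mdf i j) doo iP rP) _.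
apply: (@le_trans _ _ (2%:E * ((D ^+ 2)%:E * m%:E + (t ^+ 2)%:E * (4 * M)%:E))%E).
  apply: lee_wpmul2l => //; apply: leeD; first by rewrite fineK ?fin_num_measure.
  by apply: lee_wpmul2l; [rewrite lee_fin sqr_ge0|exact: sqn_df].
rewrite -[((D ^+ 2)%:E * _)%E]EFinM -[((t ^+ 2)%:E * _)%E]EFinM -EFinD -EFinM lee_fin !sqr_sqrtr; last 2 first.
- by rewrite divr_ge0 ?mulr_ge0 ?ltW.
- by rewrite divr_ge0 ?mulr_ge0 ?ltW.
have h1 : e / (4 * (m + 1)) * m <= e / 4.
  rewrite invfM mulrA -mulrA ler_piMr ?divr_ge0 ?(ltW e0)//.
  by rewrite mulrC ler_pdivrMr// mul1r lerDl.
have h2 : e / (16 * (M + 1)) * (4 * M) <= e / 4.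
  have -> : e / (16 * (M + 1)) * (4 * M) = e / 4 * ((M + 1)^-1 * M) by field; rewrite gt_eqF.
  rewrite ler_piMr ?divr_ge0 ?(ltW e0)//.
  by rewrite mulrC ler_pdivrMr// mul1r lerDl.
lra.
Qed.

End compactness.

(** * The kernel on the sphere and its binomial expansion *)

Lemma nondecreasing_even_sums (R : realType) (F : nat -> R) q : 0 < q -> (forall j, 0 <= F j) ->
  nondecreasing_seq (fun m => q * \sum_(0 <= j < 0 + m.*2) F j).
Proof.
move=> q0 F0; apply/nondecreasing_seqP => k; rewrite ler_pM2l// !add0n doubleS.
by rewrite !big_nat_recr//= -addrA lerDl addr_ge0.
Qed.

Section sphere_kernel.
Context {R : realType} (n : nat) (a : R).
Local Notation d := n.+1.
Local Notation S := (@surface_measure R n).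
Local Notation X := (sphere R n).
Hypothesis a_range : 1 - d%:R / 2 < a < 1 / 2.
Let b : R := d%:R / 2 + a - 1.

Let b0 : 0 < b. Proof. by case/andP: a_range; rewrite /b; lra. Qed.
Let bd : b + 1 / 2 < d%:R / 2. Proof. by case/andP: a_range; rewrite /b; lra. Qed.

Definition sdot2 (z : X * X) : R := sdot z.1 z.2.

Lemma measurable_sphere_coord (i : 'I_d) : measurable_fun setT (fun x : X => tnth x i).
Proof.
rewrite (_ : (fun x => _) = (fun t : d.-tuple R => tnth t i) \o @sphere_val R n)//.
by apply: measurableT_comp; [exact: measurable_tnth|exact: measurable_sphere_val].
Qed.

Lemma bmeasurable_sphere_coord (i : 'I_d) : bmeasurable (fun x : X => tnth x i).
Proof.
split; first exact: measurable_sphere_coord.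
by exists 1 => x; rewrite -[leRHS](enorm_sphere x); exact: le_tnth_enorm.
Qed.

Lemma separated_sdot2 : separated sdot2.
Proof.
by exists 'I_d, (fun i (x : X) => tnth x i), (fun i (x : X) => tnth x i); split => // i;
  exact: bmeasurable_sphere_coord.
Qed.

Lemma measurable_sdot2 : measurable_fun setT sdot2.
Proof. exact: measurable_separated separated_sdot2. Qed.

Lemma sdotC (x y : X) : sdot x y = sdot y x.
Proof. by apply: eq_bigr => i _; rewrite mulrC. Qed.

Lemma sqr_edist (x y : X) : Defs.edist y x ^+ 2 = 2 - 2 * sdot x y.
Proof.
rewrite /Defs.edist sqr_enorm.
transitivity (\sum_i (tnth y i ^+ 2 + tnth x i ^+ 2 - 2 * (tnth x i * tnth y i))).
  by apply: eq_bigr => i _; rewrite tnth_mktuple; ring.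
by rewrite sumrB big_split/= !sum_sqr_sphere -mulr_sumr.
Qed.

Lemma sdot_le1 (x y : X) : `|sdot x y| <= 1.
Proof.
have h1 := sqr_ge0 (Defs.edist y x); rewrite sqr_edist in h1.
have h2 : 0 <= \sum_i (tnth x i + tnth y i) ^+ 2 by apply: sumr_ge0 => i _; exact: sqr_ge0.
have h3 : \sum_i (tnth x i + tnth y i) ^+ 2 = 2 + 2 * sdot x y.
  transitivity (\sum_i (tnth x i ^+ 2 + tnth y i ^+ 2 + 2 * (tnth x i * tnth y i))).
    by apply: eq_bigr => i _; ring.
  by rewrite 2!big_split/= !sum_sqr_sphere -mulr_sumr.
by rewrite ler_norml; move: h2; rewrite h3; lra.
Qed.

(** The squared distance is 2 - 2 x.y. The identity includes the diagonal, where both sides are 0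
    because 0 to a nonzero power is 0 and so is its inverse. *)
Lemma TS_kernelE (x y : X) : TS_kernel a x y = 2 `^ (- b) * (1 - sdot x y) `^ (- b).
Proof.
rewrite /TS_kernel div1r -powRN.
have -> : - (d%:R + 2 * a - 2) = 2 * - b by rewrite /b; field.
rewrite powRrM powR_mulrn; last exact: sqrtr_ge0.
rewrite sqr_edist -powRM//; last first.
  by rewrite subr_ge0 (le_trans (ler_norm _))// sdot_le1.
by congr (_ `^ _); ring.
Qed.

Definition TS_kernel2 (z : X * X) : R := TS_kernel a z.1 z.2.

Lemma measurable_TS_kernel2 : measurable_fun setT TS_kernel2.
Proof.
rewrite (_ : TS_kernel2 = fun z => 2 `^ (- b) * (1 - sdot2 z) `^ (- b)).
  apply: measurable_funM => //.
  apply: measurableT_comp (measurable_powR (- b)) _.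
  by apply: measurable_funB => //; exact: measurable_sdot2.
by apply/funext => z; exact: TS_kernelE.
Qed.

Lemma TS_kernel2_ge0 z : 0 <= TS_kernel2 z.
Proof. by rewrite /TS_kernel2 /TS_kernel div1r invr_ge0 powR_ge0. Qed.

Lemma TS_kernel2C x y : TS_kernel2 (x, y) = TS_kernel2 (y, x).
Proof. by rewrite /TS_kernel2/= !TS_kernelE sdotC. Qed.

Definition TS_partial N (z : X * X) : R :=
  2 `^ (- b) * \sum_(0 <= j < N) bcoef b j * sdot2 z ^+ j.

(** Absolute values make it a nonnegative majorant fit for Schur's test; extended values allow the
    series to diverge where |x.y| = 1. *)
Definition TS_tail N (z : X * X) : \bar R :=
  ((2 `^ (- b))%:E * \sum_(N <= j <oo) (bcoef b j * `|sdot2 z| ^+ j)%:E)%E.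

Let term0 j z : (0 <= (bcoef b j * `|sdot2 z| ^+ j)%:E :> \bar R)%E.
Proof. by rewrite lee_fin mulr_ge0 ?exprn_ge0// ltW// bcoef_gt0. Qed.

(** Comparison with the harmonic series: [bcoef b j.+1] is [b / (j + 1)] times (b+1)_j / j!, which
    is at least 1. *)
Lemma dvg_bcoef : ~ cvgn (series (bcoef b)).
Proof.
move=> cb; apply: (@dvg_harmonic R).
have cb' : cvgn (series (fun j => b^-1 * bcoef b j.+1)).
  apply: (@is_cvg_seriesZ _ (fun j => bcoef b j.+1) b^-1).
  have : cvgn (fun m => series (bcoef b) m.+1 - bcoef b 0).
    apply: is_cvgB; last exact: is_cvg_cst.
    by apply/cvg_ex; exists (limn (series (bcoef b))); rewrite (cvg_shiftS (series (bcoef b))).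
  rewrite (_ : (fun m => _) = series (fun j => bcoef b j.+1))//.
  by apply/funext => m; rewrite /series/= big_nat_recl//= addrAC subrr add0r.
apply: series_le_cvg cb' => j; first by rewrite /harmonic/= invr_ge0.
  by rewrite mulr_ge0 ?invr_ge0 ?(ltW b0)// ltW// bcoef_gt0.
rewrite /harmonic/= /bcoef risingSl -!mulrA mulKf ?gt_eqF// factS natrM invfM mulrCA.
rewrite ler_peMr ?invr_ge0// ler_pdivlMr ?ltr0n ?fact_gt0// mul1r.
elim: j => [|j IH]; first by rewrite rising0.
rewrite risingS factS natrM mulrC ler_pM//.
by rewrite -[j.+1%:R]natr1 -addrA (addrC 1) lerDr ltW.
Qed.

(* On the diagonal [x.y = 1] the kernel has the junk value 0; the bound survives
   because there the tail of the binomial series diverges. *)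
Lemma TS_approx N z : (`|TS_kernel2 z - TS_partial N z|%:E <= TS_tail N z)%E.
Proof.
have p0 : 0 < 2 `^ (- b) :> R by rewrite powR_gt0.
have c0 := bcoef_gt0 _ b0.
rewrite /TS_kernel2 TS_kernelE /TS_partial -mulrBr normrM gtr0_norm// EFinM.
apply: lee_wpmul2l; first by rewrite lee_fin ltW.
have := sdot_le1 z.1 z.2; rewrite -/(sdot2 z) le_eqVlt => /predU1P[x1|x1].
  have -> : (\sum_(N <= j <oo) (bcoef b j * `|sdot2 z| ^+ j)%:E = +oo)%E; last exact: leey.
  apply/eqP; rewrite -leye_eq leNgt; apply/negP => lt.
  apply: dvg_bcoef.
  have t0 : (\sum_(0 <= j <oo) (bcoef b j)%:E < +oo :> \bar R)%E.
    rewrite (@nneseries_split _ _ 0 N)// ?add0n => [|j _]; last by rewrite lee_fin ltW.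
    rewrite lte_add_pinfty//; first by rewrite sumEFin ltry.
    apply: le_lt_trans lt; apply: lee_nneseries => [j _ _|j _]; first by rewrite lee_fin ltW.
    by rewrite x1 expr1n mulr1.
  apply: nondecreasing_is_cvgn.
    apply/nondecreasing_seqP => m; rewrite /series/= big_nat_recr//= lerDl ltW//.
  exists (fine (\sum_(0 <= j <oo) (bcoef b j)%:E)) => _ [m _ <-].
  rewrite -lee_fin fineK; last first.
    by rewrite ge0_fin_numE// nneseries_ge0// => j _ _; rewrite lee_fin ltW.
  rewrite /series/= -sumEFin; apply: nneseries_lim_ge => j _ _.
  by rewrite lee_fin ltW.
rewrite -/(sdot2 z) -(bserE b0 x1).
have := is_cvg_bcoef b0 x1; rewrite -/(bser _ _) => cb.
have h : `|pseries (bcoef b) (sdot2 z) m - \sum_(0 <= j < N) bcoef b j * sdot2 z ^+ j| @[m --> \oo]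
    --> `|bser b (sdot2 z) - \sum_(0 <= j < N) bcoef b j * sdot2 z ^+ j|.
  by apply: cvg_norm; apply: cvgB => //; exact: cvg_cst.
have {}h : (`|pseries (bcoef b) (sdot2 z) m - \sum_(0 <= j < N) bcoef b j * sdot2 z ^+ j|%:E @[m --> \oo]
    --> `|bser b (sdot2 z) - \sum_(0 <= j < N) bcoef b j * sdot2 z ^+ j|%:E)%E.
  by apply/fine_cvgP; split => //; exact: nearW.
rewrite -(cvg_lim _ h)//; apply: lime_le; first by apply/cvg_ex; eexists; exact: h.
exists N => // m /= Nm.
rewrite /pseries /series/= (big_cat_nat (n := N))//= addrAC subrr add0r.
apply: (@le_trans _ _ (\sum_(N <= j < m) (bcoef b j * `|sdot2 z| ^+ j)%:E)%E).
  rewrite sumEFin lee_fin (le_trans (ler_norm_sum _ _ _))// ler_sum// => j _.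
  by rewrite normrM normrX gtr0_norm.
exact: nneseries_lim_ge.
Qed.

Let term_meas j : measurable_fun setT (fun z : X * X => (bcoef b j * `|sdot2 z| ^+ j)%:E).
Proof.
apply/measurable_EFinP; apply: measurable_funM => //; apply: measurable_funX.
by apply: measurableT_comp => //; exact: measurable_sdot2.
Qed.

Lemma measurable_TS_tail N : measurable_fun setT (TS_tail N).
Proof.
apply: measurable_funeM.
rewrite (_ : (fun z => _) = (fun z => \sum_(0 <= j <oo) (bcoef b (j + N) * `|sdot2 z| ^+ (j + N))%:E)%E).
  apply: ge0_emeasurable_sum => [j z _ _|j _]; [exact: term0|exact: term_meas].
by apply/funext => z; rewrite (@nneseries_addn R _ N (term0^~ z)).
Qed.

Lemma TS_tail_ge0 N z : (0 <= TS_tail N z)%E.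
Proof.
by apply: mule_ge0; [rewrite lee_fin powR_ge0|apply: nneseries_ge0 => j _ _; exact: term0].
Qed.

Lemma TS_tailC N x y : TS_tail N (x, y) = TS_tail N (y, x).
Proof. by rewrite /TS_tail /sdot2/= sdotC. Qed.

Lemma separated_TS_partial N : separated (TS_partial N).
Proof.
apply: separatedM; first exact: separated_cst.
apply: separated_sum => j; apply: separatedM; first exact: separated_cst.
exact: separatedX separated_sdot2.
Qed.

(** The formula for harmonics applied to the constant polynomial 1, of degree 0. *)
Let sdotX_moment (x : X) j : S.-integrable setT (fun y => (sdot x y ^+ j)%:E) /\
  \int[S]_y (sdot x y ^+ j) = sharm n j 0.
Proof.
have h1 : solid_harmonic 0 (1 : mpoly d R[i]).
  by split; [exact: dhomog1|apply: big1 => i _; rewrite !mderivC].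
have E (t : X) : sphere_restr (1 : mpoly d R[i]) t = 1 by rewrite /sphere_restr meval1.
have [[ire _] /(congr1 (@complex.Re R))] := cintegral_dot_harmonic x j h1.
rewrite E mulr1 /= /sharm => <-; split.
  by apply: eq_integrable ire => // y _ /=; rewrite E mulr1.
by congr (fine _); apply: eq_integral => y _; rewrite E mulr1.
Qed.

Lemma integrable_sdotX (x : X) j : S.-integrable setT (fun y => (sdot x y ^+ j)%:E).
Proof. by case: (sdotX_moment x j). Qed.

Lemma integral_sdotX (x : X) j : \int[S]_y (sdot x y ^+ j) = sharm n j 0.
Proof. by case: (sdotX_moment x j). Qed.

(** The moment of the largest even power not exceeding [j]. Since |x.y| <= 1 it bounds the integral
    of |x.y|^j, which for odd [j] is not the integral of a polynomial. *)
Definition sbeta j : R := sharm n (j./2).*2 0.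

Lemma integral_norm_sdotX (x : X) j : (\int[S]_y (`|sdot x y| ^+ j)%:E <= (sbeta j)%:E)%E.
Proof.
have mx k : measurable_fun setT (fun y : X => sdot x y ^+ k).
  by apply/measurable_EFinP; exact: measurable_int (integrable_sdotX x k).
have nx : measurable_fun setT (fun y : X => (`|sdot x y| ^+ j)%:E).
  rewrite (_ : (fun y => _) = (fun y => `|sdot x y ^+ j|%:E)).
    by apply/measurable_EFinP; exact: measurableT_comp.
  by apply/funext => y; rewrite normrX.
rewrite /sbeta -(integral_sdotX x) /Rintegral fineK; last first.
  by apply: integrable_fin_num => //; exact: integrable_sdotX.
apply: ge0_le_integral => //; first by apply/measurable_EFinP.
move=> y _; rewrite lee_fin -mul2n exprM -(real_normK (num_real (sdot x y))) -exprM mul2n.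
by rewrite ler_wiXn2l ?sdot_le1// -[leqRHS]odd_double_half leq_addl.
Qed.

Let tb0 j : 0 <= bcoef b j * sbeta j.
Proof. by rewrite mulr_ge0 ?sharm_ge0// ltW// bcoef_gt0. Qed.

Local Opaque sharm.

(** The even terms are summable by [cvg_sum_bcoef_sharm] in degree 0. Each odd term is at most
    [max b 1] times the even term before it, whence the factor [C]. *)
Lemma sum_bcoef_sbeta : (\sum_(j <oo) (bcoef b j * sbeta j)%:E < +oo :> \bar R)%E.
Proof.
pose C := 1 + Num.max b 1.
have C0 : 0 <= C by rewrite addr_ge0// le_max ler01 orbT.
have := @cvg_sum_bcoef_sharm R n a a_range 0%N; rewrite -/b.
set l := (X in _ --> X) => hl.
have hc : cvgn (fun m => 2 `^ (- b) / 2 * \sum_(0 <= j < 0 + m.*2) bcoef b j * sharm n j 0).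
  by apply/cvg_ex; exists l.
pose q := 2 `^ (- b) / 2 : R.
have q0 : 0 < q by rewrite divr_gt0 ?powR_gt0.
have t0 j : 0 <= bcoef b j * sharm n j 0.
  by rewrite mulr_ge0 ?sharm_ge0// ltW// bcoef_gt0.
have bound m : \sum_(0 <= j < m.*2) bcoef b j * sharm n j 0 <= l / q.
  rewrite ler_pdivlMr// mulrC -(cvg_lim _ hl)//.
  apply: (@nondecreasing_cvgn_le _ (fun m => q * \sum_(0 <= j < 0 + m.*2) bcoef b j * sharm n j 0)) => //.
  exact: nondecreasing_even_sums.
apply: (@le_lt_trans _ _ (C * (l / q))%:E); last exact: ltry.
apply: lime_le; first by apply: is_cvg_nneseries => j _ _; rewrite lee_fin.
apply: nearW => m; rewrite sumEFin lee_fin.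
have -> : \sum_(0 <= j < m) bcoef b j * sbeta j <= C * (l / q); last by [].
apply: (@le_trans _ _ (\sum_(0 <= j < m.*2) bcoef b j * sbeta j)).
  by rewrite (@big_cat_nat _ _ _ m 0 m.*2)//= ?lerDl ?sumr_ge0// -addnn leq_addr.
apply: (@le_trans _ _ (C * \sum_(0 <= j < m.*2) bcoef b j * sharm n j 0)); last first.
  by rewrite ler_wpM2l.
clear hl hc bound.
elim: m => [|m IH]; first by rewrite double0 !big_nil mulr0.
rewrite doubleS !big_nat_recr//= -!addrA mulrDr; apply: lerD; first exact: IH.
have e1 : m.*2.+1./2 = m by rewrite /= uphalf_double.
rewrite /sbeta e1 doubleK.
have h : (b + m.*2%:R) / m.*2.+1%:R <= Num.max b 1.
  rewrite ler_pdivrMr// -[m.*2.+1%:R]natr1 mulrDr mulr1 addrC lerD//.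
    by rewrite -[leLHS]mul1r ler_wpM2r// le_max lexx orbT.
  by rewrite le_max lexx.
have hB : bcoef b m.*2.+1 * sharm n m.*2 0 <= Num.max b 1 * (bcoef b m.*2 * sharm n m.*2 0).
  by rewrite bcoefS mulrAC mulrC; apply: ler_wpM2r; [exact: t0|exact: h].
have alg (x y z u : R) : 0 <= x -> 0 <= z -> y <= u * x -> 0 <= 1 + u -> x + y <= (1 + u) * (x + z).
  by move=> _ z0 yu u0; have := mulr_ge0 u0 z0; lra.
exact: alg (t0 _) (t0 _) hB C0.
Qed.

Definition TS_tau N : \bar R := \sum_(N <= j <oo) (bcoef b j * sbeta j)%:E.

Lemma cvg_TS_tau : TS_tau N @[N --> \oo] --> 0%E.
Proof.
by apply: nneseries_tail_cvg => [|j _]; [exact: sum_bcoef_sbeta|rewrite lee_fin].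
Qed.

Lemma integral_TS_tail N x : (\int[S]_y TS_tail N (x, y) <= (2 `^ (- b))%:E * TS_tau N)%E.
Proof.
have mt j : measurable_fun setT (fun y : X => (bcoef b j * `|sdot2 (x, y)| ^+ j)%:E).
  exact: measurableT_comp (term_meas j) (pair1_measurable x).
have E y : TS_tail N (x, y) =
    ((2 `^ (- b))%:E * \sum_(0 <= j <oo) (bcoef b (j + N) * `|sdot2 (x, y)| ^+ (j + N))%:E)%E.
  by rewrite (@nneseries_addn R _ N (term0^~ (x, y))).
under eq_integral do rewrite E.
rewrite ge0_integralZl//; last 2 first.
- by apply: ge0_emeasurable_sum => [j y _ _|j _]; [exact: term0|exact: mt].
- by move=> y _; apply: nneseries_ge0 => j _ _; exact: term0.
apply: lee_wpmul2l; first by rewrite lee_fin powR_ge0.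
rewrite integral_nneseries//.
have tbE j : (0 <= (bcoef b j * sbeta j)%:E :> \bar R)%E by rewrite lee_fin.
rewrite /TS_tau -(@nneseries_addn R _ N tbE).
apply: lee_nneseries => [j _ _|i _].
  by apply: integral_ge0 => y _; exact: term0.
move: (i + N)%N => j.
under eq_integral do rewrite EFinM.
rewrite ge0_integralZl//; last 2 first.
- apply/measurable_EFinP; apply: measurable_funX; apply: measurableT_comp => //.
  exact: measurableT_comp measurable_sdot2 (pair1_measurable x).
- by rewrite lee_fin ltW// bcoef_gt0.
rewrite [leRHS]EFinM; apply: lee_wpmul2l; first by rewrite lee_fin ltW// bcoef_gt0.
exact: integral_norm_sdotX.
Qed.

Lemma TS_tau_fin N : TS_tau N \is a fin_num.
Proof.
rewrite ge0_fin_numE; last by apply: nneseries_ge0 => j _ _; rewrite lee_fin.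
apply: le_lt_trans sum_bcoef_sbeta.
rewrite [leRHS](@nneseries_split _ _ 0 N) => [|j _]; last by rewrite lee_fin.
by rewrite add0n leeDr// sume_ge0// => j _; rewrite lee_fin.
Qed.

Lemma TS_tau_small t : 0 < t -> exists N, (TS_tau N <= t%:E)%E.
Proof.
move=> t0; have /fine_cvgP[_ /cvgrPdist_le/(_ _ t0)] := cvg_TS_tau.
move=> [N _ /(_ N (leqnn N))] /= h; exists N.
rewrite -(fineK (TS_tau_fin N)) lee_fin (le_trans (ler_norm _))//.
by move: h; rewrite sub0r normrN.
Qed.

End sphere_kernel.

(** * Complex L^2 norms through real and imaginary parts *)

Section L2_norm.
Context d (T : measurableType d) (R : realType).
Variable mu : {finite_measure set T -> \bar R}.
Implicit Types f g : T -> R[i].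

Definition csqn f : \bar R :=
  (sqn mu (fun x => complex.Re (f x)) + sqn mu (fun x => complex.Im (f x)))%E.

Lemma csqn_ge0 f : (0 <= csqn f)%E.
Proof. by rewrite adde_ge0// sqn_ge0. Qed.

Lemma L2normE f : cmeasurable f -> L2norm mu f = (csqn f `^ 2^-1)%E.
Proof.
move=> [mr mi]; rewrite /L2norm /csqn.
have -> : (sqn mu (fun x => complex.Re (f x)) + sqn mu (fun x => complex.Im (f x)))%E =
    ('N[mu]_2%:E [EFin \o (fun x => ComplexField.Normc.normc (f x))] `^ 2)%E.
  rewrite poweR_Lnorm// /sqn -ge0_integralD//; last 4 first.
  - by move=> x _; rewrite lee_fin sqr_ge0.
  - exact: measurable_sqr.
  - by move=> x _; rewrite lee_fin sqr_ge0.
  - exact: measurable_sqr.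
  apply: eq_integral => x _.
  rewrite -EFinD -[RHS]/(`|ComplexField.Normc.normc (f x)|%:E `^ 2)%E poweR_EFin; congr EFin.
  rewrite powR_mulrn// /ComplexField.Normc.normc; case: (f x) => u v /=.
  by rewrite ger0_norm ?sqrtr_ge0// sqr_sqrtr// addr_ge0// sqr_ge0.
by rewrite -poweRrM mulfV// poweRe1// Lnorm_ge0.
Qed.

Lemma sqrL2norm f : cmeasurable f -> (L2norm mu f `^ 2 = csqn f)%E.
Proof. by move=> mf; rewrite L2normE// -poweRrM mulVf// poweRe1// csqn_ge0. Qed.

Lemma le_L2norm f (M : R) : 0 <= M -> cmeasurable f ->
  (L2norm mu f <= M%:E)%E <-> (csqn f <= (M ^+ 2)%:E)%E.
Proof.
move=> M0 mf; split => h.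
- have -> : (M ^+ 2)%:E = (M%:E `^ 2)%E by rewrite poweR_EFin powR_mulrn.
  rewrite -sqrL2norm//; apply: gt0_ler_poweR => //.
    by rewrite in_itv/= Lnorm_ge0 leey.
  by rewrite in_itv/= lee_fin M0 leey.
- rewrite L2normE//.
  have -> : M%:E = ((M ^+ 2)%:E `^ 2^-1)%E.
    by rewrite poweR_EFin -powR_mulrn// -powRrM mulfV// powRr1.
  apply: gt0_ler_poweR => //; first by rewrite in_itv/= csqn_ge0 leey.
  by rewrite in_itv/= lee_fin sqr_ge0 leey.
Qed.

Lemma L2P f : L2 mu f <-> cmeasurable f /\
  (sqn mu (fun x => complex.Re (f x)) < +oo)%E /\ (sqn mu (fun x => complex.Im (f x)) < +oo)%E.
Proof.
split=> -[mf].
- rewrite L2normE// => h; split=> //.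
  have : (csqn f < +oo)%E.
    by rewrite ltey; apply: contraTN h => /eqP ->; rewrite poweRyr.
  move=> h'; split; apply: le_lt_trans h'.
    by rewrite leeDl// sqn_ge0.
  by rewrite leeDr// sqn_ge0.
- move=> [hr hi]; split => //.
  have hc : (csqn f < +oo)%E by rewrite lte_add_pinfty.
  have cf : csqn f \is a fin_num by rewrite ge0_fin_numE// csqn_ge0.
  by rewrite L2normE// -(fineK cf) poweR_EFin ltry.
Qed.

Lemma sqn_ae_eq (f g : T -> R) : measurable_fun setT f -> measurable_fun setT g ->
  (\forall x \ae mu, f x = g x) -> sqn mu f = sqn mu g.
Proof.
move=> mf mg fg; apply: ae_eq_integral => //; [exact: measurable_sqr|exact: measurable_sqr|].
by apply: filterS fg => x /= ->.
Qed.

End L2_norm.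

(** * Eigenfunctions of the kernel *)

Section sphere_operator.
Context {R : realType} (n : nat) (a : R).
Local Notation d := n.+1.
Local Notation S := (@surface_measure R n).
Local Notation X := (sphere R n).
Hypothesis a_range : 1 - d%:R / 2 < a < 1 / 2.
Let b : R := d%:R / 2 + a - 1.
Local Notation K := (@TS_kernel2 R n a).
Local Opaque sharm TS_lambda.

Let b0 : 0 < b. Proof. by case/andP: a_range; rewrite /b; lra. Qed.
Let p0 : 0 < 2 `^ (- b) :> R. Proof. by rewrite powR_gt0. Qed.

Let schur_tail (h : X -> R) C N x : measurable_fun setT h -> (forall y, `|h y| <= C) ->
  (schur_int S (TS_tail a N) h x <= C%:E * ((2 `^ (- b))%:E * TS_tau n a N))%E.
Proof.
move=> mh hC; have C0 : 0 <= C by apply: le_trans (hC x).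
apply: le_trans (lee_wpmul2l _ (integral_TS_tail a_range N x)); last by rewrite lee_fin.
have mt : measurable_fun setT (fun y => TS_tail a N (x, y)).
  exact: measurableT_comp (measurable_TS_tail a_range N) (pair1_measurable x).
rewrite -ge0_integralZl//; last by move=> y _; exact: TS_tail_ge0.
apply: ge0_le_integral => //.
- by move=> y _; apply: mule_ge0 => //; exact: TS_tail_ge0.
- by apply: emeasurable_funM => //; apply/measurable_EFinP; exact: measurableT_comp.
- exact: measurable_funeM.
- by move=> y _; rewrite muleC; apply: lee_wpmul2r; [exact: TS_tail_ge0|rewrite lee_fin].
Qed.

Section eigenfunction.
Variables (h : X -> R) (k : nat).
Hypothesis bh : bmeasurable h.
(** Only integrals against powers of x.y are prescribed, so that the real and imaginary parts of a
    harmonic and the constant 1 are all covered. *)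
Hypothesis ih : forall x j, S.-integrable setT (fun y => (sdot x y ^+ j * h y)%:E).
Hypothesis Eh : forall x j, \int[S]_y (sdot x y ^+ j * h y) = sharm n j k * h x.

Let partial_rop N x : S.-integrable setT (fun y => (TS_partial a N (x, y) * h y)%:E) /\
  rop S (TS_partial a N) h x = 2 `^ (- b) * (\sum_(0 <= j < N) bcoef b j * sharm n j k) * h x.
Proof.
elim: N => [|N [iN eN]].
  have E y : TS_partial a 0 (x, y) * h y = 0 by rewrite /TS_partial big_geq// mulr0 mul0r.
  split; first by under eq_fun do rewrite E; exact: integrable0.
  by rewrite big_geq// mulr0 mul0r /rop; under eq_Rintegral do rewrite E; rewrite Rintegral_cst// mul0r.
have E : (fun y => TS_partial a N.+1 (x, y) * h y) =
    (fun y => TS_partial a N (x, y) * h y + (2 `^ (- b) * bcoef b N) * (sdot x y ^+ N * h y)).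
  by apply/funext => y; rewrite /TS_partial big_nat_recr//= -/b /sdot2/=; ring.
have iT : S.-integrable setT (EFin \o (fun y => (2 `^ (- b) * bcoef b N) * (sdot x y ^+ N * h y))).
  by apply: (@eq_integrable _ _ _ _ _ measurableT (fun y => ((2 `^ (- b) * bcoef b N)%:E * (sdot x y ^+ N * h y)%:E)%E)) => //; exact: integrableZl.
split.
  rewrite (_ : (fun y => _) = (fun y => ((TS_partial a N (x, y) * h y)%:E +
      ((2 `^ (- b) * bcoef b N) * (sdot x y ^+ N * h y))%:E)%E)); first exact: integrableD.
  by apply/funext => y; rewrite (congr1 (@^~ y) E).
rewrite /rop E RintegralD// -/(rop _ _ _ _) eN.
rewrite (@RintegralZl _ _ _ S setT (fun y => sdot x y ^+ N * h y) _ measurableT (ih x N)).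
by rewrite Eh big_nat_recr//=; ring.
Qed.

(** The equation holds at every point: as [h] is bounded, the tail acts on it with size at most
    [C * 2^-b * TS_tau N], which tends to 0. The limit is identified along [N = k + 2 * m], where
    the partial sums are known. *)
Lemma TS_eigenfunction x : S.-integrable setT (fun y => (K (x, y) * h y)%:E) /\
  rop S K h x = 2 * TS_lambda n a k * h x.
Proof.
have [mh [C hC]] := bh; have C0 : 0 <= C by apply: le_trans (hC x).
have sf N : schur_int S (TS_tail a N) h x \is a fin_num.
  rewrite ge0_fin_numE; last by apply: schur_int_ge0 => z; exact: TS_tail_ge0.
  by apply: le_lt_trans (schur_tail N x mh hC) _; rewrite ltey_eq !fin_numM// TS_tau_fin.
have ap N := rop_approx (measurable_TS_tail a_range N)
  (@measurable_TS_kernel2 R n a) (measurable_separated (separated_TS_partial n a N)) mh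
  (TS_approx a_range N) (sf N) (partial_rop N x).1.
split; first exact: (ap 0%N).1.
have c1 : rop S (TS_partial a N) h x @[N --> \oo] --> rop S K h x.
  (* The case [C = 0] is set apart because [e] is divided by [C] below. *)
  have [C00|C00] := eqVneq C 0.
    have h0 y : h y = 0 by apply/eqP; rewrite -normr_le0 -C00.
    have z P : rop S P h x = 0.
      by rewrite /rop; under eq_Rintegral do rewrite h0 mulr0; rewrite Rintegral_cst// mul0r.
    by rewrite z; under eq_fun do rewrite z; exact: cvg_cst.
  have Cp : 0 < C by rewrite lt_neqAle eq_sym C00.
  apply/cvgrPdist_le => e e0.
  have e1 : 0 < e / (C * 2 `^ (- b)) by rewrite divr_gt0// mulr_gt0.
  have /fine_cvgP[_ /cvgrPdist_le/(_ _ e1)] := cvg_TS_tau a_range.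
  move=> [N0 _ HN]; exists N0 => // N /= /HN/=; rewrite sub0r normrN.
  move=> /(le_trans (ler_norm _)) tN.
  rewrite -lee_fin; apply: le_trans (ap N).2 _.
  apply: le_trans (schur_tail N x mh hC) _.
  rewrite -(fineK (TS_tau_fin a_range N)) -!EFinM lee_fin mulrA.
  by rewrite mulrC -ler_pdivlMr// mulr_gt0.
have c2 := @cvg_sum_bcoef_sharm R n a a_range k; rewrite -(TS_lambdaE a_range) in c2.
have c3 : 2 `^ (- b) / 2 * (\sum_(0 <= j < k + m.*2) bcoef b j * sharm n j k) * (2 * h x) @[m --> \oo] -->
    TS_lambda n a k * (2 * h x) by apply: cvgMr_tmp; exact: c2.
have c4 : rop S (TS_partial a (k + m.*2)) h x @[m --> \oo] --> rop S K h x.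
  apply: (cvg_comp _ _ _ c1) => A [N _ HN]; exists N => // m /= Nm; apply: HN => /=.
  by rewrite (leq_trans Nm)// (leq_trans _ (leq_addl _ _))// -addnn leq_addr.
have -> : 2 * TS_lambda n a k * h x = TS_lambda n a k * (2 * h x) by ring.
apply: (cvg_unique _ c4 _) => //.
rewrite (_ : (fun m => rop _ _ _ _) = (fun m => 2 `^ (- b) / 2 *
  (\sum_(0 <= j < k + m.*2) bcoef b j * sharm n j k) * (2 * h x))); first exact: c3.
by apply/funext => m; rewrite (partial_rop _ _).2; field.
Qed.

End eigenfunction.

(** The eigenvalue equation of the constant 1, evaluated at [x]. *)
Lemma integral_TS_kernel x : (\int[S]_y (K (x, y))%:E = (2 * TS_lambda n a 0)%:E)%E.
Proof.
have b1 : bmeasurable (cst 1 : X -> R) by exact: bmeasurable_cst.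
have i1 y j : S.-integrable setT (fun z => (sdot y z ^+ j * cst 1 z)%:E).
  by under eq_fun do rewrite mulr1; exact: integrable_sdotX.
have E1 y j : \int[S]_z (sdot y z ^+ j * cst 1 z) = sharm n j 0 * cst 1 y.
  by under eq_Rintegral do rewrite mulr1; rewrite integral_sdotX mulr1.
have [iK] := TS_eigenfunction b1 i1 E1 x.
rewrite /rop mulr1 => <-; rewrite /Rintegral; under [in RHS]eq_integral do rewrite mulr1.
rewrite fineK//; apply: integrable_fin_num => //.
by move: iK; under eq_fun do rewrite mulr1.
Qed.

End sphere_operator.

(** * Linearity, spectrum, norm and compactness of the operator *)

Section sphere_spectrum.
Context {R : realType} (n : nat) (a : R).
Local Notation d := n.+1.
Local Notation S := (@surface_measure R n).
Local Notation X := (sphere R n).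
Hypothesis a_range : 1 - d%:R / 2 < a < 1 / 2.
Local Notation K := (@TS_kernel2 R n a).
Local Notation T := (@TS R n a).
Local Notation lambda := (TS_lambda n a).
Local Opaque TS_lambda.

Let q (z : X * X) : \bar R := (K z)%:E.
Let t : R := 2 * lambda 0.

Let mK : measurable_fun setT K. Proof. exact: measurable_TS_kernel2. Qed.
Let mq : measurable_fun setT q. Proof. by apply/measurable_EFinP. Qed.
Let q0 z : (0 <= q z)%E. Proof. by rewrite lee_fin TS_kernel2_ge0. Qed.
Let t0 : 0 < t. Proof. by rewrite mulr_gt0// TS_lambda_gt0. Qed.
Let qsym x y : q (x, y) = q (y, x). Proof. by rewrite /q TS_kernel2C. Qed.
Let qt x : (\int[S]_y q (x, y) <= t%:E)%E. Proof. by rewrite /q integral_TS_kernel. Qed.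
Let Kq z : (`|K z|%:E <= q z)%E. Proof. by rewrite ger0_norm// TS_kernel2_ge0. Qed.

Definition TSr (h : X -> R) x : R := 2^-1 * rop S K h x.

(** The kernel is real, so the two parts of a function do not interact; as [csqn] adds their squared
    norms, estimates reduce to real functions. *)
Lemma TS_ReIm f : T f = (fun x => TSr (fun y => complex.Re (f y)) x +i* TSr (fun y => complex.Im (f y)) x).
Proof.
have E (r : R) (z : R[i]) : r%:C * z = (r * complex.Re z) +i* (r * complex.Im z).
  by case: z => u v; apply/eqP; rewrite eq_complex/= !mul0r subr0 addr0 !eqxx.
apply/funext => x; rewrite /TS E div1r /TSr /rop /cintegral /=.
by congr (_ * _ +i* (_ * _)); congr (fine _); apply: eq_integral => y _; rewrite E.
Qed.

Lemma measurable_TSr h : measurable_fun setT h -> measurable_fun setT (TSr h).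
Proof. by move=> mh; apply: measurable_funM => //; exact: measurable_rop. Qed.

Lemma sqn_TSr h : measurable_fun setT h -> (sqn S h < +oo)%E ->
  (sqn S (TSr h) <= (lambda 0 ^+ 2)%:E * sqn S h)%E.
Proof.
move=> mh hoo; have mr : measurable_fun setT (rop S K h) by exact: measurable_rop.
rewrite /TSr sqnZ//.
apply: (@le_trans _ _ ((2^-1 ^+ 2)%:E * ((t ^+ 2)%:E * sqn S h))%E).
  apply: lee_wpmul2l; first by rewrite lee_fin sqr_ge0.
  exact: (sqn_rop mq q0 t0 qsym qt mK Kq mh hoo).
by rewrite muleA -EFinM -exprMn /t mulKf.
Qed.

Lemma cmeasurable_TS f : cmeasurable f -> cmeasurable (T f).
Proof. by move=> [mr mi]; rewrite TS_ReIm; split; exact: measurable_TSr. Qed.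

Lemma csqn_TS f : L2 S f -> (csqn S (T f) <= (lambda 0 ^+ 2)%:E * csqn S f)%E.
Proof.
move=> /L2P[[mr mi] [hr hi]]; rewrite TS_ReIm /csqn ge0_muleDr ?sqn_ge0//.
by apply: leeD; exact: sqn_TSr.
Qed.

Lemma TS_cintegrable f : L2 S f -> \forall omega \ae S,
  cintegrable S (fun theta => (TS_kernel a omega theta)%:C * f theta).
Proof.
move=> /L2P[[mr mi] [hr hi]].
apply: filterS2 (schur_ae mq q0 t0 qsym qt mr hr) (schur_ae mq q0 t0 qsym qt mi hi) => x fr fi.
split.
- apply: eq_integrable (rop_schur mq mK mr Kq fr).1 => // y _ /=.
  by case: (f y) => ? ?; rewrite /= mul0r subr0.
- apply: eq_integrable (rop_schur mq mK mi Kq fi).1 => // y _ /=.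
  by case: (f y) => ? ?; rewrite /= mul0r addr0.
Qed.

Let rop_comb (u v : R) f g : measurable_fun setT f -> measurable_fun setT g ->
  (sqn S f < +oo)%E -> (sqn S g < +oo)%E ->
  \forall x \ae S, TSr (fun y => u * f y + v * g y) x = u * TSr f x + v * TSr g x.
Proof.
move=> mf mg foo goo.
have voo : (sqn S (fun y => v * g y)%R < +oo)%E.
  by rewrite sqnZ// ltey_eq fin_numM// ge0_fin_numE// sqn_ge0.
have mvg : measurable_fun setT (fun y => v * g y) by exact: measurable_funM.
have m0 : measurable_fun setT (cst 0 : X -> R) by [].
have s0 : (sqn S (cst 0 : X -> R)%R < +oo)%E.
  by rewrite sqn_cst expr0n mul0e ltry.
apply: filterS2 (rop_linear_ae mq q0 t0 qsym qt u mK Kq mf mvg foo voo)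
  (rop_linear_ae mq q0 t0 qsym qt v mK Kq mg m0 goo s0) => x.
have -> : rop S K (cst 0) x = 0.
  by rewrite /rop; under eq_Rintegral do rewrite mulr0; rewrite Rintegral_cst// mul0r.
have -> : (fun y => v * g y + cst 0 y) = (fun y => v * g y).
  by apply/funext => y; rewrite addr0.
by rewrite /TSr => -> ->; ring.
Qed.

Lemma TS_linear : L2_linear S T.
Proof.
split.
- move=> f Lf; have [mf [hr hi]] := (L2P _ _).1 Lf.
  have mT := cmeasurable_TS mf; apply/L2P; split => //.
  have : (csqn S (T f) < +oo)%E.
    apply: le_lt_trans (csqn_TS Lf) _; rewrite ltey_eq fin_numM// /csqn fin_numD.
    by rewrite !ge0_fin_numE ?sqn_ge0// hr hi.
  by move=> h; split; apply: le_lt_trans h; rewrite /csqn ?leeDl ?leeDr// sqn_ge0.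
- move=> f g /L2P[[mfr mfi] _] /L2P[[mgr mgi] _] fg; rewrite !TS_ReIm.
  apply: nearW => x _; rewrite /TSr.
  congr (_ * _ +i* (_ * _)).
  + by congr (_ x); apply: rop_ae_eq => //; apply: filterS fg => y /= h _; rewrite h.
  + by congr (_ x); apply: rop_ae_eq => //; apply: filterS fg => y /= h _; rewrite h.
- move=> [u v] f g /L2P[[mfr mfi] [fr fi]] /L2P[[mgr mgi] [gr gi]].
  rewrite !TS_ReIm.
  have mlin (r s : R) (h k : X -> R) : measurable_fun setT h -> measurable_fun setT k ->
      measurable_fun setT (fun y => r * h y + s * k y).
    by move=> mh mk; apply: measurable_funD; exact: measurable_funM.
  have slin (r s : R) (h k : X -> R) : measurable_fun setT h -> measurable_fun setT k ->
      (sqn S h < +oo)%E -> (sqn S k < +oo)%E -> (sqn S (fun y => r * h y + s * k y)%R < +oo)%E.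
    move=> mh mk hh hk.
    apply: le_lt_trans (sqnD S (measurable_funM (measurable_cst r) mh) (measurable_funM (measurable_cst s) mk)) _.
    rewrite ltey_eq fin_numM// fin_numD !sqnZ// !fin_numM//.
      by rewrite ge0_fin_numE// sqn_ge0.
    by rewrite ge0_fin_numE// sqn_ge0.
  (* A complex scalar mixes the two parts: [A1] and [A2] treat the product with [f], [B1] and [B2]
     the addition of [g]. *)
  have A1 := rop_comb u (- v) mfr mfi fr fi.
  have A2 := rop_comb v u mfr mfi fr fi.
  have B1 := rop_comb 1 1 (mlin u (- v) _ _ mfr mfi) mgr (slin u (- v) _ _ mfr mfi fr fi) gr.
  have B2 := rop_comb 1 1 (mlin v u _ _ mfr mfi) mgi (slin v u _ _ mfr mfi fr fi) gi.
  have E1 : (fun y => complex.Re ((u +i* v) * f y + g y)) =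
      (fun y => 1 * (u * complex.Re (f y) + - v * complex.Im (f y)) + 1 * complex.Re (g y)).
    by apply/funext => y; case: (f y) (g y) => [? ?] [? ?] /=; rewrite !mul1r mulNr.
  have E2 : (fun y => complex.Im ((u +i* v) * f y + g y)) =
      (fun y => 1 * (v * complex.Re (f y) + u * complex.Im (f y)) + 1 * complex.Im (g y)).
    by apply/funext => y; case: (f y) (g y) => [? ?] [? ?] /=; rewrite !mul1r addrC [in RHS]addrC (addrC (u * _)).
  rewrite E1 E2.
  apply: filterS2 (filterI A1 A2) (filterI B1 B2) => x [a1 a2] [b1 b2] _.
  rewrite b1 b2 a1 a2; apply/eqP; rewrite eq_complex/= !mul1r mulNr eqxx/=.
  by apply/eqP; rewrite addrC [in RHS]addrC (addrC (u * _)).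
Qed.

Let sdotX_Re (x y : X) j (z : R[i]) : complex.Re ((sdot x y ^+ j)%:C * z) = sdot x y ^+ j * complex.Re z.
Proof. by case: z => u v; rewrite /= mul0r subr0. Qed.

Let sdotX_Im (x y : X) j (z : R[i]) : complex.Im ((sdot x y ^+ j)%:C * z) = sdot x y ^+ j * complex.Im z.
Proof. by case: z => u v; rewrite /= mul0r addr0. Qed.

Lemma bmeasurable_sphere_restr (p : mpoly d R[i]) :
  bmeasurable (fun x : X => complex.Re (sphere_restr p x)) /\
  bmeasurable (fun x : X => complex.Im (sphere_restr p x)).
Proof.
have [ir ii] := cintegrable_sphere_restr p.
have [C hC] : exists C, forall x : X, `|complex.Re (sphere_restr p x)| <= C /\
    `|complex.Im (sphere_restr p x)| <= C.
  rewrite sphere_restr_tmono; elim: (msupp p) => [|m s [C hC]].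
    by exists 0 => x; rewrite big_nil /= normr0.
  have c0 : 0 <= C by apply: le_trans (hC (pole R n)).1.
  exists (`|complex.Re (mcoeff m p)| + `|complex.Im (mcoeff m p)| + C) => x.
  rewrite big_cons; have [h1 h2] := hC x.
  have tm := tmono_le1 (fun i => m i) x.
  move: h1 h2; case: (\sum_(_ <- _) _) => u v /=; case: (mcoeff m p) => c e /= uC vC.
  rewrite !mulr0 subr0 add0r; split.
  - apply: le_trans (ler_normD _ _) _; apply: lerD => //; rewrite normrM.
    by apply: le_trans (ler_piMr _ tm) _ => //; rewrite lerDl.
  - apply: le_trans (ler_normD _ _) _; apply: lerD => //; rewrite normrM.
    by apply: le_trans (ler_piMr _ tm) _ => //; rewrite lerDr.
split; split.
- by apply/measurable_EFinP; exact: measurable_int ir.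
- by exists C => x; exact: (hC x).1.
- by apply/measurable_EFinP; exact: measurable_int ii.
- by exists C => x; exact: (hC x).2.
Qed.

Lemma TS_harmonic k (P : mpoly d R[i]) : solid_harmonic k P ->
  forall x, T (sphere_restr P) x = (lambda k)%:C * sphere_restr P x.
Proof.
move=> hP x; have [br bi] := bmeasurable_sphere_restr P.
have H y j := cintegral_dot_harmonic y j hP.
have [_ Er] : S.-integrable setT (fun y => (K (x, y) * complex.Re (sphere_restr P y))%:E) /\
    rop S K (fun y => complex.Re (sphere_restr P y)) x = 2 * lambda k * complex.Re (sphere_restr P x).
  apply: (TS_eigenfunction a_range br) => y j.
    by have [[+ _] _] := H y j; apply: eq_integrable => // z _ /=; rewrite sdotX_Re.
  have [_ /(congr1 (@complex.Re R))] := H y j.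
  rewrite /cintegral /=; under eq_Rintegral do rewrite sdotX_Re.
  by move=> ->; rewrite /sharm; case: (sphere_restr P y) => u v; rewrite /= mul0r subr0.
have [_ Ei] : S.-integrable setT (fun y => (K (x, y) * complex.Im (sphere_restr P y))%:E) /\
    rop S K (fun y => complex.Im (sphere_restr P y)) x = 2 * lambda k * complex.Im (sphere_restr P x).
  apply: (TS_eigenfunction a_range bi) => y j.
    by have [[_ +] _] := H y j; apply: eq_integrable => // z _ /=; rewrite sdotX_Im.
  have [_ /(congr1 (@complex.Im R))] := H y j.
  rewrite /cintegral /=; under eq_Rintegral do rewrite sdotX_Im.
  by move=> ->; rewrite /sharm; case: (sphere_restr P y) => u v; rewrite /= mul0r addr0.
rewrite TS_ReIm /TSr Er Ei; case: (sphere_restr P x) => u v.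
by apply/eqP; rewrite eq_complex/= !mul0r subr0 addr0 -!mulrA !mulKf// !eqxx.
Qed.

Lemma L2_sphere_restr (p : mpoly d R[i]) : L2 S (sphere_restr p).
Proof.
have [[mr [C hC]] [mi [D hD]]] := bmeasurable_sphere_restr p.
have bnd (h : X -> R) B : measurable_fun setT h -> (forall x, `|h x| <= B) -> (sqn S h < +oo)%E.
  move=> mh hB; apply: (@le_lt_trans _ _ (sqn S (cst B))).
    by apply: le_sqn => // x; rewrite (le_trans (hB x))// ler_norm.
  by rewrite sqn_cst ltey_eq fin_numM// fin_num_measure.
by apply/L2P; split => //; split; [exact: bnd hC|exact: bnd hD].
Qed.

Let n_gt0 : (0 < n)%N.
Proof.
case: n a_range => // /andP[h1 h2]; exfalso.
by have := lt_trans h1 h2; lra.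
Qed.

(* The vector (1, i) of square 0, padded: in dimension at least 2 its powers
   provide a nonzero solid harmonic in every degree. *)
Let isotropic (i : 'I_d) : R[i] := if i == ord0 then 1 else if i == ord_max then 0 +i* 1 else 0.

Let sum_sqr_isotropic : \sum_i isotropic i ^+ 2 = 0.
Proof.
have m0 : (ord_max : 'I_d) != ord0 by rewrite -val_eqE /= -lt0n.
rewrite (bigD1 ord0)//= (bigD1 ord_max)//= big1 ?addr0 => [|i /andP[/negbTE i0 /negbTE im]]; last first.
  by rewrite /isotropic i0 im expr0n.
rewrite /isotropic eqxx (negbTE m0) eqxx expr1n.
by rewrite complex.sqr_i subrr.
Qed.

(** The Laplacian of (w.x)^k is k (k-1) (w.w) (w.x)^(k-2), and w.w = 0 for [isotropic]. *)
Lemma solid_harmonic_isotropic k : solid_harmonic k (dotp isotropic ^+ k : mpoly d R[i]).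
Proof.
split; first exact: homog_dotpX.
have E i : mderiv i (mderiv i (dotp isotropic ^+ k)) =
    isotropic i ^+ 2 *: ((k%:R * k.-1%:R) *: dotp isotropic ^+ k.-2).
  by rewrite mderiv_dotpX mderivZ mderiv_dotpX !scalerA; congr (_ *: _); ring.
by under eq_bigr do rewrite E; rewrite -scaler_suml sum_sqr_isotropic scale0r.
Qed.

(** The harmonic is 1 at the pole. If it vanished almost everywhere, its image would be 0 at the
    pole, because the integral depends only on the class of the function; but the image there is
    [lambda k], which is positive. *)
Lemma TS_eigenvalue k : L2_eigenvalue S T (lambda k)%:C.
Proof.
set P := (dotp isotropic ^+ k : mpoly d R[i]).
have hP : solid_harmonic k P by exact: solid_harmonic_isotropic.
exists (sphere_restr P); split.
- exact: L2_sphere_restr.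
- move=> P0; have := TS_harmonic hP (pole R n).
  have -> : sphere_restr P (pole R n) = 1.
    rewrite /sphere_restr rmorphXn /dotp raddf_sum (bigD1 ord0)//= big1 ?addr0 => [|i i0].
      by rewrite mevalZ mevalXU tnth_mktuple eqxx /isotropic eqxx mulr1 expr1n.
    by rewrite mevalZ mevalXU tnth_mktuple (negbTE i0) mulr0.
  have [[mr _] [mi _]] := bmeasurable_sphere_restr P.
  have z (h : X -> R) : measurable_fun setT h -> h = cst 0 %[ae S] -> TSr h (pole R n) = 0.
    move=> mh h0; rewrite /TSr (rop_ae_eq mK mh _ h0)// /rop.
    by under eq_Rintegral do rewrite mulr0; rewrite Rintegral_cst// mul0r mulr0.
  rewrite TS_ReIm (z _ mr) ?(z _ mi); last 2 first.
  + by apply: filterS P0 => x /= h _; rewrite h.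
  + by apply: filterS P0 => x /= h _; rewrite h.
  rewrite mulr1 => -[] /eqP; rewrite eq_sym => /eqP l0.
  by have := TS_lambda_gt0 a_range k; rewrite l0 ltxx.
- by apply: nearW => x _; exact: TS_harmonic.
Qed.

Lemma TS_opnorm : L2_opnorm S T = (lambda 0)%:E.
Proof.
have l0 := TS_lambda_gt0 a_range 0.
apply/eqP; rewrite eq_le; apply/andP; split.
  apply: ge_ereal_sup => _ [f [Lf f1] <-].
  have [mf _] := (L2P _ _).1 Lf.
  apply/le_L2norm; [exact: ltW|exact: cmeasurable_TS|].
  apply: le_trans (csqn_TS Lf) _.
  have f1' : (csqn S f <= 1)%E by have := (le_L2norm S ler01 mf).1 f1; rewrite expr1n.
  rewrite -[leRHS]mule1; apply: lee_wpmul2l => //.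
  by rewrite lee_fin sqr_ge0.
pose m := fine (S setT).
have mE : S setT = m%:E by rewrite fineK// fin_num_measure.
have sE (B : R) : sqn S (cst B) = (B ^+ 2 * m)%:E by rewrite sqn_cst (EFinM (B ^+ 2) m) -mE.
(* The area is the moment of order 0, whose closed form is positive. *)
have m0 : 0 < m.
  have := integral_sdotX (pole R n) 0.
  rewrite /Rintegral; under eq_integral do rewrite expr0.
  rewrite integral_cst// mul1e -/m => ->.
  rewrite /sharm gcoef0 mulr1 divr_gt0 ?mulr_gt0 ?exprn_gt0 ?sqrtr_gt0 ?pi_gt0//.
  by rewrite Gamma_pos_gt0// divr_gt0.
(* This constant function has norm 1, and its image, computed in degree 0, has norm [lambda 0]. *)
pose c := (Num.sqrt m)^-1.
have c2 : c ^+ 2 * m = 1 by rewrite exprVn sqr_sqrtr ?(ltW m0)// mulVf// gt_eqF.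
pose P := mpolyC d (c%:C : R[i]).
have PE x : sphere_restr P x = c%:C by rewrite /sphere_restr mevalC.
have hP : solid_harmonic 0 P.
  split; last by apply: big1 => i _; rewrite !mderivC.
  by have := @rpredZ _ _ _ c%:C _ (@dhomog1 d R[i] (@mdeg d)); rewrite -mul_mpolyC mulr1.
have LP := L2_sphere_restr P; have [mP _] := (L2P _ _).1 LP.
have csq : csqn S (sphere_restr P) = 1%E.
  rewrite /csqn (_ : (fun x => complex.Re _) = cst c); last by apply/funext => x; rewrite PE.
  rewrite (_ : (fun x => complex.Im _) = cst 0); last by apply/funext => x; rewrite PE.
  by rewrite !sE expr0n mul0r -EFinD addr0 c2.
have -> : (lambda 0)%:E = L2norm S (T (sphere_restr P)).
  rewrite L2normE; last exact: cmeasurable_TS.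
  rewrite /csqn (_ : (fun x => complex.Re _) = cst (lambda 0 * c)); last first.
    by apply/funext => x; rewrite (TS_harmonic hP) PE /= mul0r subr0.
  rewrite (_ : (fun x => complex.Im _) = cst 0); last first.
    by apply/funext => x; rewrite (TS_harmonic hP) PE /= mulr0 mul0r addr0.
  rewrite !sE expr0n mul0r -EFinD addr0 exprMn -mulrA c2 mulr1 poweR_EFin.
  by rewrite -powR_mulrn ?(ltW l0)// -powRrM mulfV// powRr1// ltW.
apply: ereal_sup_ubound; exists (sphere_restr P) => //; split => //.
by apply/le_L2norm => //; rewrite csq expr1n.
Qed.

Lemma TS_kernel_approx s : 0 < s -> exists (P : X * X -> R) (r : X * X -> \bar R),
  [/\ separated P, measurable_fun setT r /\ (forall z, (0 <= r z)%E),
      forall x y, r (x, y) = r (y, x),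
      forall x, (\int[S]_y r (x, y) <= s%:E)%E &
      forall z, (`|K z - P z|%:E <= r z)%E].
Proof.
move=> s0; set b := d%:R / 2 + a - 1.
have p0 : 0 < 2 `^ (- b) :> R by rewrite powR_gt0.
have [N hN] := TS_tau_small a_range (divr_gt0 s0 p0).
exists (TS_partial a N), (TS_tail a N); split.
- exact: separated_TS_partial.
- by split; [exact: measurable_TS_tail|exact: TS_tail_ge0].
- exact: TS_tailC.
- move=> x; apply: le_trans (integral_TS_tail a_range N x) _.
  apply: le_trans (lee_wpmul2l _ hN) _; first by rewrite lee_fin ltW.
  by rewrite -EFinM mulrC divfK// gt_eqF.
- exact: TS_approx.
Qed.

(** One ultrafilter serves the real and the imaginary parts, hence so does one subsequence. The
    index [u m] is taken in [A 0], ..., [A m] at once and beyond the previous one; consecutive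
    images are then within 16^-m in squared norm, as [riesz_fischer] requires. *)
Lemma TS_compact : L2_compact S T.
Proof.
split; first exact: TS_linear.
move=> f Lf [M fM].
have M0 : 0 <= M by rewrite -lee_fin; apply: le_trans (fM 0%N); exact: Lnorm_ge0.
have mf j : cmeasurable (f j) by have [] := (L2P _ _).1 (Lf j).
pose fr j x := complex.Re (f j x); pose fi j x := complex.Im (f j x).
have mr j : measurable_fun setT (fr j) by exact: (mf j).1.
have mi j : measurable_fun setT (fi j) by exact: (mf j).2.
have cM j : (csqn S (f j) <= (M ^+ 2)%:E)%E by exact/le_L2norm.
have rM j : (sqn S (fr j) <= (M ^+ 2)%:E)%E.
  by apply: le_trans (cM j); rewrite /csqn leeDl// sqn_ge0.
have iM j : (sqn S (fi j) <= (M ^+ 2)%:E)%E.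
  by apply: le_trans (cM j); rewrite /csqn leeDr// sqn_ge0.
have [U [UU subU]] := ultraFilterLemma (@eventually_filter : ProperFilter \oo).
have e0 m : 0 < 16^-1 ^+ m :> R by rewrite exprn_gt0.
have /choice[A hA] : forall m, exists A : set nat, U A /\ forall i j, A i -> A j ->
    (sqn S (rop S K (fun y => fr i y - fr j y)%R) <= (16^-1 ^+ m)%:E)%E /\
    (sqn S (rop S K (fun y => fi i y - fi j y)%R) <= (16^-1 ^+ m)%:E)%E.
  move=> m.
  have [A1 U1 H1] := ultra_rop_cauchy mK TS_kernel_approx mr rM UU (e0 m).
  have [A2 U2 H2] := ultra_rop_cauchy mK TS_kernel_approx mi iM UU (e0 m).
  exists (A1 `&` A2); split; first exact: filterI.
  by move=> i j [i1 i2] [j1 j2]; split; [exact: H1|exact: H2].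
(* [U] refines the filter of cofinite sets, so its members contain arbitrarily large indices, also
   after finite intersections. *)
have pick m N : exists j, (N <= j)%N /\ forall k : 'I_m.+1, A k j.
  have UN : U [set j | (N <= j)%N] by apply: subU; exists N.
  have UA : U [set j | forall k : 'I_m.+1, A k j].
    by apply: filter_forall => k; exact: (hA k).1.
  by have [j [? ?]] := filter_ex (filterI UN UA); exists j.
have /choice[g hg] : forall mN : nat * nat, exists j, (mN.2 <= j)%N /\ forall k : 'I_mN.1.+1, A k j.
  by move=> [m N]; exact: pick.
pose u := fix u m := if m is m'.+1 then g (m'.+1, (u m').+1) else g (0%N, 0%N).
have uS m : (u m < u m.+1)%N by exact: (hg (m.+1, (u m).+1)).1.
have uA m k : (k <= m)%N -> A k (u m).
  move=> km; have km' : (k < m.+1)%N by [].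
  by case: m km km' => [|m] km km'; [exact: ((hg (0%N, 0%N)).2 (Ordinal km'))|
    exact: ((hg (m.+1, (u m).+1)).2 (Ordinal km'))].
(* The image of a difference is the difference of the images only almost everywhere, which squared
   norms do not see; the factor 1/2 of [TSr] is bounded by 1. *)
have diff (h : nat -> X -> R) : (forall j, measurable_fun setT (h j)) ->
    (forall j, (sqn S (h j) <= (M ^+ 2)%:E)%E) -> forall m,
    (sqn S (rop S K (fun y => h (u m.+1) y - h (u m) y)%R) <= (16^-1 ^+ m)%:E)%E ->
    (sqn S (fun x => TSr (h (u m.+1)) x - TSr (h (u m)) x)%R <= (16^-1 ^+ m)%:E)%E.
  move=> mh hM m H.
  have hoo j : (sqn S (h j) < +oo)%E by apply: le_lt_trans (hM j) _; exact: ltry.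
  have mT j : measurable_fun setT (TSr (h j)) by exact: measurable_TSr.
  have md : measurable_fun setT (fun y => h (u m.+1) y - h (u m) y) by exact: measurable_funB.
  rewrite (@sqn_ae_eq _ _ _ S _ (TSr (fun y => h (u m.+1) y - h (u m) y))); last 3 first.
  - exact: measurable_funB.
  - exact: measurable_TSr.
  - apply: filterS (rop_comb 1 (-1) (mh (u m.+1)) (mh (u m)) (hoo _) (hoo _)) => x.
    have -> : (fun y => 1 * h (u m.+1) y + -1 * h (u m) y) = (fun y => h (u m.+1) y - h (u m) y).
      by apply/funext => y; rewrite mul1r mulN1r.
    by move=> ->; rewrite mul1r mulN1r.
  rewrite /TSr sqnZ; last exact: measurable_rop.
  apply: le_trans H; rewrite -[leRHS]mul1e; apply: lee_wpmul2r; first exact: sqn_ge0.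
  by rewrite lee_fin exprn_ile1// invf_le1// ler1n.
have [gr mgr hgr] := riesz_fischer (fun m => measurable_TSr (mr (u m)))
  (fun m => diff fr mr rM m ((hA m).2 _ _ (uA m.+1 m (leqnSn m)) (uA m m (leqnn m))).1).
have [gi mgi hgi] := riesz_fischer (fun m => measurable_TSr (mi (u m)))
  (fun m => diff fi mi iM m ((hA m).2 _ _ (uA m.+1 m (leqnSn m)) (uA m m (leqnn m))).2).
(* The limit is square integrable because it lies at finite distance from the first image. *)
have lim_oo (h : nat -> X -> R) (l : X -> R) : (forall j, measurable_fun setT (h j)) ->
    (forall j, (sqn S (h j) <= (M ^+ 2)%:E)%E) -> measurable_fun setT l ->
    (sqn S (fun x => TSr (h (u 0%N)) x - l x)%R <= (8 * 4^-1 ^+ 0)%:E)%E -> (sqn S l < +oo)%E.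
  move=> mh hM ml H.
  have mT : measurable_fun setT (TSr (h (u 0%N))) by exact: measurable_TSr.
  have md : measurable_fun setT (fun x => TSr (h (u 0%N)) x - l x) by exact: measurable_funB.
  have md1 : measurable_fun setT (fun x => -1 * (TSr (h (u 0%N)) x - l x)) by exact: measurable_funM.
  have -> : l = (fun x => TSr (h (u 0%N)) x + -1 * (TSr (h (u 0%N)) x - l x)).
    by apply/funext => x; ring.
  apply: le_lt_trans (sqnD S mT md1) _; rewrite (sqnZ S (-1) md) sqrrN expr1n mul1e.
  have hoo j : (sqn S (h j) < +oo)%E by apply: le_lt_trans (hM j) _; exact: ltry.
  rewrite ltey_eq fin_numM// fin_numD !ge0_fin_numE ?sqn_ge0//.
  rewrite (le_lt_trans H) ?ltry// andbT (le_lt_trans (sqn_TSr (mh _) (hoo _)))//.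
  by rewrite ltey_eq fin_numM// ge0_fin_numE ?sqn_ge0.
exists u, (fun x => gr x +i* gi x); split.
- by apply: homo_ltn => // y x z; exact: ltn_trans.
- apply/L2P; split; first by split.
  by split; [exact: lim_oo mr rM mgr (hgr 0%N)|exact: lim_oo mi iM mgi (hgi 0%N)].
(* Each part contributes at most 8 times 4^-j to the squared norm, and 16 times 4^-j is the square
   of 4 times 2^-j. *)
have bound j : (L2norm S (fun x => T (f (u j)) x - (gr x +i* gi x))%R <= (4 * 2^-1 ^+ j)%:E)%E.
  apply/le_L2norm; first by rewrite mulr_ge0// exprn_ge0.
    rewrite TS_ReIm; split.
      exact: (measurable_funB (measurable_TSr (mr (u j))) mgr).
    exact: (measurable_funB (measurable_TSr (mi (u j))) mgi).
  rewrite /csqn TS_ReIm /=.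
  apply: le_trans (leeD (hgr j) (hgi j)) _; rewrite -EFinD lee_fin.
  rewrite exprMn -exprM mulnC exprM.
  have -> : 2^-1 ^+ 2 = 4^-1 :> R by field.
  by rewrite le_eqVlt; apply/orP; left; apply/eqP; ring.
have c0 : (4 * 2^-1 ^+ j)%:E @[j --> \oo] --> (0%:E : \bar R).
  apply/fine_cvgP; split; first exact: nearW.
  have z : 4 * 0 = 0 :> R by rewrite mulr0.
  rewrite -[X in _ --> X]z; apply: cvgMl_tmp; apply: cvg_expr.
  by rewrite ger0_norm// invf_lt1// ltr1n.
apply: (squeeze_cvge _ (cvg_cst 0%E) c0).
by apply: nearW => j; rewrite bound Lnorm_ge0.
Qed.

End sphere_spectrum.

Theorem theorem1p6 (R : realType) (n : nat) (a : R) :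
  let d := n.+1 in
  let sigma := @surface_measure R n in
  let T := @TS R n a in
  let lambda := TS_lambda n a in
  (2 <= d)%N -> 1 - d%:R / 2 < a < 1 / 2 ->
  (* the integral defining T f converges almost everywhere *)
  (forall f, L2 sigma f -> \forall omega \ae sigma,
     cintegrable sigma (fun theta => (TS_kernel a omega theta)%:C * f theta)) /\
  L2_compact sigma T /\
  (forall (k : nat) (P : mpoly d R[i]), solid_harmonic k P ->
     forall omega : sphere R n,
       T (sphere_restr P) omega = (lambda k)%:C * sphere_restr P omega) /\
  (forall k, L2_eigenvalue sigma T (lambda k)%:C) /\
  decreasing_seq lambda /\
  lambda @ \oo --> (0 : R) /\
  L2_opnorm sigma T =
    (pi `^ ((d%:R - 1) / 2) / 2 `^ (2 * a)
      * (Gamma (1 / 2 - a) / Gamma (- a + d%:R / 2)))%:E.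
Proof.
move=> d sigma T lambda _ ha.
split; first by move=> f; exact: TS_cintegrable.
split; first exact: TS_compact.
split; first by move=> k P hP x; exact: TS_harmonic.
split; first by move=> k; exact: TS_eigenvalue.
split; first exact: TS_lambda_decreasing.
split; first exact: cvg_TS_lambda.
by rewrite -(TS_lambda0 ha); exact: TS_opnorm.
Qed.
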